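(* Let $p>0$ be a prime. Suppose that $M$ is a finite monoid such that the left stabilizer of every element of $M$ is a $p'$-monoid (or, dually, such that the right stabilizer of every element of $M$ is a $p'$-monoid). If $C(\mathbb CM)$ is nonsingular, then $C(kM)$ is nonsingular for any field $k$ of characteristic $p$.
   Context: For $a\in M$, the left stabilizer is the submonoid $\mathrm{Stab}_L(a)=\{m\in M\mid ma=a\}$ and the right stabilizer is $\mathrm{Stab}_R(a)=\{m\in M\mid am=a\}$. For an element $m$ of a finite monoid, let $i\ge 0$, $k>0$ be least with $m^i=m^{i+k}$; $k$ is the period of $m$. A finite monoid is a $p'$-monoid if no element of it has period divisible by $p$. For a finite dimensional algebra $A$ over a field, let $P_1,\ldots,P_n$ represent the isomorphism classes of projective indecomposable left $A$-modules and $S_i=P_i/\mathrm{rad}\,P_i$. The Cartan matrix $C(A)$ is the $n\times n$ integer matrix with $C(A)_{ij}$ the multiplicity of $S_i$ as a composition factor of $P_j$. $kM$ denotes the monoid algebra. *)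

(* Defs.v *)
From HB Require Import structures.
From mathcomp Require Import all_boot all_algebra all_field.
From mathcomp Require Import ring_quotient generic_quotient.
From mathcomp Require Import complex boolp classical_sets reals.

Set Implicit Arguments.
Unset Strict Implicit.
Unset Printing Implicit Defensive.

Import GRing.Theory.

#[short(type="finMonoidType")]
HB.structure Definition FinMonoid := {M of Finite M & Monoid M}.

Section FiniteMonoid.
Local Open Scope group_scope.
Variable M : finMonoidType.
Implicit Types (a m : M) (N : {set M}).

Definition lstab a : {set M} := [set m | m * a == a].
Definition rstab a : {set M} := [set m | a * m == a].

Definition index_period m (i k : nat) : Prop :=
  [/\ (0 < k)%N, m ^+ i = m ^+ (i + k) &
      forall i' k', (0 < k')%N -> m ^+ i' = m ^+ (i' + k') ->
        (i <= i')%N /\ (k <= k')%N].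

(* Powers in a submonoid are powers in [M], so periods may be computed in [M]. *)
Definition p'_monoid (p : nat) N : Prop :=
  forall m, m \in N -> forall i k, index_period m i k -> ~~ (p %| k)%N.

End FiniteMonoid.

Local Open Scope ring_scope.

(* An alias of [{ffun M -> k^o}], so that the convolution product below does not
   clash with the pointwise one. *)
Definition monoid_algebra (k : fieldType) (M : finMonoidType) := {ffun M -> k^o}.

Section MonoidAlgebra.
Variables (k : fieldType) (M : finMonoidType).
Local Notation kM := (monoid_algebra k M).

HB.instance Definition _ := Vector.on kM.

Implicit Types f g h : kM.

Definition malg_one : kM := [ffun m : M => (m == 1%g)%:R].
Definition malg_mul f g : kM :=
  [ffun m : M => \sum_(x : M) \sum_(y : M | (x * y)%g == m) f x * g y].

Lemma malg_mul_sum f g (F : M -> k^o) :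
  \sum_m malg_mul f g m * F m = \sum_x \sum_y f x * g y * F (x * y)%g.
Proof.
under eq_bigr => m _ do rewrite ffunE big_distrl /=.
rewrite exchange_big; apply: eq_bigr => x _ /=.
under eq_bigr => m _ do rewrite big_distrl /=.
rewrite (exchange_big_dep predT) //=; apply: eq_bigr => y _.
under eq_bigl => m do rewrite eq_sym.
by rewrite big_pred1_eq.
Qed.

Lemma malg_mulE f g m :
  malg_mul f g m = \sum_x \sum_y f x * g y * ((x * y)%g == m)%:R.
Proof.
rewrite ffunE; apply: eq_bigr => x _; rewrite big_mkcond; apply: eq_bigr => y _.
by case: eqP; rewrite ?mulr1 ?mulr0.
Qed.

Lemma malg_mulA : associative malg_mul.
Proof.
move=> f g h; apply/ffunP => m; rewrite !malg_mulE.
under [RHS]eq_bigr => u _.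
  under eq_bigr => z _ do rewrite -mulrA.
  rewrite -big_distrr /=.
  over.
rewrite malg_mul_sum; apply: eq_bigr => x _.
under eq_bigr => u _ do rewrite mulrAC mulrC.
rewrite malg_mul_sum; apply: eq_bigr => y _.
rewrite big_distrr; apply: eq_bigr => z _ /=.
by rewrite mulgA -!mulrA [RHS]mulrCA; congr (_ * _); rewrite mulrCA.
Qed.

Lemma malg_mul1 : left_id malg_one malg_mul.
Proof.
move=> f; apply/ffunP => m; rewrite ffunE (bigD1 1%g) //= [X in _ + X]big1.
  rewrite addr0 (big_pred1 m) => [|y]; last by rewrite /= mul1g.
  by rewrite ffunE eqxx mul1r.
by move=> x /negbTE x1; rewrite big1 // => y _; rewrite ffunE x1 mul0r.
Qed.

Lemma malg_mulr1 : right_id malg_one malg_mul.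
Proof.
move=> f; apply/ffunP => m; rewrite malg_mulE exchange_big (bigD1 1%g) //=.
rewrite [X in _ + X]big1 => [|y /negbTE y1]; last first.
  by rewrite big1 // => x _; rewrite ffunE y1 mulr0 mul0r.
rewrite addr0 (bigD1 m) //= big1 => [|x /negbTE xm].
  by rewrite mulg1 ffunE !eqxx !mulr1 addr0.
by rewrite mulg1 xm mulr0.
Qed.

Lemma malg_mulDl : left_distributive malg_mul +%R.
Proof.
move=> f g h; apply/ffunP => m; rewrite !ffunE -big_split; apply: eq_bigr => x _.
by rewrite -big_split; apply: eq_bigr => y _; rewrite ffunE mulrDl.
Qed.

Lemma malg_mulDr : right_distributive malg_mul +%R.
Proof.
move=> f g h; apply/ffunP => m; rewrite !ffunE -big_split; apply: eq_bigr => x _.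
by rewrite -big_split; apply: eq_bigr => y _; rewrite ffunE mulrDr.
Qed.

Lemma malg_one_neq0 : malg_one != 0.
Proof. by apply/eqP => /ffunP/(_ 1%g)/eqP; rewrite !ffunE eqxx oner_eq0. Qed.

HB.instance Definition _ := GRing.Zmodule_isNzRing.Build kM
  malg_mulA malg_mul1 malg_mulr1 malg_mulDl malg_mulDr malg_one_neq0.

Lemma malg_scaleAl (a : k) f g : a *: (f * g) = (a *: f) * g.
Proof.
apply/ffunP => m; rewrite !ffunE scaler_sumr; apply: eq_bigr => x _.
by rewrite scaler_sumr; apply: eq_bigr => y _; rewrite ffunE -scalerAl.
Qed.

Lemma malg_scaleAr (a : k) f g : a *: (f * g) = f * (a *: g).
Proof.
apply/ffunP => m; rewrite !ffunE scaler_sumr; apply: eq_bigr => x _.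
by rewrite scaler_sumr; apply: eq_bigr => y _; rewrite ffunE -scalerAr.
Qed.

HB.instance Definition _ := GRing.Lmodule_isLalgebra.Build k kM malg_scaleAl.
HB.instance Definition _ := GRing.Lalgebra_isAlgebra.Build k kM malg_scaleAr.
HB.instance Definition _ := Algebra_isFalgebra.Build k kM.

End MonoidAlgebra.

Section Submodules.
Variables (A : nzRingType) (V : lmodType A).
Implicit Types U W : submodClosed V.

Record submodule U := Submodule {submod_val : V; _ : submod_val \in U}.
HB.instance Definition _ U := [isSub for @submod_val U].
HB.instance Definition _ U := [Choice of submodule U by <:].
HB.instance Definition _ U := [SubChoice_isSubLmodule of submodule U by <:].

(* Over a ring a [submodClosed] predicate is also closed under opposites, but
   the library does not infer the [zmodClosed] structure that quotients need. *)
Definition zmod_of_submod U : {pred V} := U.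
HB.instance Definition _ U := GRing.isZmodClosed.Build V (zmod_of_submod U)
  (GRing.submod_closedB (GRing.submodClosedP U)).

Definition quotmod U := Quotient.quot (zmod_of_submod U).
HB.instance Definition _ U := GRing.Zmodule.on (quotmod U).

Section Scaling.
Variable U : submodClosed V.

Definition quotmod_pi (x : V) : quotmod U := \pi_(Quotient.quot (zmod_of_submod U))%qT x.

Definition quotmod_scale (a : A) (u : quotmod U) : quotmod U :=
  quotmod_pi (a *: repr (u : Quotient.quot (zmod_of_submod U))).

Lemma quotmod_piP x y : quotmod_pi x = quotmod_pi y <-> x - y \in U.
Proof.
rewrite -[x - y \in U]/(x - y \in zmod_of_submod U) Quotient.idealrBE.
by split => [/eqP|/eqP].
Qed.

Lemma quotmod_piK u : quotmod_pi (repr (u : Quotient.quot (zmod_of_submod U))) = u.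
Proof. exact: reprK. Qed.

Lemma quotmod_piD x y : quotmod_pi (x + y) = quotmod_pi x + quotmod_pi y.
Proof. exact: (raddfD \pi_(Quotient.quot (zmod_of_submod U))%qT). Qed.

Lemma quotmod_scale_pi a x :
  quotmod_scale a (quotmod_pi x) = quotmod_pi (a *: x).
Proof.
apply/quotmod_piP; rewrite -scalerBr rpredZ //.
by apply/quotmod_piP; rewrite quotmod_piK.
Qed.

Lemma quotmod_scaleA a b u :
  quotmod_scale a (quotmod_scale b u) = quotmod_scale (a * b) u.
Proof. by rewrite -[u]quotmod_piK !quotmod_scale_pi scalerA. Qed.

Lemma quotmod_scale1 : left_id 1 quotmod_scale.
Proof. by move=> u; rewrite -[u]quotmod_piK quotmod_scale_pi scale1r. Qed.

Lemma quotmod_scaleDr : right_distributive quotmod_scale +%R.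
Proof.
move=> a u v; rewrite -[u]quotmod_piK -[v]quotmod_piK -quotmod_piD.
by rewrite !quotmod_scale_pi scalerDr quotmod_piD.
Qed.

Lemma quotmod_scaleDl u : {morph quotmod_scale^~ u : a b / a + b}.
Proof.
by move=> a b; rewrite -[u]quotmod_piK !quotmod_scale_pi scalerDl quotmod_piD.
Qed.

HB.instance Definition _ := GRing.Zmodule_isLmodule.Build A (quotmod U)
  quotmod_scaleA quotmod_scale1 quotmod_scaleDr quotmod_scaleDl.

End Scaling.

Definition maximal_submod U : Prop :=
  ~ U =i predT /\
  forall W, {subset U <= W} -> W =i U \/ W =i predT.

Definition mod_rad : {pred V} :=
  fun x => `[< forall U, maximal_submod U -> x \in U >].

Lemma mod_rad_submod_closed : submod_closed mod_rad.
Proof.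
split=> [|a x y /asboolP xr /asboolP yr]; apply/asboolP => U maxU.
  exact: rpred0.
by rewrite rpredD ?rpredZ ?xr ?yr.
Qed.

HB.instance Definition _ :=
  GRing.isSubmodClosed.Build A V mod_rad mod_rad_submod_closed.

Definition simple_mod : Prop :=
  (exists x : V, x != 0) /\ forall U, U =i pred1 0 \/ U =i predT.

Definition indecomposable_mod : Prop :=
  (exists x : V, x != 0) /\
  forall U W, (forall x, x \in U -> x \in W -> x = 0) ->
    (forall x, exists2 u, u \in U & exists2 w, w \in W & x = u + w) ->
  U =i pred1 0 \/ W =i pred1 0.

Definition finitely_generated : Prop :=
  exists (n : nat) (v : 'I_n -> V),
    forall x, exists a : 'I_n -> A, x = \sum_i a i *: v i.

Definition projective_mod : Prop :=
  forall (X Y : lmodType A) (g : {linear X -> Y}) (f : {linear V -> Y}),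
    (forall y, exists x, g x = y) ->
  exists h : {linear V -> X}, forall v, g (h v) = f v.

(* [trace_in W U] is the intersection of [W] with [U], as a submodule of [U]. *)
Definition trace_in W U : {pred submodule U} := [pred x | val x \in W].
Arguments trace_in : clear implicits.

Lemma trace_in_submod_closed W U : submod_closed (trace_in W U).
Proof.
split=> [|a x y]; rewrite !inE /= ?rpred0 // => xW yW.
by rewrite rpredD ?rpredZ.
Qed.

HB.instance Definition _ W U :=
  GRing.isSubmodClosed.Build A (submodule U) (trace_in W U)
    (trace_in_submod_closed W U).

End Submodules.

Arguments trace_in {A V} W U _.

(* U / W when W is contained in U, and U / (U :&: W) in general. *)
Definition subquotient (A : nzRingType) (V : lmodType A)
  (U W : submodClosed V) : lmodType A := quotmod (trace_in W U).

Definition isomorphic_mod (A : nzRingType) (V W : lmodType A) : Prop :=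
  exists f : {linear V -> W}, bijective f.

Section Cartan.
Variables (F : fieldType) (A : falgType F).
Implicit Types V P S : lmodType A.

Definition pim P : Prop :=
  [/\ finitely_generated P, projective_mod P & indecomposable_mod P].

(* Only [U 0], ..., [U n] matter. *)
Definition composition_series V (n : nat) (U : nat -> submodClosed V) : Prop :=
  [/\ U 0 =i pred1 0, U n =i predT &
      forall i, (i < n)%N ->
        {subset U i <= U i.+1} /\ simple_mod (subquotient (U i.+1) (U i))].

(* Independent of the composition series by the Jordan-Hoelder theorem; the
   default value 0 is used only if [V] has no composition series. *)
Definition composition_multiplicity V S : nat :=
  xget 0%N [set m | exists (n : nat) (U : nat -> submodClosed V),
    composition_series n U /\
    m = (\sum_(i < n) `[< isomorphic_mod (subquotient (U i.+1) (U i)) S >])%N].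

Definition represents_pims n (P : 'I_n -> lmodType A) : Prop :=
  [/\ forall i, pim (P i),
      forall i j, isomorphic_mod (P i) (P j) -> i = j &
      forall Q : lmodType A, pim Q -> exists i, isomorphic_mod Q (P i)].

Definition mod_top P : lmodType A := quotmod (mod_rad (V := P)).

(* The Cartan matrix with respect to chosen representatives [P]; another choice
   changes it by a simultaneous permutation of rows and columns. *)
Definition cartan_matrix n (P : 'I_n -> lmodType A) : 'M[int]_n :=
  \matrix_(i, j) (composition_multiplicity (P j) (mod_top (P i)))%:Z.

End Cartan.

(* Main.v *)
(* For a, b in M let X(a, b) be the number of x with a x b = x; extended
   linearly, X(a, e) is the trace of a on (kM)e for an idempotent e of kM. By
   passing to the opposite monoid only left stabilizers matter.

   Over C, nonsingularity of the Cartan matrix of the opposite monoid puts all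
   characters into the span of the functions X(y, -), and Green's relations then
   show that all class functions are in this span. After clearing denominators:
   for some integer D <> 0, D times the indicator of any class is an integral
   combination of the X(y, -).

   In characteristic p, let O be a torsion-free ring with a surjection O -> k of
   kernel I and a lift of Frobenius. The trace of the p^N-th power of a lifted
   matrix is well defined modulo I^(N+1) and additive in short exact sequences.
   If v is an integer vector killed by the Cartan matrix and Q_j = (kM)e_j, then
     sum_j v_j X(a^(p^N), e_j^(p^N)) = 0  modulo I^(N+1)  for all a in M.
   If a has, from some exponent on, a period prime to p, then X(a^(p^N), -) =
   X(a, -) for suitable N. Otherwise no x is fixed by a^(p^N - 1), because the
   stabilizer of x is a p'-monoid; rotating words then shows that X(a, u^(p^N))
   is in I^(N+1) for all u in O[M]. Hence sum_j v_j X(a, e_j^(p^N)) is in I^(N+1)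
   for all a, and D sum_j v_j f(e_j^(p^N)) for all class functions f.

   Take f(b) to be the power trace of b on the simple top of Q_i: it is a class
   function, and f(e_j^(p^N)) is congruent to the rank of e_j on this top, which
   is nonzero exactly for j = i. So D v_i times a fixed positive integer lies in
   arbitrarily high powers of I. But an integer in all powers of I is 0, since
   the derivation x |-> (phi x - x^p)/p maps I^(n+1) to I^n; thus v = 0. *)

Require Import Defs.
From HB Require Import structures.
From mathcomp Require Import all_boot all_fingroup all_algebra all_field.
From mathcomp Require Import ring_quotient generic_quotient cyclic.
From mathcomp Require Import complex boolp classical_sets reals.
From mathcomp Require Import zify ring.
From mathcomp Require finmap monalg.

Set Implicit Arguments.
Unset Strict Implicit.
Unset Printing Implicit Defensive.

Import GRing.Theory.
Local Open Scope ring_scope.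

(** * Modules over a finite-dimensional algebra *)

Section Modules.
Variable A : nzRingType.
Implicit Types V W X Y Z : lmodType A.

(** Over [k] itself, traces see an integral relation between characters only modulo [p], while the
    factor [D] coming from characteristic zero may be divisible by [p]; no fixed precision suffices,
    whence the arbitrarily high powers of I. The field [k] is arbitrary, possibly imperfect and not
    a splitting field, so Brauer characters with values in Witt vectors are not directly available;
    a polynomial ring with an explicit Frobenius lift takes their place. It is not complete, and
    idempotents of [kM] need not lift to it. Instead, any lift of the coefficients is raised to the
    power [p ^ N], and only the trace of this power, not the power itself, is determined to
    precision [N + 1]. This is why words appear everywhere: the trace is invariant under rotation,
    and the sizes of the orbits of words under rotation supply the missing factors [p]. As simple
    modules may have large endomorphism rings, the dimension of [e_i] times the top of [Q_i] occurs
    as a nonzero factor that may differ from 1. *)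

Lemma linear_fun V W (f : V -> W) : linear f -> {g : {linear V -> W} | g =1 f}.
Proof.
move=> lf; pose m := GRing.isLinear.Build A V W _ f lf.
by exists (HB.pack_for {linear V -> W} f m).
Qed.

Lemma submod_of V (S : V -> Prop) :
    S 0 -> (forall a x y, S x -> S y -> S (a *: x + y)) ->
  {U : submodClosed V | forall x, x \in U <-> S x}.
Proof.
move=> S0 Slin; pose U : {pred V} := fun x => `[< S x >].
have clU : submod_closed U.
  split=> [|a x y]; first exact/asboolP.
  by move=> /asboolP Sx /asboolP Sy; apply/asboolP/Slin.
pose m := GRing.isSubmodClosed.Build A V U clU.
exists (HB.pack_for (submodClosed V) U m) => x.
by split => [/asboolP|/asboolP].
Qed.

Lemma inj_surj_bij (T U : Type) (f : T -> U) :
  injective f -> (forall y, exists x, f x = y) -> bijective f.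
Proof.
move=> fI fS; have [g fg] := choice fS.
by exists g => // x; apply: fI; rewrite fg.
Qed.

Lemma submodB V (U : submodClosed V) x y : x \in U -> y \in U -> x - y \in U.
Proof. by move=> xU yU; rewrite -scaleN1r rpredD // rpredZ. Qed.

Definition short_exact X Y Z (f : {linear X -> Y}) (g : {linear Y -> Z}) :=
  [/\ injective f, forall z, exists y, g y = z &
      forall y, g y = 0 <-> exists x, y = f x].

Lemma isomorphic_sym V W : isomorphic_mod V W -> isomorphic_mod W V.
Proof.
case=> f [g fK gK]; have lg : linear g.
  by move=> a x y; apply: (can_inj fK); rewrite linearP !gK.
by have [h hE] := linear_fun lg; exists h; exists f => x; rewrite hE ?fK ?gK.
Qed.

Lemma isomorphic_refl V : isomorphic_mod V V.
Proof. by have [h hE] := @linear_fun V V id (fun _ _ _ => erefl); exists h; exists h => x; rewrite !hE. Qed.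

Lemma isomorphic_trans V W X :
  isomorphic_mod V W -> isomorphic_mod W X -> isomorphic_mod V X.
Proof.
move=> [f bf] [g bg].
have [h hE] := @linear_fun V X (g \o f) (fun a x y => linearP (g \o f) a x y).
by exists h; exact: eq_bij (bij_comp bg bf) _ (fun x => esym (hE x)).
Qed.

Lemma isoP V W (f : {linear V -> W}) :
  (forall x, f x = 0 -> x = 0) -> (forall y, exists x, f x = y) -> isomorphic_mod V W.
Proof.
move=> fI fS; exists f; apply: inj_surj_bij fS => x y fxy; apply/eqP.
by rewrite -subr_eq0; apply/eqP/fI; rewrite linearB fxy subrr.
Qed.

Lemma submod_val_lin V (U : submodClosed V) (a : A) (x y : submodule U) :
  val (a *: x + y) = a *: val x + val y.
Proof. by []. Qed.

Lemma submod_inj V (U : submodClosed V) : {f : {linear submodule U -> V} | f =1 val}.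
Proof. exact: linear_fun. Qed.

Lemma submod_incl V (U W : submodClosed V) : {subset U <= W} ->
  {f : {linear submodule U -> submodule W} | forall x, val (f x) = val x}.
Proof.
move=> sUW; pose f (x : submodule U) : submodule W := Submodule (sUW _ (valP x)).
have lf : linear f by move=> a x y; apply: val_inj.
by have [g gE] := linear_fun lf; exists g => x; rewrite gE.
Qed.

Lemma quotmod_piS V (U : submodClosed V) : {f : {linear V -> quotmod U} | f =1 @quotmod_pi A V U}.
Proof.
apply: linear_fun => a x y.
by rewrite quotmod_piD -quotmod_scale_pi.
Qed.

Lemma quotmod_surj V (U : submodClosed V) (q : quotmod U) : exists x, q = quotmod_pi U x.
Proof. by exists (repr (q : Quotient.quot (zmod_of_submod U))); rewrite quotmod_piK. Qed.

Lemma quotmod_pi_eq0 V (U : submodClosed V) x : quotmod_pi U x = 0 <-> x \in U.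
Proof.
have [f fE] := quotmod_piS U; rewrite -fE -(linear0 f) !fE.
by rewrite quotmod_piP subr0.
Qed.

Lemma quotmod_lift V W (U : submodClosed V) (g : {linear V -> W}) :
    (forall x, x \in U -> g x = 0) ->
  {h : {linear quotmod U -> W} | forall x, h (quotmod_pi U x) = g x}.
Proof.
move=> gU; pose h (q : quotmod U) := g (repr (q : Quotient.quot (zmod_of_submod U))).
have hE x : h (quotmod_pi U x) = g x.
  apply/eqP; rewrite -subr_eq0 -linearB; apply/eqP/gU.
  by apply/quotmod_piP; rewrite quotmod_piK.
have lh : linear h.
  move=> a q q'; have [x ->] := quotmod_surj q; have [y ->] := quotmod_surj q'.
  have [f fE] := quotmod_piS U.
  by rewrite -!fE -linearP fE !(fE,hE) linearP.
by have [k kE] := linear_fun lh; exists k => x; rewrite kE hE.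
Qed.

End Modules.

(** * Bases over the ground field for modules and their subspaces *)

Section Coordinates.
Variables (F : fieldType) (A : falgType F).
Implicit Types V W X Y Z : lmodType A.

(** [V] is only an [A]-module, so [F] acts on it through the scalars [c%:A]. *)
Definition F_linear d V (t : 'rV[F]_d -> V) :=
  forall c x y, t (c *: x + y) = c%:A *: t x + t y.

Section FLinear.
Variables (d : nat) (V : lmodType A) (t : 'rV[F]_d -> V).
Hypothesis tL : F_linear t.

Lemma F_linearD x y : t (x + y) = t x + t y.
Proof. by rewrite -[x]scale1r tL !scale1r. Qed.

Lemma F_linear0 : t 0 = 0.
Proof. by apply: (addrI (t 0)); rewrite -F_linearD !addr0. Qed.

Lemma F_linearZ c x : t (c *: x) = c%:A *: t x.
Proof. by rewrite -[c *: x]addr0 tL F_linear0 addr0. Qed.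

Lemma F_linearN x : t (- x) = - t x.
Proof. by rewrite -[- x]scaleN1r F_linearZ !scaleN1r. Qed.

Lemma F_linear_sum (I : Type) (r : seq I) (P : pred I) (f : I -> 'rV_d) :
  t (\sum_(i <- r | P i) f i) = \sum_(i <- r | P i) t (f i).
Proof. exact: (big_morph t F_linearD F_linear0). Qed.

Lemma F_linear_inj : (forall x, t x = 0 -> x = 0) -> injective t.
Proof.
move=> t0 x y txy; apply/eqP; rewrite -subr_eq0; apply/eqP/t0.
by rewrite F_linearD F_linearN txy subrr.
Qed.

End FLinear.

Lemma F_linear_rows m V (w : 'I_m -> V) :
  {t : 'rV[F]_m -> V | F_linear t & forall i, t (delta_mx 0 i) = w i}.
Proof.
exists (fun x => \sum_i (x 0 i)%:A *: w i) => [c x y|i].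
  rewrite scaler_sumr -big_split; apply: eq_bigr => i _ /=.
  by rewrite !mxE scalerA -scalerDl mulr_algl scalerA -scalerDl.
rewrite (bigD1 i) //= big1 ?mxE ?eqxx ?scale1r ?addr0 ?scale1r // => j ji.
by rewrite mxE eqxx (negbTE ji) !scale0r.
Qed.

Lemma F_linear_mulmx d m V (t : 'rV[F]_d -> V) (B : 'M_(m, d)) :
  F_linear t -> F_linear (fun x => t (x *m B)).
Proof. by move=> tL c x y; rewrite mulmxDl -scalemxAl tL. Qed.

Lemma F_linear_comp d V W (t : 'rV[F]_d -> V) (f : {linear V -> W}) :
  F_linear t -> F_linear (f \o t).
Proof. by move=> tL c x y; rewrite /= tL linearD linearZ. Qed.

Lemma F_linear_scale d V (t : 'rV[F]_d -> V) (a : A) :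
  F_linear t -> F_linear (fun x => a *: t x).
Proof. by move=> tL c x y; rewrite tL scalerDr !scalerA mulr_algl mulr_algr. Qed.

Lemma F_linear_ext d V (t t' : 'rV[F]_d -> V) : F_linear t -> F_linear t' ->
  (forall i, t (delta_mx 0 i) = t' (delta_mx 0 i)) -> t =1 t'.
Proof.
move=> tL tL' tt' x; rewrite [x]row_sum_delta !F_linear_sum //.
by apply: eq_bigr => i _; rewrite !F_linearZ // tt'.
Qed.

Lemma F_linear_factor d d' V (t : 'rV[F]_d -> V) (t' : 'rV[F]_d' -> V) :
    F_linear t -> F_linear t' -> (forall x, exists y, t x = t' y) ->
  exists B : 'M_(d, d'), forall x, t x = t' (x *m B).
Proof.
move=> tL tL' tt'; have [f fE] := choice tt'.
exists (\matrix_i f (delta_mx 0 i)).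
apply: F_linear_ext => [//||i]; first exact: F_linear_mulmx.
by rewrite -rowE rowK fE.
Qed.

(** The subset [S] is an arbitrary predicate because the fixed space of an idempotent, to which this
    is applied, is a subspace over [F] but in general not an [A]-submodule. *)
Definition coordinates V (S : V -> Prop) d (t : 'rV[F]_d -> V) :=
  [/\ F_linear t, injective t & forall v, S v <-> exists x, v = t x].

(** A relation between the generators with a nonzero coefficient at [i] makes generator number [i]
    redundant; induction on the number of generators. *)
Lemma coordinates_exist V (S : V -> Prop) m (t : 'rV[F]_m -> V) :
    F_linear t -> (forall v, S v <-> exists x, v = t x) ->
  exists d (t' : 'rV[F]_d -> V), coordinates S t'.
Proof.
elim: m t => [|m IH] t tL tS.
  exists 0%N, t; split=> // x y _; by rewrite [x]thinmx0 [y]thinmx0.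
have [t0|] := pselect (forall x, t x = 0 -> x = 0).
  by exists m.+1, t; split=> //; apply: F_linear_inj.
move=> /existsNP[x /not_implyP[tx0 /eqP x0]].
have [i xi0] : exists i, x 0 i != 0.
  by apply/rV0Pn.
pose t1 y := t (y *m row' i 1%:M).
apply: (IH t1); first exact: F_linear_mulmx.
move=> v; rewrite tS; split=> [[z ->]|[y ->]]; last by eexists.
pose z' := z - (z 0 i / x 0 i) *: x.
have z'i : z' 0 i = 0 by rewrite !mxE divfK ?subrr.
exists (col' i z'); rewrite /t1.
have -> : col' i z' *m row' i 1%:M = z'.
  rewrite -[RHS]mulmx1; apply/rowP => j; rewrite !mxE [RHS](bigD1 i) //= z'i mul0r add0r.
  rewrite [RHS](reindex_omap (lift i) (unlift i)) /=; last first.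
    by move=> k ki; case: unliftP ki => [? ->|->] //; rewrite eqxx.
  by apply: eq_big => k; rewrite ?neq_lift ?liftK ?eqxx ?[_ == i]eq_sym ?neq_lift // !mxE.
by rewrite F_linearD // F_linearN // F_linearZ // tx0 scaler0 subr0.
Qed.

Lemma coordinates_sub V (S S' : V -> Prop) d d' (t : 'rV[F]_d -> V) (t' : 'rV[F]_d' -> V) :
    coordinates S t -> coordinates S' t' -> (forall v, S v -> S' v) ->
  (d <= d')%N /\ (d = d' -> forall v, S' v -> S v).
Proof.
move=> [tL tI tS] [tL' tI' tS'] SS'.
have [|B tB] := F_linear_factor tL tL'.
  by move=> x; apply/tS'/SS'/tS; exists x.
have Bfree : row_free B.
  apply: inj_row_free => x xB; apply: tI.
  by rewrite tB xB !F_linear0.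
split; first by rewrite -(eqP Bfree) rank_leq_col.
move=> dd' v /tS'[x ->]; subst d'; apply/tS.
have Bu : B \in unitmx by rewrite -row_free_unit.
by exists (x *m invmx B); rewrite tB mulmxKV.
Qed.

Lemma coordinates_dim V (S : V -> Prop) d d' (t : 'rV[F]_d -> V) (t' : 'rV[F]_d' -> V) :
  coordinates S t -> coordinates S t' -> d = d'.
Proof.
move=> c c'; apply/eqP; rewrite eqn_leq.
by have [-> _] := coordinates_sub c c' (fun _ s => s);
   have [-> _] := coordinates_sub c' c (fun _ s => s).
Qed.

Definition fin_dim V :=
  exists d (t : 'rV[F]_d -> V), F_linear t /\ forall v, exists x, v = t x.

Lemma fin_dim_coordinates V : fin_dim V ->
  exists d (t : 'rV[F]_d -> V), coordinates (fun=> True) t.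
Proof. by case=> d [t [tL tS]]; apply: coordinates_exist tL _. Qed.

Lemma fin_dim_eigen V (e : A) : e * e = e -> fin_dim V ->
  exists d (t : 'rV[F]_d -> V), coordinates (fun v => e *: v = v) t.
Proof.
move=> ee [d [t [tL tS]]]; apply: (coordinates_exist (F_linear_scale e tL)).
move=> v; split=> [ev|[x ->]]; last by rewrite scalerA ee.
by have [x vx] := tS v; exists x; rewrite -vx.
Qed.

(** No spanning family of [U] is at hand. One is read off a matrix of maximal rank among those with
    image in [U], since a vector of [U] outside that image would increase the rank. *)
Lemma coordinates_submod V (U : submodClosed V) : fin_dim V ->
  exists d (t : 'rV[F]_d -> V), coordinates (fun v => v \in U) t.
Proof.
move=> [d [t [tL tS]]].
pose inU (r : nat) := `[< exists B : 'M_d, \rank B = r /\ forall y, t (y *m B) \in U >].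
have exU : exists r, inU r.
  exists 0%N; apply/asboolP; exists 0; split=> [|y]; first by rewrite mxrank0.
  by rewrite mulmx0 F_linear0 // rpred0.
have leU r : inU r -> (r <= d)%N.
  by move=> /asboolP[B [<- _]]; exact: rank_leq_row.
have [r /asboolP[B [rB BU]] rmax] := ex_maxnP exU leU.
apply: (coordinates_exist (F_linear_mulmx B tL)) => v.
split=> [vU|[x ->]]; last exact: BU.
have [z vz] := tS v; suff /submxP[y zy] : (z <= B)%MS by exists y; rewrite -zy.
have sBz : (B <= B + z)%MS by apply: addsmxSl.
have sz : (z <= B + z)%MS by apply: addsmxSr.
apply: submx_trans sz _; rewrite -(geq_leqif (mxrank_leqif_sup sBz)) rB.
apply: rmax; apply/asboolP; exists (B + z)%MS; split=> // y.
have /sub_addsmxP[[u1 u2] /= ->] : (y *m (B + z)%MS <= B + z)%MS by apply: submxMl.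
rewrite F_linearD // rpredD //.
rewrite [u2]mx11_scalar mul_scalar_mx F_linearZ // -vz; exact: rpredZ.
Qed.

Lemma fin_dim_submod V (U : submodClosed V) : fin_dim V -> fin_dim (submodule U).
Proof.
move=> /(coordinates_submod U)[d [t [tL tI tU]]].
have tUx x : t x \in U by apply/tU; exists x.
exists d, (fun x => Submodule (tUx x)); split=> [c x y|v].
  by apply: val_inj; rewrite /= tL.
by have /tU[x vx] := valP v; exists x; apply: val_inj.
Qed.

Lemma fin_dim_quot V W (g : {linear V -> W}) :
  (forall w, exists v, g v = w) -> fin_dim V -> fin_dim W.
Proof.
move=> gS [d [t [tL tS]]]; exists d, (g \o t); split; first exact: F_linear_comp.
by move=> w; have [v <-] := gS w; have [x ->] := tS v; exists x.
Qed.

Lemma fin_dim_fg V : finitely_generated V -> fin_dim V.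
Proof.
case=> n [v vS]; pose b := vbasis (@fullv F A); pose m := \dim (@fullv F A).
pose comb (y : 'rV[F]_m) : A := \sum_l y 0 l *: b`_l.
have combL c x y : comb (c *: x + y) = c *: comb x + comb y.
  rewrite scaler_sumr -big_split; apply: eq_bigr => l _ /=.
  by rewrite !mxE scalerDl scalerA.
have combS a : a = comb (\row_l coord b l a).
  by rewrite {1}(coord_vbasis (memvf a)); apply: eq_bigr => l _; rewrite mxE.
exists (n * m)%N, (fun x => \sum_i comb (row i (vec_mx x)) *: v i); split.
  move=> c x y; rewrite scaler_sumr -big_split; apply: eq_bigr => i _ /=.
  by rewrite !linearP /= combL scalerDl scalerA mulr_algl.
move=> u; have [a ->] := vS u; exists (mxvec (\matrix_i (\row_l coord b l (a i)))).
by apply: eq_bigr => i _; rewrite mxvecK rowK -combS.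
Qed.

End Coordinates.

(** * Exact sequences and matrix representations *)

Section MatrixRepresentations.
Variables (F : fieldType) (A : falgType F).
Implicit Types V W X Y Z : lmodType A.

(** Passing from [V] to [e V] is exact: lifts to [Y] of a basis of [e Z] are pushed into [e Y] by
    multiplication with [e]. The case [e = 1] yields bases of the modules themselves. *)
Lemma short_exact_coordinates X Y Z (f : {linear X -> Y}) (g : {linear Y -> Z})
    (e : A) dX dZ (tX : 'rV[F]_dX -> X) (tZ : 'rV[F]_dZ -> Z) :
    e * e = e -> short_exact f g ->
    coordinates (fun v => e *: v = v) tX -> coordinates (fun v => e *: v = v) tZ ->
  exists tY : 'rV[F]_(dX + dZ) -> Y,
    [/\ coordinates (fun v => e *: v = v) tY,
        forall x, tY (row_mx x 0) = f (tX x) &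
        forall x z, g (tY (row_mx x z)) = tZ z].
Proof.
move=> ee [fI gS ker] [tXL tXI tXS] [tZL tZI tZS].
have [y yE] := choice (fun l => gS (tZ (delta_mx 0 l))).
have [s sL sE] := F_linear_rows (fun l => e *: y l).
have tZe z : e *: tZ z = tZ z by apply/tZS; exists z.
have tXe x : e *: tX x = tX x by apply/tXS; exists x.
have gs z : g (s z) = tZ z.
  apply: (F_linear_ext (F_linear_comp g sL)) z => [//|i].
  by rewrite /= sE linearZ /= yE tZe.
have es z : e *: s z = s z.
  apply: (F_linear_ext (F_linear_scale e sL)) z => [//|i].
  by rewrite sE scalerA ee.
have gf x : g (f x) = 0 by apply/ker; exists x.
exists (fun w => f (tX (lsubmx w)) + s (rsubmx w)); split; first split.
- move=> c w w'; rewrite !linearP /= tXL sL !linearP /= scalerDr.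
  by rewrite addrACA.
- apply: F_linear_inj.
    move=> c w w'; rewrite !linearP /= tXL sL !linearP /= scalerDr.
    by rewrite addrACA.
  move=> w w0; have w2 : rsubmx w = 0.
    apply: tZI; rewrite (F_linear0 tZL) -gs; have := congr1 g w0.
    by rewrite linearD gf add0r linear0.
  rewrite -[w]hsubmxK w2; move: w0; rewrite w2 (F_linear0 sL) addr0 => fw.
  have -> : lsubmx w = 0.
    by apply: tXI; apply: fI; rewrite fw (F_linear0 tXL) linear0.
  by rewrite row_mx0.
- move=> v; split=> [ev|[w ->]]; last by rewrite scalerDr -linearZ /= tXe es.
  have /tZS[z gv] : e *: g v = g v by rewrite -linearZ /= ev.
  have /ker[x vx] : g (v - s z) = 0 by rewrite linearB gv gs subrr.
  have /tXS[x' xx'] : e *: x = x.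
    by apply: fI; rewrite linearZ /= -vx scalerBr ev es.
  exists (row_mx x' z); rewrite row_mxKl row_mxKr -xx' -vx.
  by rewrite subrK.
- by move=> x; rewrite row_mxKl row_mxKr (F_linear0 sL) addr0.
- by move=> x z; rewrite row_mxKl row_mxKr linearD gf add0r gs.
Qed.

(* Coordinates are row vectors, on which matrices act on the right: the
   transpose turns this action into a representation of [A]. *)
Definition affords_by V d (t : 'rV[F]_d -> V) (r : A -> 'M[F]_d) :=
  coordinates (fun=> True) t /\ forall a x, t (x *m (r a)^T) = a *: t x.

Definition affords V d (r : A -> 'M[F]_d) := exists t, @affords_by V d t r.

Lemma coordinates_affords V d (t : 'rV[F]_d -> V) :
  coordinates (fun=> True) t -> exists r, affords_by t r.
Proof.
move=> ct; have [tL tI tS] := ct.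
suff /choice[r rE] : forall a, exists B : 'M_d, forall x, t (x *m B^T) = a *: t x.
  by exists r.
move=> a; have [|B BE] := F_linear_factor (F_linear_scale a tL) tL.
  by move=> x; apply/tS.
by exists B^T => x; rewrite trmxK.
Qed.

Lemma fin_dim_affords V : fin_dim V -> exists d (r : A -> 'M[F]_d), affords V r.
Proof.
case/fin_dim_coordinates=> d [t /coordinates_affords[r tr]].
by exists d, r, t.
Qed.

Lemma affords_lin V d (r : A -> 'M[F]_d) : affords V r -> linear r.
Proof.
case=> t [[tL tI _] tr] c a b; apply: trmx_inj; apply/row_matrixP => i.
rewrite !rowE; apply: tI; rewrite tr linearP /= mulmxDr -scalemxAr tL !tr.
by rewrite scalerDl scalerA mulr_algl.
Qed.

Lemma affordsM V d (r : A -> 'M[F]_d) a b : affords V r -> r (a * b) = r a *m r b.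
Proof.
case=> t [[tL tI _] tr]; apply: trmx_inj; apply/row_matrixP => i.
by rewrite !rowE; apply: tI; rewrite tr trmx_mul mulmxA !tr scalerA.
Qed.

Lemma affords1 V d (r : A -> 'M[F]_d) : affords V r -> r 1 = 1%:M.
Proof.
case=> t [[tL tI _] tr]; apply: trmx_inj; apply/row_matrixP => i.
by rewrite !rowE; apply: tI; rewrite tr trmx1 mulmx1 scale1r.
Qed.

Lemma affords_conj V d d' (r : A -> 'M[F]_d) (r' : A -> 'M[F]_d') :
    affords V r -> affords V r' ->
  exists (U : 'M_(d', d)) (U' : 'M_(d, d')),
    [/\ U *m U' = 1%:M, U' *m U = 1%:M & forall a, r' a = U *m r a *m U'].
Proof.
move=> [t [[tL tI tS] tr]] [t' [[tL' tI' tS'] tr']].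
have [|B tB] := F_linear_factor tL tL'; first by move=> x; apply/tS'.
have [|B' tB'] := F_linear_factor tL' tL; first by move=> x; apply/tS.
have BB' : B *m B' = 1%:M.
  by apply/row_matrixP => i; rewrite !rowE; apply: tI; rewrite mulmxA -tB' -tB mulmx1.
have B'B : B' *m B = 1%:M.
  by apply/row_matrixP => i; rewrite !rowE; apply: tI'; rewrite mulmxA -tB -tB' mulmx1.
exists B^T, B'^T; split; rewrite -?trmx_mul ?BB' ?B'B ?trmx1 // => a.
apply: trmx_inj; rewrite !trmx_mul !trmxK; apply/row_matrixP => i.
by rewrite !rowE; apply: tI'; rewrite tr' !mulmxA -tB tr -tB'.
Qed.

Lemma affords_exact X Y Z (f : {linear X -> Y}) (g : {linear Y -> Z}) dX dZ
    (rX : A -> 'M[F]_dX) (rZ : A -> 'M[F]_dZ) :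
    short_exact f g -> affords X rX -> affords Z rZ ->
  exists C, affords Y (fun a => block_mx (rX a) (C a) 0 (rZ a)).
Proof.
move=> fg [tX [cX rXE]] [tZ [cZ rZE]].
have T1 V : (fun v : V => 1 *: v = v) = (fun=> True).
  by apply/funext => v; apply/propext; rewrite scale1r.
have := @short_exact_coordinates _ _ _ f g 1 _ _ tX tZ (mulr1 1) fg.
rewrite !T1 => /(_ cX cZ)[tY [cY tYf tYg]].
have [r [_ rE]] := coordinates_affords cY.
have [tYL tYI tYS] := cY; have [tXL _ _] := cX; have [tZL tZI _] := cZ.
exists (fun a => (dlsubmx (r a)^T)^T); exists tY; split=> // a w.
rewrite -rE; congr (tY (_ *m _)); rewrite tr_block_mx trmxK trmx0.
rewrite -[RHS]submxK; have [l [q E]] : exists l q, (r a)^T =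
    col_mx (row_mx l q) (row_mx (dlsubmx (r a)^T) (drsubmx (r a)^T)).
  by exists (ulsubmx (r a)^T), (ursubmx (r a)^T); rewrite -[LHS]submxK.
have up (x : 'rV_dX) : row_mx x 0 *m (r a)^T = row_mx (x *m (rX a)^T) 0.
  by apply: tYI; rewrite rE !tYf -linearZ /= rXE.
have dn (z : 'rV_dZ) : z *m drsubmx (r a)^T = z *m (rZ a)^T.
  apply: tZI; rewrite rZE -(tYg 0 z) -linearZ /= -rE -{2}[(r a)^T]submxK.
  by rewrite mul_row_block !mul0mx !add0r tYg.
congr block_mx; apply/row_matrixP => i; rewrite !rowE //.
- have := up (delta_mx 0 i); rewrite -{1}[(r a)^T]submxK mul_row_block !mul0mx !addr0.
  by case/eq_row_mx=> ->.
- have := up (delta_mx 0 i); rewrite -{1}[(r a)^T]submxK mul_row_block !mul0mx !addr0.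
  by case/eq_row_mx=> _ ->; rewrite mulmx0.
Qed.

End MatrixRepresentations.

(* Invariants take values in [G] and are compared modulo the subgroup [J]. *)
Section AdditiveInvariants.
Variables (F : fieldType) (A : falgType F) (G : zmodType) (J : G -> Prop).
Hypotheses (J0 : J 0) (JD : forall x y, J x -> J y -> J (x + y))
  (JN : forall x, J x -> J (- x)).
Implicit Types V W X Y Z : lmodType A.

Lemma J_sum (I : Type) (r : seq I) (P : pred I) (f : I -> G) :
  (forall i, P i -> J (f i)) -> J (\sum_(i <- r | P i) f i).
Proof. by move=> Jf; apply: (big_ind J). Qed.

Lemma J_mulrz x (c : int) : J x -> J (x *~ c).
Proof.
move=> Jx; have Jn n : J (x *+ n) by elim: n => [|n IH]; rewrite ?mulr0n ?mulrS //; apply: JD.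
by case: c => n; [exact: Jn|rewrite NegzE mulrNz; apply: JN; exact: Jn].
Qed.

Lemma J_trans x y z : J (x - y) -> J (y - z) -> J (x - z).
Proof. by move=> xy yz; have := JD xy yz; rewrite addrA subrK. Qed.

Lemma J_sym x y : J (x - y) -> J (y - x).
Proof. by move=> /JN; rewrite opprB. Qed.

Definition additive_invariant (phi : lmodType A -> G) :=
  forall X Y Z (f : {linear X -> Y}) (g : {linear Y -> Z}), short_exact f g ->
    fin_dim X -> fin_dim Y -> fin_dim Z -> J (phi Y - (phi X + phi Z)).

Section FromMatrices.
Variable psi : forall d, (A -> 'M[F]_d) -> G.
Hypothesis psi_conj : forall d d' (r : A -> 'M[F]_d) (U : 'M_(d', d)) (U' : 'M_(d, d')),
  U *m U' = 1%:M -> U' *m U = 1%:M -> J (psi (fun a => U *m r a *m U') - psi r).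
Hypothesis psi_block : forall d d' (r : A -> 'M[F]_d) (r' : A -> 'M[F]_d')
  (C : A -> 'M[F]_(d, d')),
  J (psi (fun a => block_mx (r a) (C a) 0 (r' a)) - (psi r + psi r')).

(* The junk value 0 is taken on infinite-dimensional modules only. *)
Definition invariant_of V : G :=
  xget 0 [set x | exists d (r : A -> 'M[F]_d), affords V r /\ x = psi r]%classic.

Lemma invariant_ofE V d (r : A -> 'M[F]_d) : affords V r -> J (invariant_of V - psi r).
Proof.
move=> Vr; rewrite /invariant_of.
have [|d' [r' [Vr' ->]]] :=
    xgetPex 0 (P := [set x | exists d (r : A -> 'M[F]_d), affords V r /\ x = psi r]%classic).
  by exists (psi r), d, r.
have [U [U' [UU' U'U rE]]] := affords_conj Vr Vr'.
by rewrite (_ : r' = fun a => U *m r a *m U'); [exact: psi_conj | exact/funext].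
Qed.

Lemma invariant_of_additive : additive_invariant invariant_of.
Proof.
move=> X Y Z f g fg /fin_dim_affords[dX [rX aX]] _ /fin_dim_affords[dZ [rZ aZ]].
have [C aY] := affords_exact fg aX aZ.
apply: J_trans (invariant_ofE aY) _; apply: J_trans (psi_block _ _ _) _.
rewrite opprD addrACA; apply: JD; apply: J_sym; exact: invariant_ofE.
Qed.

End FromMatrices.

End AdditiveInvariants.

(** * Fitting's lemma, projective covers and the radical *)

Section Indecomposables.
Variables (F : fieldType) (A : falgType F).
Implicit Types V W X Y Z P S : lmodType A.

Lemma iter_linear V (h : {linear V -> V}) n : linear (iter n h).
Proof. by move=> a x y; elim: n => //= n ->; rewrite linearP. Qed.

Lemma endomorphism_stable_power V (h : {linear V -> V}) : fin_dim V ->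
  exists n, [/\ (0 < n)%N, forall v, iter n h (iter n h v) = 0 -> iter n h v = 0 &
    forall v, exists w, iter n h v = iter n h (iter n h w)].
Proof.
case/fin_dim_coordinates=> d [t [tL tI tS]].
have [|H HE] := F_linear_factor (F_linear_comp h tL) tL.
  by move=> x; apply/tS.
have HnE n x : iter n h (t x) = t (x *m H ^+ n).
  elim: n => [|n IH] /=; first by rewrite expr0 mulmx1.
  by rewrite IH exprSr mulmxA -HE.
(* The exponents are powers of two so that the square of a power in this family belongs to it again;
   minimality then forces [K] and [K *m K] to have the same rank. *)
pose rk r := `[< exists i, \rank (H ^+ (2 ^ i)) = r >].
have exr : exists r, rk r by exists (\rank (H ^+ (2 ^ 0))); apply/asboolP; exists 0%N.
have [r /asboolP[i ri] rmin] := ex_minnP exr.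
pose K := H ^+ (2 ^ i); have KK : H ^+ (2 ^ i.+1) = K *m K.
  by rewrite /K expnS mul2n -addnn exprD.
have rKK : (\rank K <= \rank (K *m K))%N.
  by rewrite {1}/K ri; apply: rmin; apply/asboolP; exists i.+1; rewrite KK.
have KsK : (K <= K *m K)%MS.
  by rewrite -(geq_leqif (mxrank_leqif_sup (submxMl K K))).
have kerK : (kermx (K *m K) <= kermx K)%MS.
  have sub : (kermx K <= kermx (K *m K))%MS.
    by apply/sub_kermxP; rewrite mulmxA mulmx_ker mul0mx.
  by rewrite -(geq_leqif (mxrank_leqif_sup sub)) !mxrank_ker leq_sub2l.
exists (2 ^ i)%N; split=> [|v|v]; first by rewrite expn_gt0.
all: have [x ->] := (tS v).1 I.
  rewrite !HnE -mulmxA -/K -(F_linear0 tL) => /tI xKK; congr t; apply/sub_kermxP.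
  by apply: submx_trans kerK; apply/sub_kermxP.
have /submxP[D DE] := KsK.
by exists (t (x *m D)); rewrite !HnE -/K -!mulmxA -DE.
Qed.

(** [V] is the direct sum of the kernel and the image of a stable power of [h], so one of the two
    vanishes. *)
Lemma fitting V (h : {linear V -> V}) : fin_dim V -> indecomposable_mod V ->
  (exists n, forall v, iter n h v = 0) \/ bijective h.
Proof.
move=> Vfd [_ Vind]; have [[|n] [n0 hker him]] := endomorphism_stable_power h Vfd; first by [].
have hL := iter_linear h n.+1; have [g gE] := linear_fun hL.
have [||U UE] := @submod_of _ V (fun v => iter n.+1 h v = 0).
- by rewrite -gE linear0.
- by move=> a x y; rewrite -!gE linearP => -> ->; rewrite scaler0 addr0.
have [||W WE] := @submod_of _ V (fun v => exists w, v = iter n.+1 h w).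
- by exists 0; rewrite -gE linear0.
- by move=> a x y [x' ->] [y' ->]; exists (a *: x' + y'); rewrite hL.
have UW v : exists2 u, u \in U & exists2 w, w \in W & v = u + w.
  have [w vw] := him v; exists (v - iter n.+1 h w).
    by apply/UE; rewrite -gE linearB !gE vw subrr.
  by exists (iter n.+1 h w); rewrite ?subrK //; apply/WE; exists w.
case: (Vind U W) => [v /UE hv /WE[w vw]|//|U0|W0].
- by rewrite vw hker // -vw.
- right; apply: inj_surj_bij => [x y hxy|y].
    have : x - y \in U by apply/UE; rewrite -gE linearB !gE !iterSr hxy subrr.
    by rewrite U0 inE subr_eq0 => /eqP.
  have [u] := UW y; rewrite U0 inE => /eqP-> [w /WE[w' ->] ->].
  by exists (iter n h w'); rewrite add0r.
- left; exists n.+1 => v; have : iter n.+1 h v \in W by apply/WE; exists v.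
  by rewrite W0 inE => /eqP.
Qed.

Lemma iter_compat V X (h : {linear V -> V}) (g : {linear V -> X}) n v :
  (forall v, g (h v) = g v) -> g (iter n h v) = g v.
Proof. by move=> gh; elim: n => //= n IH; rewrite gh. Qed.

(** Uniqueness of projective covers. Lifting each map through the other gives endomorphisms
    compatible with the maps to [X]; as [X] is nonzero they are not nilpotent, hence bijective by
    Fitting's lemma. *)
Lemma common_quotient_iso P P' X (g : {linear P -> X}) (g' : {linear P' -> X}) :
    pim P -> pim P' -> (exists x : X, x != 0) ->
    (forall x, exists v, g v = x) -> (forall x, exists v, g' v = x) ->
  isomorphic_mod P P'.
Proof.
move=> [fgP prP inP] [fgP' prP' inP'] [x0 /eqP x0N] gS gS'.
have [h hE] := prP _ _ g' g gS'; have [h' hE'] := prP' _ _ g g' gS.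
have bij_endo (Q : lmodType A) (k : {linear Q -> X}) (f : {linear Q -> Q}) : fin_dim Q ->
    indecomposable_mod Q -> (forall x, exists v, k v = x) ->
    (forall v, k (f v) = k v) -> bijective f.
  move=> Qfd Qin kS kf; case: (fitting f Qfd Qin) => // -[n fn].
  have [v vx] := kS x0; case: x0N.
  by rewrite -vx -(iter_compat n v kf) fn linear0.
have [f fE] := @linear_fun _ P P (h' \o h) (fun a x y => linearP (h' \o h) a x y).
have [f' fE'] := @linear_fun _ P' P' (h \o h') (fun a x y => linearP (h \o h') a x y).
have [k fK _] : bijective f.
  by apply: (bij_endo _ g) => // [|v]; [exact: fin_dim_fg | rewrite fE /= hE' hE].
have [k' _ fK'] : bijective f'.
  by apply: (bij_endo _ g') => // [|v]; [exact: fin_dim_fg | rewrite fE' /= hE hE'].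
exists h; apply: inj_surj_bij => [x y hxy|y].
  by apply: (can_inj fK); rewrite !fE /= hxy.
by exists (h' (k' y)); rewrite -[RHS]fK' fE'.
Qed.

Lemma maximal_submod_exists V : fin_dim V -> (exists x : V, x != 0) ->
  exists U : submodClosed V, maximal_submod U.
Proof.
move=> Vfd [x0 x0N].
pose D r := `[< exists (U : submodClosed V) (t : 'rV[F]_r -> V),
  ~ U =i predT /\ coordinates (fun v => v \in U) t >].
have exD : exists r, D r.
  have [||U UE] := @submod_of _ V (fun v => v = 0) => [//|a x y -> ->|].
    by rewrite scaler0 addr0.
  have [r [t tU]] := coordinates_submod U Vfd; exists r; apply/asboolP; exists U, t.
  by split=> // /(_ x0); rewrite inE => /UE x00; rewrite x00 eqxx in x0N.
have [d [t tc]] := fin_dim_coordinates Vfd.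
have leD r : D r -> (r <= d)%N.
  by case/asboolP=> U [t' [_ cU]]; have [] := coordinates_sub cU tc.
have [r /asboolP[U [tU [UN cU]]] rmax] := ex_maxnP exD leD.
exists U; split=> // W UW; have [WT|WN] := pselect (W =i predT); [by right|left].
have [r' [tW cW]] := coordinates_submod W Vfd.
have [le eqUW] := coordinates_sub cU cW UW.
have re : r = r'.
  by apply/eqP; rewrite eqn_leq le rmax //; apply/asboolP; exists W, tW.
by move=> v; apply/idP/idP => [|/UW//]; apply: eqUW.
Qed.

Lemma simple_quotmod V (U : submodClosed V) : maximal_submod U -> simple_mod (quotmod U).
Proof.
move=> [UN Umax]; split.
  have [x /negP xU] : exists x, ~ (x \in U).
    by apply/existsNP => UT; apply: UN => x; rewrite UT.
  exists (quotmod_pi U x); apply: contra_notN (elimN idP xU) => /eqP/quotmod_pi_eq0.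
  by [].
move=> W; have [f fE] := quotmod_piS U.
have [||W' WE] := @submod_of _ V (fun v => quotmod_pi U v \in W).
- by rewrite -fE linear0 rpred0.
- by move=> a x y; rewrite -!fE => xW yW; rewrite linearP rpredD ?rpredZ.
case: (Umax W') => [x xU|WU|WT].
- by apply/WE; have /quotmod_pi_eq0-> := xU; rewrite rpred0.
- left=> q; have [x ->] := quotmod_surj q; rewrite inE; apply/idP/eqP => [/WE|/quotmod_pi_eq0].
    by rewrite WU => /quotmod_pi_eq0.
  by rewrite -WU => /WE.
- right=> q; have [x ->] := quotmod_surj q.
  by have /WE-> : x \in W' by rewrite WT.
Qed.

Lemma kernel_submod V W (g : {linear V -> W}) :
  {U : submodClosed V | forall x, x \in U <-> g x = 0}.
Proof.
apply: submod_of => [|a x y gx gy]; first exact: linear0.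
by rewrite linearP gx gy scaler0 addr0.
Qed.

Lemma kernel_maximal V S (g : {linear V -> S}) (U : submodClosed V) :
    (forall s, exists v, g v = s) -> simple_mod S -> (forall x, x \in U <-> g x = 0) ->
  maximal_submod U.
Proof.
move=> gS [[s sN] Smax] UE; split=> [UT|W UW].
  have [v vs] := gS s; have /UE : v \in U by rewrite UT.
  by rewrite vs => s0; rewrite s0 eqxx in sN.
have [||W' WE] := @submod_of _ S (fun s => exists2 w, w \in W & s = g w).
- by exists 0; rewrite ?rpred0 ?linear0.
- move=> a _ _ [x xW ->] [y yW ->]; exists (a *: x + y); last by rewrite linearP.
  by rewrite rpredD ?rpredZ.
case: (Smax W') => [W0|WT]; [left|right] => x.
  apply/idP/idP => [xW|/UW//]; apply/UE; have : g x \in W' by apply/WE; exists x.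
  by rewrite W0 inE => /eqP.
have /WE[w wW gxw] : g x \in W' by rewrite WT.
rewrite -[x](subrK w) inE; apply: rpredD => //; apply/UW/UE.
by rewrite linearB gxw subrr.
Qed.

Lemma pim_fin_dim P : pim P -> fin_dim P.
Proof. by case=> /fin_dim_fg. Qed.

(** If [U'] were not contained in [U], it would map onto the quotient by [U]. Lifting the projection
    of [P] through [U'] then gives an endomorphism of [P] with image in [U'], congruent to the
    identity modulo [U]. It cannot be nilpotent, as [U] is proper, nor bijective, as [U'] is
    proper. *)
Lemma pim_maximal_sub P (U U' : submodClosed P) : pim P ->
  maximal_submod U -> maximal_submod U' -> {subset U' <= U}.
Proof.
move=> Ppim [UN Umax] [UN' Umax']; apply: contrapT => /existsNP[x /not_implyP[xU' xU]].
have [||W WE] := @submod_of _ P (fun v => exists2 u, u \in U & exists2 u', u' \in U' & v = u + u').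
- by exists 0; rewrite ?rpred0 //; exists 0; rewrite ?rpred0 ?addr0.
- move=> a _ _ [u uU [u' uU' ->]] [w wU [w' wU' ->]].
  exists (a *: u + w); first by rewrite rpredD ?rpredZ.
  exists (a *: u' + w'); first by rewrite rpredD ?rpredZ.
  by rewrite scalerDr addrACA.
have WT : W =i predT.
  case: (Umax W) => [u uU|WU|//].
    by apply/WE; exists u => //; exists 0; rewrite ?rpred0 ?addr0.
  case: xU; rewrite -WU; apply/WE; exists 0; rewrite ?rpred0 //.
  by exists x; rewrite ?add0r.
have [q qE] := quotmod_piS U; have [i iE] := submod_inj U'.
have [fgP prP inP] := Ppim.
have [f fE] := @linear_fun _ _ _ (q \o i) (fun a x y => linearP (q \o i) a x y).
have [|h hE] := prP _ _ f q.
  move=> y; have [v ->] := quotmod_surj y.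
  have /WE[u uU [u' uU' ->]] : v \in W by rewrite WT.
  exists (Submodule uU'); rewrite fE /= iE /= qE quotmod_piD.
  by have /quotmod_pi_eq0-> := uU; rewrite add0r.
have [k kE] := @linear_fun _ _ _ (i \o h) (fun a x y => linearP (i \o h) a x y).
have qk v : q (k v) = q v by rewrite kE /= -[RHS]hE fE.
case: (fitting k (pim_fin_dim Ppim) inP) => [[n kn]|[k' _ kK]].
  apply: UN => v; rewrite [RHS]inE; apply/quotmod_pi_eq0; rewrite -qE.
  by rewrite -(iter_compat n v qk) kn linear0.
by apply: UN' => v; rewrite [RHS]inE -[v]kK kE /= iE; exact: valP.
Qed.

Lemma pim_mod_rad P (U : submodClosed P) : pim P -> maximal_submod U -> mod_rad (V := P) =i U.
Proof.
move=> Ppim Umax x; apply/asboolP/idP => [/(_ U Umax)//|xU U' Umax'].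
exact: (pim_maximal_sub Ppim Umax' Umax).
Qed.

Lemma maximal_eq V (U U' : submodClosed V) : U =i U' -> maximal_submod U -> maximal_submod U'.
Proof.
move=> UU' [UN Umax]; split=> [UT|W UW]; first by apply: UN => x; rewrite UU' UT.
case: (Umax W) => [x|WU|WT]; first by rewrite UU'; exact: UW.
  by left=> x; rewrite WU UU'.
by right.
Qed.

Lemma pim_mod_rad_maximal P : pim P -> maximal_submod (mod_rad (V := P)).
Proof.
move=> Ppim; have [_ _ [P0 _]] := Ppim.
have [U Umax] := maximal_submod_exists (pim_fin_dim Ppim) P0.
by apply: maximal_eq (Umax) => x; rewrite (pim_mod_rad Ppim Umax).
Qed.

Lemma pim_top_simple P : pim P -> simple_mod (mod_top P).
Proof. by move=> Ppim; apply/simple_quotmod/pim_mod_rad_maximal. Qed.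

Lemma pim_top_iso P S (g : {linear P -> S}) : pim P -> simple_mod S ->
  (forall s, exists v, g v = s) -> isomorphic_mod (mod_top P) S.
Proof.
move=> Ppim Ssim gS; have [U UE] := kernel_submod g.
have Umax := kernel_maximal gS Ssim UE.
have radE := pim_mod_rad Ppim Umax.
have [|h hE] := @quotmod_lift _ P S (mod_rad (V := P)) g.
  by move=> x; rewrite radE => /UE.
apply: (@isoP _ _ _ h) => [q|s].
  have [x ->] := quotmod_surj q; rewrite hE => /UE; rewrite -radE.
  by move=> /quotmod_pi_eq0.
by have [v <-] := gS s; exists (quotmod_pi _ v); rewrite hE.
Qed.

Lemma pim_top_inj P P' : pim P -> pim P' ->
  isomorphic_mod (mod_top P) (mod_top P') -> isomorphic_mod P P'.
Proof.
move=> Ppim Ppim' [f [f' fK fK']].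
have [q qE] := quotmod_piS (mod_rad (V := P)).
have [q' qE'] := quotmod_piS (mod_rad (V := P')).
have [g gE] := @linear_fun _ _ _ (f \o q) (fun a x y => linearP (f \o q) a x y).
apply: (@common_quotient_iso _ _ (mod_top P') g q') => //.
- by have [] := pim_top_simple Ppim'.
- move=> x; have [v vE] := quotmod_surj (f' x).
  by exists v; rewrite gE /= qE -vE fK'.
- by move=> x; have [v ->] := quotmod_surj x; exists v; rewrite qE'.
Qed.

End Indecomposables.

(** * Primitive idempotents and projective indecomposables *)

Section Idempotents.
Variables (F : fieldType) (A : falgType F).
Implicit Types V W X Y Z P S : lmodType A.

Definition primitive_idem (e : A) :=
  [/\ e * e = e, e != 0 &
      forall f, f * f = f -> e * f = f -> f * e = f -> f = 0 \/ f = e].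

(** This form of isomorphism between projectives is stable under reversal of products, as the
    passage to the opposite algebra requires. *)
Definition idem_equiv (e f : A) := exists a b,
  [/\ e * a * f = a, f * b * e = b, a * b = e & b * a = f].

(** For an idempotent [e] the fixed points of right multiplication by [e] are exactly [A e]; the
    equation avoids an existential. *)
Fact left_ideal_subproof (e : A) : {U : submodClosed A^o | forall x, x \in U <-> x * e = x}.
Proof.
apply: submod_of => [|a x y xe ye]; first by rewrite mul0r.
by rewrite mulrDl -scalerAl xe ye.
Qed.

Definition left_ideal e : submodClosed A^o := sval (left_ideal_subproof e).

Lemma left_idealP e x : x \in left_ideal e <-> x * e = x.
Proof. exact: (svalP (left_ideal_subproof e)). Qed.

Definition principal e : lmodType A := submodule (left_ideal e).

Lemma principal_val e (x : principal e) : val x * e = val x.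
Proof. exact/left_idealP/(valP x). Qed.

Lemma principal_valZ e a (x : principal e) : (val (a *: x) : A) = a * val x.
Proof. by []. Qed.

Definition principal_elt e x (xe : x * e = x) : principal e :=
  Submodule ((left_idealP e x).2 xe).

Lemma principal_hom V e (v : V) :
  {f : {linear principal e -> V} | forall x, f x = (val x : A) *: v}.
Proof.
apply: linear_fun => a x y.
by rewrite submod_val_lin scalerDl -scalerA.
Qed.

Lemma principal_fg e : e * e = e -> finitely_generated (principal e).
Proof.
move=> ee; exists 1%N, (fun=> principal_elt ee) => x; exists (fun=> val x).
by rewrite big_ord1; apply: val_inj; apply/esym/principal_val.
Qed.

Lemma principal_fin_dim e : e * e = e -> fin_dim (principal e).
Proof. by move=> /principal_fg/fin_dim_fg. Qed.

Lemma principal_projective e : e * e = e -> projective_mod (principal e).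
Proof.
move=> ee X Y g f gS; have [x xE] := gS (f (principal_elt ee)).
have [h hE] := principal_hom e x; exists h => v.
rewrite hE linearZ /= xE -linearZ /=; congr (f _); apply: val_inj.
by apply: principal_val.
Qed.

(** A decomposition of [A e] splits [e] as [u + w], and [u] is an idempotent below [e]. *)
Lemma principal_pim e : primitive_idem e -> pim (principal e).
Proof.
move=> [ee e0 emin]; split; [exact: principal_fg|exact: principal_projective|split].
  exists (principal_elt ee); apply: contraNneq e0 => /(congr1 val) /= ->.
  by [].
move=> U W UW0 UWT; have [u uU [w wW uw]] := UWT (principal_elt ee).
have uwe : val u + val w = e by exact/esym/(congr1 val uw).
have ue := principal_val u; have we := principal_val w.
have gen (x : principal e) : x = (val x : A) *: u + (val x : A) *: w.
  by rewrite -scalerDr -uw; apply: val_inj; apply/esym/principal_val.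
pose f : A := val u.
have decomp x : x \in U -> (val x : A) *: w = 0.
  move=> xU; apply: UW0; last by rewrite rpredZ.
  rewrite (_ : _ *: w = x - (val x : A) *: u); last by rewrite {2}(gen x) addrC addKr.
  by rewrite submodB ?rpredZ.
have fw : f * val w = 0 by have /(congr1 val) := decomp u uU.
have fe : f * e = f by [].
have ff : f * f = f by rewrite -{3}fe -uwe mulrDr fw addr0.
(* [e *: u - u] lies in [U] and equals [w - e *: w], which lies in [W]; so it vanishes. *)
have ef : e * f = f.
  have E : e *: u - u = w - e *: w.
    apply/eqP; rewrite subr_eq addrAC -subr_eq opprK -scalerDr -uw; apply/eqP.
    by rewrite addrC -uw; apply: val_inj; exact: ee.
  have : e *: u - u = 0.
    by apply: UW0; [rewrite submodB ?rpredZ | rewrite E submodB ?rpredZ].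
  by move/eqP; rewrite subr_eq0 => /eqP/(congr1 val).
case: (emin f ff ef fe) => fE; [left|right] => x; rewrite inE; apply/idP/eqP.
- move=> xU; rewrite [x]gen (_ : u = 0) ?scaler0 ?add0r ?decomp //.
  exact: val_inj.
- by move->; rewrite rpred0.
- move=> xW; apply: UW0 => //; rewrite [x]gen (_ : w = 0) ?scaler0 ?addr0 ?rpredZ //.
  apply: val_inj => /=; apply: (addrI (val u)).
  by rewrite uwe addr0 -/f fE.
- by move->; rewrite rpred0.
Qed.

Lemma principal_iso e f : e * e = e -> f * f = f ->
  isomorphic_mod (principal e) (principal f) <-> idem_equiv e f.
Proof.
move=> ee ff; split=> [[h [h' hK hK']]|[a [b [ea fb ab ba]]]].
  have lh' : linear h' by move=> c x y; apply: (can_inj hK); rewrite linearP !hK'.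
  pose a : A := val (h (principal_elt ee)); pose b : A := val (h' (principal_elt ff)).
  have ha x : (val (h x) : A) = val x * a.
    have {1}-> : x = (val x : A) *: principal_elt ee.
      by apply: val_inj; apply/esym/principal_val.
    by rewrite linearZ.
  have [k kE] := linear_fun lh'.
  have hb x : (val (h' x) : A) = val x * b.
    have {1}-> : x = (val x : A) *: principal_elt ff.
      by apply: val_inj; apply/esym/principal_val.
    by rewrite -kE linearZ /= kE.
  have ea : e * a = a by exact/esym/(ha (principal_elt ee)).
  have fb : f * b = b by exact/esym/(hb (principal_elt ff)).
  exists a, b; split.
  - by rewrite ea; exact: principal_val.
  - by rewrite fb; exact: principal_val.
  - by rewrite /a -hb hK.
  - by rewrite /b -ha hK'.
have af : a * f = a by rewrite -ea -mulrA ff.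
have be : b * e = b by rewrite -fb -mulrA ee.
have [g gE] := principal_hom e (principal_elt af).
have [g' gE'] := principal_hom f (principal_elt be).
exists g; exists g' => x; apply: val_inj.
  by rewrite gE' gE -[LHS]/(val x * a * b) -mulrA ab principal_val.
by rewrite gE gE' -[LHS]/(val x * b * a) -mulrA ba principal_val.
Qed.

(** Among the idempotents that do not annihilate [S], one with [A f] of smallest dimension is
    primitive: if it split into two proper orthogonal parts, each would annihilate [S], and so would
    their sum. *)
Lemma primitive_idem_acting S : (exists s : S, s != 0) ->
  exists2 e, primitive_idem e & exists s : S, e *: s = s /\ s != 0.
Proof.
move=> [s0 s0N].
pose D r := `[< exists f : A, [/\ f * f = f, exists s : S, f *: s != 0 & \dim (limg (amulr f)) = r] >].
have exD : exists r, D r.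
  exists (\dim (limg (amulr (1 : A)))); apply/asboolP; exists 1.
  by split; rewrite ?mulr1 //; exists s0; rewrite scale1r.
have [r /asboolP[e [ee [s sN] er]] rmin] := ex_minnP exD.
have smaller f : f * f = f -> e * f = f -> f * e = f -> f != e ->
    forall s : S, f *: s = 0.
  move=> ff ef fe fNe t; apply/eqP/negP => /negP tN.
  have sub : (limg (amulr f) <= limg (amulr e))%VS.
    apply/subvP => x /memv_imgP[y _ ->]; apply/memv_imgP; exists (y * f); rewrite ?memvf //.
    by rewrite !lfunE /= -mulrA fe.
  have rle : (r <= \dim (limg (amulr f)))%N.
    by apply: rmin; apply/asboolP; exists f; split=> //; exists t.
  have /eqP dimE : limg (amulr f) == limg (amulr e).
    by rewrite -(geq_leqif (dimv_leqif_eq sub)) er.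
  have : e \in limg (amulr f).
    rewrite dimE; apply/memv_imgP; exists 1; rewrite ?memvf // lfunE /= mul1r //.
  case/memv_imgP=> y _; rewrite lfunE /= => ey.
  by case/eqP: fNe; rewrite -ef {1}ey -mulrA ff.
exists e; last by exists (e *: s); rewrite scalerA ee.
split=> //; first by apply: contraNneq sN => ->; rewrite scale0r.
move=> f ff ef fe; have [->|fNe] := eqVneq f e; [by right|left].
have [f0|//] := eqVneq (e - f) e.
  by apply/eqP; rewrite -oppr_eq0; apply/eqP; apply: (addrI e); rewrite addr0.
move=> efNe; have sub := smaller _ ff ef fe fNe.
have : e *: s = 0.
  rewrite -[e](subrK f) scalerDl sub addr0; apply: smaller => //.
  - by rewrite mulrBl !mulrBr ee ef fe ff subrr subr0.
  - by rewrite mulrBr ee ef.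
  - by rewrite mulrBl ee fe.
by move/eqP; rewrite (negbTE sN).
Qed.

Lemma simple_generated S (s : S) : simple_mod S -> s != 0 -> forall x, exists a : A, a *: s = x.
Proof.
move=> [_ Smax] sN; have [||U UE] := @submod_of _ S (fun v => exists a : A, a *: s = v).
- by exists 0; rewrite scale0r.
- by move=> c x y [a <-] [b <-]; exists (c * a + b); rewrite scalerDl scalerA.
case: (Smax U) => U0 x; last by apply/UE; rewrite U0.
have : s \in U by apply/UE; exists 1; rewrite scale1r.
by rewrite U0 inE (negbTE sN).
Qed.

Lemma principal_onto_simple S e (s : S) : simple_mod S -> e * e = e -> e *: s = s -> s != 0 ->
  exists g : {linear principal e -> S}, forall x, exists v, g v = x.
Proof.
move=> Ssim ee es sN; have [g gE] := principal_hom e s; exists g => x.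
have [a <-] := simple_generated Ssim sN x.
have aee : a * e * e = a * e by rewrite -mulrA ee.
by exists (principal_elt aee); rewrite gE /= -scalerA es.
Qed.

Section Representatives.
Variables (n : nat) (P : 'I_n -> lmodType A).
Hypothesis Preps : represents_pims P.
Let Ppim i : pim (P i). Proof. by case: Preps. Qed.

Lemma simple_top S : simple_mod S -> exists i, isomorphic_mod (mod_top (P i)) S.
Proof.
move=> Ssim; have [e eprim [s [es sN]]] := primitive_idem_acting Ssim.1.
have [ee _ _] := eprim; have [g gS] := principal_onto_simple Ssim ee es sN.
have [_ _ Pall] := Preps; have [i /isomorphic_sym[f [f' fK fK']]] := Pall _ (principal_pim eprim); exists i.
have [h hE] := @linear_fun _ _ _ (g \o f) (fun a x y => linearP (g \o f) a x y).
apply: (@pim_top_iso _ _ _ _ h) => // t; have [v <-] := gS t.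
by exists (f' v); rewrite hE /= fK'.
Qed.

Lemma top_inj i j : isomorphic_mod (mod_top (P i)) (mod_top (P j)) -> i = j.
Proof. by case: Preps => _ Pinj _ /pim_top_inj ij; apply/Pinj/ij. Qed.

(** A primitive idempotent acting nontrivially on the simple top of [Q] makes this top a common
    quotient of [principal e] and [Q]. *)
Lemma pim_principal Q : pim Q -> exists2 e : A, primitive_idem e & isomorphic_mod (principal e) Q.
Proof.
move=> Qpim; have Ssim := pim_top_simple Qpim.
have [e eprim [s [es sN]]] := primitive_idem_acting Ssim.1.
have [ee _ _] := eprim; have [g gS] := principal_onto_simple Ssim ee es sN.
exists e => //; have [q qE] := quotmod_piS (mod_rad (V := Q)).
apply: (@common_quotient_iso _ _ _ _ (mod_top Q) g q) => //.
- exact: principal_pim.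
- exact: Ssim.1.
- by move=> x; have [v ->] := quotmod_surj x; exists v; rewrite qE.
Qed.

Lemma idem_simple_top i e S (s : S) : primitive_idem e -> isomorphic_mod (principal e) (P i) ->
  simple_mod S -> e *: s = s -> s != 0 -> isomorphic_mod (mod_top (P i)) S.
Proof.
move=> [ee _ _] /isomorphic_sym[f [f' fK fK']] Ssim es sN.
have [g gS] := principal_onto_simple Ssim ee es sN.
have [h hE] := @linear_fun _ _ _ (g \o f) (fun a x y => linearP (g \o f) a x y).
apply: (@pim_top_iso _ _ _ _ h) => // t; have [v <-] := gS t.
by exists (f' v); rewrite hE /= fK'.
Qed.

Lemma idem_acts_on_top i e : primitive_idem e -> isomorphic_mod (principal e) (P i) ->
  exists s : mod_top (P i), e *: s = s /\ s != 0.
Proof.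
move=> [ee _ _] [f [f' fK fK']]; have [x xN] := (pim_top_simple (Ppim i)).1.
have [v vx] := quotmod_surj x; have [q qE] := quotmod_piS (mod_rad (V := P i)).
pose s := q (f (principal_elt ee)); exists s; split.
  by rewrite /s -!linearZ /=; congr (q (f _)); apply: val_inj; exact: ee.
apply: contraNneq xN => s0; rewrite vx -qE -[v]fK'.
rewrite (_ : f' v = (val (f' v) : A) *: principal_elt ee).
  by rewrite !linearZ /= -/s s0 scaler0.
by apply: val_inj; apply/esym/principal_val.
Qed.

End Representatives.

End Idempotents.

(** * Existence of composition series, and additivity along them *)

Section CompositionSeries.
Variables (F : fieldType) (A : falgType F).
Implicit Types V W X Y Z P S : lmodType A.

Lemma subquotient_exact V (U W : submodClosed V) : {subset U <= W} ->
  exists (f : {linear submodule U -> submodule W})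
    (g : {linear submodule W -> subquotient W U}), short_exact f g.
Proof.
move=> UW; have [f fE] := submod_incl UW; have [g gE] := quotmod_piS (trace_in U W).
exists f, g; split=> [x y fxy|z|y].
- by apply: val_inj; rewrite -!fE fxy.
- by have [y ->] := quotmod_surj z; exists y; rewrite gE.
rewrite gE quotmod_pi_eq0; split=> [yU|[x ->]]; last by rewrite inE /= fE; exact: valP.
have yU' : val y \in U by [].
by exists (Submodule yU'); apply: val_inj; rewrite fE.
Qed.

Lemma composition_series_exists V : fin_dim V ->
  exists n (U : nat -> submodClosed V), composition_series n U.
Proof.
move=> Vfd; suff main d : forall (W : submodClosed V) d' (t : 'rV[F]_d' -> V), (d' <= d)%N ->
    coordinates (fun v => v \in W) t ->
    exists n (U : nat -> submodClosed V), [/\ U 0 =i pred1 0, U n =i W &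
      forall i, (i < n)%N -> {subset U i <= U i.+1} /\ simple_mod (subquotient (U i.+1) (U i))].
  have [||T TE] := @submod_of _ V (fun=> True) => //.
  have [d [t ct]] := coordinates_submod T Vfd.
  have [n [U [U0 Un Us]]] := main d T d t (leqnn d) ct.
  by exists n, U; split=> // v; rewrite Un inE; apply/TE.
elim: d => [|d IH] W d' t d'd ct.
  exists 0%N, (fun=> W); have W0 : W =i pred1 0.
    move=> v; rewrite inE; apply/idP/eqP => [|->]; last exact: rpred0.
    have [tL _ tS] := ct; move=> /tS[x ->]; move: d'd x; rewrite leqn0 => /eqP d0.
    subst d' => x; by rewrite [x]thinmx0 (F_linear0 tL).
  by split.
have [W0|WN] := pselect (W =i pred1 0).
  by exists 0%N, (fun=> W); split.
have [||K' K'max] := @maximal_submod_exists _ _ (submodule W).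
- exact: fin_dim_submod.
- apply: contrapT => /forallNP all0; apply: WN => v; rewrite inE.
  apply/idP/eqP => [vW|->]; last exact: rpred0.
  have /negP := all0 (Submodule vW); rewrite negbK => /eqP/(congr1 val).
  by [].
have [||K KE] := @submod_of _ V (fun v => exists2 x, x \in K' & v = val x).
- by exists 0; rewrite ?rpred0.
- move=> a _ _ [x xK ->] [y yK ->]; exists (a *: x + y) => //.
  by rewrite rpredD ?rpredZ.
have KW : {subset K <= W} by move=> v /KE[x _ ->]; exact: valP.
have KtrE (K1 : submodClosed V) : K1 =i K -> K' =i trace_in K1 W.
  move=> K1E x; rewrite [RHS]inE /= K1E; apply/idP/idP => [xK'|/KE[y yK' /val_inj-> //]].
  by apply/KE; exists x.
have [dK [tK cK]] := coordinates_submod K Vfd.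
have [dle deq] := coordinates_sub cK ct KW.
have dlt : (dK < d')%N.
  rewrite ltn_neqAle dle andbT; apply/eqP => /deq WK.
  case: K'max => K'N _; apply: K'N => x; rewrite [RHS]inE (KtrE K) // inE /=.
  by apply: WK; exact: valP.
have [|n [U [U0 Un Us]]] := IH K dK tK _ cK.
  by rewrite -ltnS (leq_trans dlt).
pose U' i := if (i <= n)%N then U i else W.
have U'E i : (i <= n)%N -> U' i = U i by rewrite /U' => ->.
have U'n : U' n.+1 = W by rewrite /U' ltnn.
exists n.+1, U'; split=> [||i]; [by rewrite U'E|by rewrite U'n|].
rewrite ltnS leq_eqVlt => /predU1P[->|lt_in]; last by rewrite !U'E ?(ltnW lt_in) //; exact: Us.
rewrite U'n U'E //; split=> [v|]; first by rewrite Un; exact: KW.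
exact/simple_quotmod/(maximal_eq (KtrE _ Un)).
Qed.

Section Invariants.
Variables (G : zmodType) (J : G -> Prop).
Hypotheses (J0 : J 0) (JD : forall x y, J x -> J y -> J (x + y))
  (JN : forall x, J x -> J (- x)).
Variable phi : lmodType A -> G.
Hypothesis phi_add : additive_invariant J phi.

Let Z0 : lmodType A := 'rV[A]_0.

Lemma fin_dim_zero : fin_dim Z0.
Proof.
exists 0%N, (fun=> 0); split=> [c x y|v]; first by rewrite scaler0 addr0.
by exists 0; rewrite [v]thinmx0.
Qed.

Lemma invariant_zero : J (phi Z0).
Proof.
have [f _] := @linear_fun _ Z0 Z0 (fun=> 0) (fun a x y => esym (etrans (addr0 _) (scaler0 _ _))).
have ex : short_exact f f.
  split=> [x y _|z|y]; first by rewrite [x]thinmx0 [y]thinmx0.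
    by exists 0; rewrite [z]thinmx0 linear0.
  by split=> _; [exists 0|]; rewrite [y]thinmx0 linear0.
have fd0 := fin_dim_zero; have := phi_add ex fd0 fd0 fd0.
by rewrite opprD addrA subrr add0r => /JN; rewrite opprK.
Qed.

Lemma invariant_iso X Y : fin_dim X -> isomorphic_mod X Y -> J (phi Y - phi X).
Proof.
move=> Xfd [f [f' fK fK']].
have [g gE] := @linear_fun _ Y Z0 (fun=> 0) (fun a x y => esym (etrans (addr0 _) (scaler0 _ _))).
have ex : short_exact f g.
  split=> [|z|y]; first exact: can_inj fK.
    by exists 0; rewrite [z]thinmx0 linear0.
  by rewrite gE; split=> // _; exists (f' y); rewrite fK'.
have Yfd : fin_dim Y by apply: (fin_dim_quot (g := f)) Xfd => y; exists (f' y).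
have := JD (phi_add ex Xfd Yfd fin_dim_zero) invariant_zero.
by rewrite opprD addrA subrK.
Qed.

Lemma invariant_series V n (U : nat -> submodClosed V) : fin_dim V ->
    composition_series n U ->
  J (phi V - \sum_(i < n) phi (subquotient (U i.+1) (U i))).
Proof.
move=> Vfd [U0 Un Us].
have key l : (l <= n)%N ->
    J (phi (submodule (U l)) - \sum_(i < l) phi (subquotient (U i.+1) (U i))).
  elim: l => [_|l IH lt_ln].
    rewrite big_ord0 subr0; have [f fE] := @linear_fun _ (submodule (U 0)) Z0 (fun=> 0)
      (fun a x y => esym (etrans (addr0 _) (scaler0 _ _))).
    have iso : isomorphic_mod (submodule (U 0)) Z0.
      apply: (isoP (f := f)) => [x _|y]; last by exists 0; rewrite [y]thinmx0 linear0.
      by apply: val_inj; have := valP x; rewrite U0 inE => /eqP.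
    have := JD (JN (invariant_iso (fin_dim_submod _ Vfd) iso)) invariant_zero.
    by rewrite opprB subrK.
  have [sub _] := Us l lt_ln; have [f [g ex]] := subquotient_exact sub.
  have gfd : fin_dim (subquotient (U l.+1) (U l)).
    by have [_ gS _] := ex; apply: (fin_dim_quot gS); exact: fin_dim_submod.
  have E (a b q s : G) : a - (b + q) + (b - s) = a - (s + q).
    by rewrite !opprD -[LHS]addrA addrACA addNr add0r [- q - s]addrC.
  have := JD (phi_add ex (fin_dim_submod _ Vfd) (fin_dim_submod _ Vfd) gfd) (IH (ltnW lt_ln)).
  by rewrite big_ord_recr /= E.
have [f fE] := submod_inj (U n).
have iso : isomorphic_mod (submodule (U n)) V.
  apply: (isoP (f := f)) => [x|y]; first by rewrite fE => x0; apply: val_inj.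
  by have yU : y \in U n by [rewrite Un]; exists (Submodule yU); rewrite fE.
have := JD (invariant_iso (fin_dim_submod _ Vfd) iso) (key n (leqnn n)).
by rewrite addrA subrK.
Qed.

End Invariants.
End CompositionSeries.

(** * Multiplicities of simple factors and the Cartan determinant *)

Section Multiplicities.
Variables (F : fieldType) (A : falgType F).
Implicit Types V W X Y Z S : lmodType A.

(** For an idempotent [e] this is the dimension of [e V], or of the space of homomorphisms from
    [A e] to [V]. It is an integer so as to take values in an additive group. *)
Definition eigen_dim (e : A) V : int :=
  (xget 0%N [set d | exists t : 'rV[F]_d -> V, coordinates (fun v => e *: v = v) t]%classic)%:Z.

Lemma eigen_dimE e V d (t : 'rV[F]_d -> V) :
  coordinates (fun v => e *: v = v) t -> eigen_dim e V = d%:Z.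
Proof.
move=> ct; rewrite /eigen_dim.
have [|t' ct'] := xgetPex 0%N (P := [set d | exists t : 'rV[F]_d -> V,
  coordinates (fun v => e *: v = v) t]%classic); first by exists d, t.
by rewrite (coordinates_dim ct' ct).
Qed.

Lemma eigen_dim_additive e : e * e = e ->
  additive_invariant (fun x : int => x = 0) (eigen_dim e).
Proof.
move=> ee X Y Z f g ex Xfd Yfd Zfd.
have [dX [tX cX]] := fin_dim_eigen ee Xfd; have [dZ [tZ cZ]] := fin_dim_eigen ee Zfd.
have [tY [cY _ _]] := short_exact_coordinates ee ex cX cZ.
by rewrite (eigen_dimE cX) (eigen_dimE cY) (eigen_dimE cZ) PoszD subrr.
Qed.

Lemma eigen_dim_eq0 e V : e * e = e -> fin_dim V ->
  eigen_dim e V = 0 <-> forall v : V, e *: v = v -> v = 0.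
Proof.
move=> ee /(fin_dim_eigen ee)[d [t ct]]; rewrite (eigen_dimE ct).
have [tL tI tS] := ct; split=> [[d0]|v0].
  by subst d => v /tS[x ->]; rewrite [x]thinmx0 (F_linear0 tL).
suff -> : d = 0%N by [].
apply: (@coordinates_dim F A V (fun v => e *: v = v) d 0 t (fun=> 0) ct).
split=> [c x y|x y _|v]; first by rewrite scaler0 addr0.
  by rewrite [x]thinmx0 [y]thinmx0.
by split=> [/v0->|[_ ->]]; [exists 0|rewrite scaler0].
Qed.

Lemma fin_dim_subquotient V (U W : submodClosed V) :
  {subset U <= W} -> fin_dim V -> fin_dim (subquotient W U).
Proof.
move=> UW Vfd; have [f [g [_ gS _]]] := subquotient_exact UW.
by apply: (fin_dim_quot gS); apply: fin_dim_submod.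
Qed.

Lemma eigen_dim_iso e X Y : e * e = e -> fin_dim X -> isomorphic_mod X Y ->
  eigen_dim e X = eigen_dim e Y.
Proof.
move=> ee Xfd iso; apply/esym/eqP; rewrite -subr_eq0; apply/eqP.
have zD (x y : int) : x = 0 -> y = 0 -> x + y = 0 by move=> -> ->.
have zN (x : int) : x = 0 -> - x = 0 by move=> ->.
exact: (@invariant_iso _ _ _ (fun x : int => x = 0) zD zN _ (eigen_dim_additive ee)).
Qed.

Section Representatives.
Variables (n : nat) (P : 'I_n -> lmodType A).
Hypothesis Preps : represents_pims P.
Variable e : 'I_n -> A.
Hypothesis e_prim : forall i, primitive_idem (e i).
Hypothesis e_iso : forall i, isomorphic_mod (principal (e i)) (P i).

Let ee i : e i * e i = e i. Proof. by case: (e_prim i). Qed.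
Let Ppim i : pim (P i). Proof. by case: Preps. Qed.
Let top i := mod_top (P i).
Let topfd i : fin_dim (top i).
Proof.
have [q qE] := quotmod_piS (mod_rad (V := P i)).
apply: (fin_dim_quot (g := q)) (pim_fin_dim (Ppim i)) => x.
by have [v ->] := quotmod_surj x; exists v.
Qed.

Lemma eigen_dim_top_neq0 i : eigen_dim (e i) (top i) != 0.
Proof.
apply/eqP => /(eigen_dim_eq0 (ee i) (topfd i)) e0.
have [s [es sN]] := idem_acts_on_top Preps (e_prim i) (e_iso i).
by rewrite (e0 s es) eqxx in sN.
Qed.

Lemma simple_isomorphic_unique S i j :
  isomorphic_mod S (top i) -> isomorphic_mod S (top j) -> i = j.
Proof.
move=> Si Sj; apply: (top_inj Preps); apply: isomorphic_trans Sj.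
exact: isomorphic_sym.
Qed.

Lemma eigen_dim_simple i S : fin_dim S -> simple_mod S ->
  eigen_dim (e i) S = eigen_dim (e i) (top i) *+ `[< isomorphic_mod S (top i) >].
Proof.
move=> Sfd Ssim; case: asboolP => iso.
  by rewrite mulr1n; apply: eigen_dim_iso.
rewrite mulr0n; apply/eigen_dim_eq0 => // v ev; apply/eqP; apply: contra_notT iso => vN.
by apply: isomorphic_sym; apply: idem_simple_top ev vN.
Qed.

Definition factor_count m V (U : nat -> submodClosed V) S : nat :=
  \sum_(l < m) `[< isomorphic_mod (subquotient (U l.+1) (U l)) S >].

Lemma factor_countE V m (U : nat -> submodClosed V) i : fin_dim V -> composition_series m U ->
  eigen_dim (e i) V = eigen_dim (e i) (top i) *+ factor_count m U (top i).
Proof.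
move=> Vfd Us; have [_ _ Ul] := Us; apply/eqP; rewrite -subr_eq0; apply/eqP.
have zD (x y : int) : x = 0 -> y = 0 -> x + y = 0 by move=> -> ->.
have zN (x : int) : x = 0 -> - x = 0 by move=> ->.
rewrite -[RHS](@invariant_series _ _ _ (fun x : int => x = 0) zD zN _
  (eigen_dim_additive (ee i)) V m U Vfd Us).
rewrite /factor_count -sumrMnr; congr (_ - _); apply: eq_bigr => l _.
have [sub sim] := Ul l (ltn_ord l).
by rewrite (eigen_dim_simple i (fin_dim_subquotient sub Vfd) sim).
Qed.

(** The needed part of the Jordan-Hoelder theorem: [eigen_dim (e i)] sees only the factors
    isomorphic to [top i], each with the same nonzero contribution, so it determines their number in
    every series. *)
Lemma composition_multiplicityE V m (U : nat -> submodClosed V) i :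
    fin_dim V -> composition_series m U ->
  composition_multiplicity V (top i) = factor_count m U (top i).
Proof.
move=> Vfd Us; rewrite /composition_multiplicity.
have [|m' [U' [Us' ->]]] := xgetPex 0%N (P := [set c | exists (m : nat) (U : nat -> submodClosed V),
    composition_series m U /\
    c = (\sum_(l < m) `[< isomorphic_mod (subquotient (U l.+1) (U l)) (top i) >])%N]%classic).
  by exists (factor_count m U (top i)), m, U.
apply: (Num.Theory.mulrIn (eigen_dim_top_neq0 i)).
by rewrite -(factor_countE i Vfd Us) (factor_countE i Vfd Us').
Qed.

Lemma eigen_dim_multiplicity V i : fin_dim V ->
  eigen_dim (e i) V = eigen_dim (e i) (top i) * (composition_multiplicity V (top i))%:Z.
Proof.
move=> Vfd; have [m [U Us]] := composition_series_exists Vfd.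
by rewrite (composition_multiplicityE i Vfd Us) (factor_countE i Vfd Us) -mulr_natr natz.
Qed.

Section Invariants.
Variables (G : zmodType) (J : G -> Prop).
Hypotheses (J0 : J 0) (JD : forall x y, J x -> J y -> J (x + y))
  (JN : forall x, J x -> J (- x)).
Variable phi : lmodType A -> G.
Hypothesis phi_add : additive_invariant J phi.

Lemma invariant_multiplicities V : fin_dim V ->
  J (phi V - \sum_i phi (top i) *+ composition_multiplicity V (top i)).
Proof.
move=> Vfd; have [m [U Us]] := composition_series_exists Vfd.
apply: (J_trans JD (invariant_series JD JN phi_add Vfd Us)).
under [X in _ - X]eq_bigr => i _.
  rewrite (composition_multiplicityE i Vfd Us) /factor_count -sumrMnr; over.
rewrite exchange_big -sumrB; apply: J_sum => // l _.
have [_ _ /(_ l (ltn_ord l))[sub sim]] := Us.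
have Qfd := fin_dim_subquotient sub Vfd.
have [i iso] := simple_top Preps sim.
rewrite (bigD1 i) //= big1 ?addr0 => [|j ji].
  rewrite asboolT ?mulr1n; last exact: isomorphic_sym.
  exact: (invariant_iso JD JN phi_add (topfd i) iso).
rewrite asboolF ?mulr0n // => iso'; case/eqP: ji.
by apply: simple_isomorphic_unique iso' _; apply: isomorphic_sym.
Qed.

Lemma invariant_cartan j : J (phi (P j) - \sum_i phi (top i) *~ cartan_matrix P i j).
Proof.
under eq_bigr => i _ do rewrite mxE.
exact/invariant_multiplicities/pim_fin_dim.
Qed.

End Invariants.

Lemma eigen_dim_cartan i j :
  eigen_dim (e i) (principal (e j)) = eigen_dim (e i) (top i) * cartan_matrix P i j.
Proof.
rewrite mxE -eigen_dim_multiplicity; last exact: pim_fin_dim.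
by apply: eigen_dim_iso (e_iso j) => //; apply: principal_fin_dim.
Qed.

(** The entries on the left are the dimensions of [e i * A * e j]. They involve no composition
    factors and are merely transposed in the opposite algebra. *)
Lemma det_cartan : \det (\matrix_(i, j) eigen_dim (e i) (principal (e j))) =
  (\prod_i eigen_dim (e i) (top i)) * \det (cartan_matrix P).
Proof.
rewrite -[\prod_i _](_ : \det (diag_mx (\row_i eigen_dim (e i) (top i))) = _); last first.
  by rewrite det_diag; apply: eq_bigr => i _; rewrite mxE.
rewrite -det_mulmx; congr (\det _); apply/matrixP => i j.
by rewrite mul_diag_mx [LHS]mxE [RHS]mxE [X in X * _]mxE eigen_dim_cartan.
Qed.

Lemma det_cartan_eq0 :
  (\det (cartan_matrix P) == 0) = (\det (\matrix_(i, j) eigen_dim (e i) (principal (e j))) == 0).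
Proof.
rewrite det_cartan mulf_eq0 prodf_seq_eq0; case: hasP => // -[i _ /=].
by rewrite (negbTE (eigen_dim_top_neq0 i)).
Qed.

End Representatives.

Lemma pim_idempotents n (P : 'I_n -> lmodType A) : represents_pims P ->
  exists e : 'I_n -> A, (forall i, primitive_idem (e i)) /\
    forall i, isomorphic_mod (principal (e i)) (P i).
Proof.
move=> [Ppim _ _].
have /choice[e eE] : forall i, exists e, primitive_idem e /\ isomorphic_mod (principal e) (P i).
  by move=> i; have [e] := pim_principal (Ppim i); exists e.
by exists e; split=> i; case: (eE i).
Qed.

End Multiplicities.

(** * Transfer to the opposite algebra *)

Section Opposite.
Variables (F : fieldType) (A B : falgType F) (iota : A -> B) (iota' : B -> A).
Hypotheses (iotaL : linear iota) (iotaM : forall x y, iota (x * y) = iota y * iota x)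
  (iotaK : cancel iota iota') (iotaK' : cancel iota' iota).

Let iota0 : iota 0 = 0.
Proof. by have := iotaL (-1) 0 0; rewrite !scaleN1r !addNr. Qed.

Lemma opp_primitive e : primitive_idem e -> primitive_idem (iota e).
Proof.
move=> [ee e0 emin]; split; first by rewrite -iotaM ee.
  by apply: contra_neq e0 => ie0; apply: (can_inj iotaK); rewrite ie0 iota0.
move=> f; rewrite -[f]iotaK' -!iotaM => /(can_inj iotaK) ff /(can_inj iotaK) fe /(can_inj iotaK) ef.
by have [->|->] := emin _ ff ef fe; [left|right].
Qed.

Lemma opp_idem_equiv e f : idem_equiv e f -> idem_equiv (iota e) (iota f).
Proof.
move=> [a [b [ea fb ab ba]]]; exists (iota b), (iota a); rewrite -!iotaM.
by rewrite !mulrA ea fb ab ba.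
Qed.

(** Both sides measure [e * A * f], the left one through its image under [iota]. *)
Lemma opp_eigen_dim e f : e * e = e -> f * f = f ->
  eigen_dim (iota f) (principal (iota e)) = eigen_dim e (principal f).
Proof.
move=> ee ff; have [d [t ct]] := fin_dim_eigen ee (principal_fin_dim ff).
rewrite (eigen_dimE ct); have [tL tI tS] := ct.
have tx x : iota (val (t x)) * iota e = iota (val (t x)).
  by rewrite -iotaM; congr iota; have /(congr1 val) := (tS (t x)).2 (ex_intro _ x erefl).
apply: (@eigen_dimE _ _ _ _ _ (fun x => principal_elt (tx x))); split.
- move=> c x y; apply: val_inj.
  rewrite -[RHS]/(c%:A * iota (val (t x)) + iota (val (t y))) mulr_algl -iotaL /=.
  by rewrite tL -[c *: val (t x)]mulr_algl.
- move=> x y /(congr1 val) /= /(can_inj iotaK) txy; apply: tI; apply: val_inj; exact: txy.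
move=> v; split=> [fv|[x ->]].
  have vf : iota' (val v) * f = iota' (val v).
    by apply: (can_inj iotaK); rewrite iotaM iotaK'; have /(congr1 val) := fv.
  have /tS[x tx'] : e *: principal_elt vf = principal_elt vf.
    apply: val_inj; suff E : e * iota' (val v) = iota' (val v) by exact: E.
    by apply: (can_inj iotaK); rewrite iotaM iotaK'; exact: principal_val.
  by exists x; apply: val_inj; rewrite /= -tx' /= iotaK'.
by apply: val_inj; rewrite -[LHS]/(iota f * iota (val (t x))) -iotaM principal_val.
Qed.

End Opposite.

(** Only the vanishing of the determinants is compared, because the two Cartan matrices are
    transposes of each other up to nonzero factors on rows and columns. *)
Lemma opposite_representatives (F : fieldType) (A B : falgType F) (iota : A -> B)
    (iota' : B -> A) (iotaL : linear iota)
    (iotaM : forall x y, iota (x * y) = iota y * iota x)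
    (iotaK : cancel iota iota') (iotaK' : cancel iota' iota)
    n (P : 'I_n -> lmodType A) : represents_pims P ->
  exists2 P' : 'I_n -> lmodType B, represents_pims P' &
    (\det (cartan_matrix P') == 0) = (\det (cartan_matrix P) == 0).
Proof.
move=> Preps; have [e [eprim eiso]] := pim_idempotents Preps.
have iotaL' : linear iota'.
  by move=> c x y; apply: (can_inj iotaK); rewrite iotaL !iotaK'.
have iotaM' x y : iota' (x * y) = iota' y * iota' x.
  by apply: (can_inj iotaK); rewrite iotaM !iotaK'.
have iprim i := opp_primitive iotaL iotaM iotaK iotaK' (eprim i).
pose P' i := principal (iota (e i)).
have Preps' : represents_pims P'.
  split=> [i|i j|Q Qpim]; first exact/principal_pim/iprim.
    move=> /principal_iso; case: (iprim i) => iei _ _; case: (iprim j) => iej _ _.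
    move=> /(_ iei iej) /(opp_idem_equiv iotaM'); rewrite !iotaK.
    case: (eprim i) => ei _ _; case: (eprim j) => ej _ _.
    move=> /(principal_iso ei ej) ij; have [_ Pinj _] := Preps; apply: Pinj.
    exact: isomorphic_trans (isomorphic_trans (isomorphic_sym (eiso i)) ij) (eiso j).
  have [f fprim fQ] := pim_principal Qpim.
  have f'prim := opp_primitive iotaL' iotaM' iotaK' iotaK fprim.
  have [_ _ Pall] := Preps; have [i fi] := Pall _ (principal_pim f'prim); exists i.
  apply: isomorphic_trans (isomorphic_sym fQ) _.
  have [ff _ _] := fprim; have [ff' _ _] := f'prim; have [ei _ _] := eprim i.
  have [iei _ _] := iprim i; apply/principal_iso => //; rewrite -[f]iotaK'.
  apply: (opp_idem_equiv iotaM); apply/principal_iso => //.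
  exact: isomorphic_trans fi (isomorphic_sym (eiso i)).
exists P' => //; rewrite (det_cartan_eq0 Preps eprim eiso).
rewrite (det_cartan_eq0 Preps' iprim (fun i => isomorphic_refl _)) -det_tr.
congr (\det _ == 0); apply/matrixP => i j; rewrite !mxE.
have [ei _ _] := eprim i; have [ej _ _] := eprim j.
exact: (opp_eigen_dim iotaL iotaM iotaK iotaK').
Qed.

(** * Power traces modulo powers of the kernel of a reduction *)

(** With [p]-th powers for [a] and [b] and the binomial correction for [w], this computes the
    Frobenius quotient of a sum. *)
Lemma frobenius_sum_identity (O : comNzRingType) (a b z1 z2 w : O) n :
  a + z1 *+ n + (b + z2 *+ n) = a + b + w *+ n + (z1 + z2 - w) *+ n.
Proof. by rewrite mulrnBl mulrnDl; move: (z1 *+ n) (z2 *+ n) (w *+ n) => x y z; ring. Qed.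

Lemma frobenius_prod_identity (O : comNzRingType) (a b z1 z2 : O) n :
  (a + z1 *+ n) * (b + z2 *+ n) = a * b + ((a + z1 *+ n) * z2 + z1 * b) *+ n.
Proof. by rewrite -(mulr_natr z1) -(mulr_natr z2) -(mulr_natr (_ + _)); move: (n%:R : O) => c; ring. Qed.

Lemma exprD_prime (O : comNzRingType) p (x y : O) : prime p ->
  (x + y) ^+ p = x ^+ p + y ^+ p +
    (\sum_(1 <= i < p) (x ^+ (p - i) * y ^+ i) *+ ('C(p, i) %/ p)) *+ p.
Proof.
move=> p_prime; have p0 := prime_gt0 p_prime.
rewrite exprDn -(big_mkord predT (fun i => (x ^+ (p - i) * y ^+ i) *+ 'C(p, i))).
rewrite big_nat_recr //= big_ltn // subn0 subnn !expr0 mulr1 mul1r bin0 binn !mulr1n.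
rewrite -[LHS]addrA [X in _ + X]addrC addrA; congr (_ + _).
rewrite -sumrMnl; apply: eq_big_nat => i ip; rewrite -mulrnA divnK //.
exact: prime_dvd_bin.
Qed.

(** * Cyclic words and their periods *)

Section Words.
Variables (T : finType) (L : nat) (L0 : (0 < L)%N).
Implicit Types w : {ffun 'I_L -> T}.

(** Continuing the word periodically turns rotation into a shift of the index. *)
Definition cyclic_ext w n : T := w (Ordinal (ltn_pmod n L0)).

Definition rotate w : {ffun 'I_L -> T} := [ffun i : 'I_L => cyclic_ext w i.+1].

Lemma cyclic_ext_ord w (i : 'I_L) : cyclic_ext w i = w i.
Proof. by congr (w _); apply: val_inj; rewrite /= modn_small. Qed.

Lemma cyclic_ext_iter w j n : cyclic_ext (iter j rotate w) n = cyclic_ext w (n + j).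
Proof.
elim: j n => [|j IH] n /=; first by rewrite addn0.
rewrite {1}/cyclic_ext ffunE /= IH; congr (w _); apply: val_inj => /=.
by rewrite addSnnS modnDml.
Qed.

Lemma iter_rotate w : iter L rotate w = w.
Proof.
apply/ffunP => i; rewrite -!cyclic_ext_ord cyclic_ext_iter.
by congr (w _); apply: val_inj; rewrite /= modnDr.
Qed.

Lemma cyclic_ext_period w q : iter q rotate w = w ->
  forall n, cyclic_ext w (n + q) = cyclic_ext w n.
Proof. by move=> wq n; rewrite -cyclic_ext_iter wq. Qed.

Section Products.
Variables (S : Type) (one : S) (op : Monoid.law one) (F : T -> S).

Lemma big_cyclic_ext w :
  \big[op/one]_(i < L) F (w i) = \big[op/one]_(0 <= n < L) F (cyclic_ext w n).
Proof. by rewrite big_mkord; apply: eq_bigr => i _; rewrite cyclic_ext_ord. Qed.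

Lemma big_rotate w :
  \big[op/one]_(i < L) F (rotate w i) =
    op (\big[op/one]_(1 <= n < L) F (cyclic_ext w n)) (F (cyclic_ext w 0)).
Proof.
rewrite big_cyclic_ext; under eq_bigr do rewrite (cyclic_ext_iter w 1) addn1.
transitivity (\big[op/one]_(1 <= n < L.+1) F (cyclic_ext w n)).
  by rewrite big_add1 /=.
rewrite big_nat_recr //=; congr (op _ (F _)).
by congr (w _); apply: val_inj; rewrite /= modnn mod0n.
Qed.

Lemma big_rotate0 w :
  \big[op/one]_(i < L) F (w i) =
    op (F (cyclic_ext w 0)) (\big[op/one]_(1 <= n < L) F (cyclic_ext w n)).
Proof. by rewrite big_cyclic_ext big_ltn. Qed.

Lemma big_periodic w q r : L = (q * r)%N -> iter q rotate w = w ->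
  \big[op/one]_(i < L) F (w i) =
    iter r (op (\big[op/one]_(0 <= n < q) F (cyclic_ext w n))) one.
Proof.
move=> LE /cyclic_ext_period wq; rewrite big_cyclic_ext {1}LE.
elim: r {LE} => [|r IH]; first by rewrite muln0 big_geq.
rewrite mulnS (@big_cat_nat _ _ _ q) ?leq_addr //= -IH; congr (op _ _).
rewrite -{1}[q]add0n big_addn addKn.
by apply: eq_bigr => n _; rewrite wq.
Qed.

End Products.

Lemma prod_rotate (O : comNzRingType) (c : T -> O) w :
  \prod_i c (rotate w i) = \prod_i c (w i).
Proof. by rewrite big_rotate big_rotate0; exact: mulrC. Qed.

Lemma tr_rotate (O : comNzRingType) d (B : T -> 'M[O]_d) w :
  \tr (\prod_i B (rotate w i)) = \tr (\prod_i B (w i)).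
Proof. by rewrite big_rotate big_rotate0; exact: mxtrace_mulC. Qed.

Lemma prod_periodic (O : pzSemiRingType) (c : T -> O) w q r :
    L = (q * r)%N -> iter q rotate w = w ->
  \prod_i c (w i) = (\prod_(0 <= n < q) c (cyclic_ext w n)) ^+ r.
Proof. by move=> LE wq; rewrite (big_periodic _ _ LE wq) iter_mulr_1. Qed.

Lemma mprod_periodic (M : monoidType) (c : T -> M) w q r :
    L = (q * r)%N -> iter q rotate w = w ->
  (\prod_i c (w i) = (\prod_(0 <= n < q) c (cyclic_ext w n)) ^+ r)%g.
Proof.
move=> LE wq; rewrite (big_periodic _ _ LE wq).
by elim: r {LE} => // r IH; rewrite expgS -IH.
Qed.

End Words.

Section MonoidWords.
Variables (M : finMonoidType) (L : nat) (L0 : (0 < L)%N) (w : {ffun 'I_L -> M}).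
Local Open Scope group_scope.

Lemma mprod_cyclic_ext : \prod_(i < L) w i = \prod_(0 <= n < L) cyclic_ext L0 w n.
Proof. apply (@big_cyclic_ext M L L0 M 1 _ id w). Qed.

Lemma mprod_rotate :
  \prod_(i < L) rotate L0 w i = (\prod_(1 <= n < L) cyclic_ext L0 w n) * cyclic_ext L0 w 0.
Proof. exact: (@big_rotate M L L0 M 1 (@mulg M : Monoid.law 1) id w). Qed.

Lemma mprod_rotate0 :
  \prod_(i < L) w i = cyclic_ext L0 w 0 * \prod_(1 <= n < L) cyclic_ext L0 w n.
Proof. exact: (@big_rotate0 M L L0 M 1 (@mulg M : Monoid.law 1) id w). Qed.

Lemma mprod_word_periodic q r : L = (q * r)%N -> iter q (rotate L0) w = w ->
  \prod_(i < L) w i = (\prod_(0 <= n < q) cyclic_ext L0 w n) ^+ r.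
Proof. by move=> LE wq; apply: (@mprod_periodic M L L0 M id w q r LE wq). Qed.

End MonoidWords.

Lemma expr_sum_words (O : comNzRingType) (T : finType) L d (c : T -> O) (B : T -> 'M[O]_d) :
  (\sum_t c t *: B t) ^+ L =
    \sum_(w : {ffun 'I_L -> T}) (\prod_i c (w i)) *: \prod_i B (w i).
Proof.
rewrite -[in LHS](card_ord L) -prodr_const bigA_distr_bigA; apply: eq_bigr => w _.
elim/big_rec3: _ => [|i x y z _ ->]; first by rewrite scale1r.
by rewrite -[LHS]/(_ *m _) -scalemxAl -scalemxAr scalerA.
Qed.

Lemma tr_expr_sum_words (O : comNzRingType) (T : finType) L d (c : T -> O) (B : T -> 'M[O]_d) :
  \tr ((\sum_t c t *: B t) ^+ L) =
    \sum_(w : {ffun 'I_L -> T}) (\prod_i c (w i)) * \tr (\prod_i B (w i)).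
Proof.
by rewrite expr_sum_words raddf_sum; apply: eq_bigr => w _ /=; rewrite mxtraceZ.
Qed.

Section WordSums.
Variables (O : comNzRingType) (M : finMonoidType).

(* The value of the linear extension of [f] at the [L]-th power of [\sum_b c b b]. *)
Definition word_sum L (c : M -> O) (f : M -> O) : O :=
  \sum_(w : {ffun 'I_L -> M}) (\prod_i c (w i)) * f (\prod_i w i)%g.

Lemma word_sum_lin L c (I : finType) (u : I -> O) (f : I -> M -> O) :
  word_sum L c (fun b => \sum_i u i * f i b) = \sum_i u i * word_sum L c (f i).
Proof.
rewrite /word_sum; under eq_bigr do rewrite mulr_sumr.
rewrite exchange_big; apply: eq_bigr => i _; rewrite mulr_sumr.
by apply: eq_bigr => w _; rewrite mulrCA.
Qed.

End WordSums.

(** * Powers and classes in a finite monoid *)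

Section MonoidPowers.
Variable M : finMonoidType.

Lemma expg_period (a : M) i k n q :
  (a ^+ i = a ^+ (i + k))%g -> (i <= n)%N -> (a ^+ (n + k * q) = a ^+ n)%g.
Proof.
move=> aik le_in; elim: q => [|q IH]; first by rewrite muln0 addn0.
rewrite -IH mulnSr addnA -(subnK (leq_trans le_in (leq_addr (k * q) n))) -addnA.
by rewrite !(expgnDr _ (n + k * q - i)) -aik.
Qed.

Lemma idempotent_exponent : exists2 e, (0 < e)%N & forall b : M, (b ^+ (e + e) = b ^+ e)%g.
Proof.
(* By the pigeonhole principle every element repeats with an index and a period at most [#|M|]; the
   factorial is a multiple of this period and not below the index. *)
pose n := #|M|; exists n`!; first exact: fact_gt0.
move=> b; have /injectivePn[i [j ij bij]] : ~~ injectiveb (fun i : 'I_n.+1 => (b ^+ i)%g).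
  apply/negP => /injectiveP/leq_card; rewrite card_ord.
  by rewrite ltnn.
wlog lt_ij : i j ij bij / (i < j)%N.
  move=> H; case: (ltngtP i j) => [|lt_ji|/val_inj eq_ij]; first exact: H.
    by apply: (H j i) => //; rewrite eq_sym.
  by rewrite eq_ij eqxx in ij.
have bE : (b ^+ i = b ^+ (i + (j - i)))%g by rewrite subnKC // ltnW.
have /dvdnP[q nE] : (j - i %| n`!)%N.
  apply: dvdn_fact; rewrite subn_gt0 lt_ij /= (leq_trans (leq_subr _ _)) //.
  by rewrite -ltnS ltn_ord.
rewrite {2}nE mulnC (expg_period _ bE) // (leq_trans _ (fact_geq _)) //.
by rewrite -ltnS ltn_ord.
Qed.

Lemma expg_eventually_periodic (b : M) e m q :
  (b ^+ (e + e) = b ^+ e)%g -> (e <= m)%N -> (b ^+ (m + e * q) = b ^+ m)%g.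
Proof. by move=> bee; apply: expg_period. Qed.

(* Characters are constant on the classes of the equivalence relation that
   [class_step e] generates, when every [b ^+ e] is idempotent. *)
Definition class_step e : rel M := fun x y =>
  [|| [exists u : M, exists v : M, (x == u * v) && (y == v * u)],
      y == x ^+ e.+1 | x == y ^+ e.+1]%g.

Lemma class_step_sym e : symmetric (class_step e).
Proof.
suff sym x y : class_step e x y -> class_step e y x by move=> x y; apply/idP/idP => /sym.
case/or3P=> [/existsP[u /existsP[v /andP[xE yE]]]|H|H]; apply/or3P.
- by apply: Or31; apply/existsP; exists v; apply/existsP; exists u; rewrite xE yE.
- exact: Or33.
- exact: Or32.
Qed.

End MonoidPowers.

(** * Powers of the kernel of a reduction with a Frobenius lift *)

Section FrobeniusLift.
Variables (O : comNzRingType) (k : fieldType) (p : nat).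
Variables (red : {rmorphism O -> k}) (phi : {rmorphism O -> O}).
Hypotheses (p_prime : prime p) (k_char : p \in [pchar k]).
Hypothesis O_torsion : forall x : O, x *+ p = 0 -> x = 0.
Hypothesis phi_frob : forall x, exists y, phi x = x ^+ p + y *+ p.
Hypothesis red_phi : forall x, red (phi x) = red x ^+ p.

(* [Ipow n] is the n-th power of the kernel of [red]. *)
Inductive Ipow : nat -> O -> Prop :=
| Ipow0 x : Ipow 0 x
| IpowD n x y : Ipow n x -> Ipow n y -> Ipow n (x + y)
| IpowI n x y : red x = 0 -> Ipow n y -> Ipow n.+1 (x * y).

Lemma Ipow_zero n : Ipow n 0.
Proof. by elim: n => [|n IH]; [exact: Ipow0 | rewrite -[0](mul0r 0); apply: IpowI; rewrite ?rmorph0]. Qed.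

Lemma IpowMl n a x : Ipow n x -> Ipow n (a * x).
Proof.
elim=> [y|m y z _ Hy _ Hz|m y z y0 _ Hz]; first exact: Ipow0.
  by rewrite mulrDr; apply: IpowD.
by rewrite mulrCA; apply: IpowI.
Qed.

Lemma IpowMr n a x : Ipow n x -> Ipow n (x * a).
Proof. by rewrite mulrC; exact: IpowMl. Qed.

Lemma IpowN n x : Ipow n x -> Ipow n (- x).
Proof. by rewrite -mulN1r; exact: IpowMl. Qed.

Lemma IpowB n x y : Ipow n x -> Ipow n y -> Ipow n (x - y).
Proof. by move=> Hx /IpowN; exact: IpowD. Qed.

Lemma Ipow_trans n x y z : Ipow n (x - y) -> Ipow n (y - z) -> Ipow n (x - z).
Proof. by move=> xy yz; have := IpowD xy yz; rewrite addrA subrK. Qed.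

Lemma IpowMn n x m : Ipow n x -> Ipow n (x *+ m).
Proof. by rewrite -mulr_natr; exact: IpowMr. Qed.

Lemma IpowMz n x (m : int) : Ipow n x -> Ipow n (x *~ m).
Proof. by rewrite -mulrzr; exact: IpowMr. Qed.

Lemma Ipow_sum n (I : Type) (r : seq I) (P : pred I) (f : I -> O) :
  (forall i, P i -> Ipow n (f i)) -> Ipow n (\sum_(i <- r | P i) f i).
Proof. by move=> Hf; apply: (big_ind (Ipow n)) => //; [exact: Ipow_zero | move=> x y; exact: IpowD]. Qed.

Lemma Ipow_leq m n x : (m <= n)%N -> Ipow n x -> Ipow m x.
Proof.
move=> le_mn H; elim: H m le_mn => [y|n' y z _ Hy _ Hz|n' y z y0 _ Hz] [|m] le_mn //; try exact: Ipow0.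
  by apply: IpowD; [exact: Hy | exact: Hz].
by apply: IpowI => //; apply: Hz.
Qed.

Lemma Ipow1P x : Ipow 1 x <-> red x = 0.
Proof.
split=> [H|x0]; last by rewrite -[x]mulr1; apply: IpowI => //; exact: Ipow0.
suff: forall n x, Ipow n x -> (0 < n)%N -> red x = 0 by move=> /(_ _ _ H); apply.
move=> n y; elim=> [//|m y1 y2 _ H1 _ H2 m0|m y1 y2 y0 _ _ _].
  by rewrite rmorphD H1 ?H2 ?addr0.
by rewrite rmorphM y0 mul0r.
Qed.

Lemma red_pn (n : nat) x : (p %| n)%N -> red (x *+ n) = 0.
Proof.
move=> /dvdnP[m ->]; rewrite mulrnA rmorphMn /= -mulr_natr.
by rewrite (pcharf0 k_char) mulr0.
Qed.

Lemma Ipow_Mpn n j x : Ipow n x -> Ipow (n + j) (x *+ p ^ j).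
Proof.
move=> Hx; elim: j => [|j IH]; first by rewrite addn0 expn0.
rewrite expnS mulnC mulrnA -mulr_natl addnS; apply: IpowI => //.
exact: red_pn.
Qed.

(** Each [p]-th power raises the precision by one: in [x ^+ p - y ^+ p] the cofactor of [x - y] is a
    sum of [p] terms with the same reduction, so it reduces to 0. *)
Lemma Ipow_congr_exp n a b : red a = red b -> Ipow n.+1 (a ^+ (p ^ n) - b ^+ (p ^ n)).
Proof.
move=> ab; elim: n => [|n IH].
  by rewrite expn0 !expr1; apply/Ipow1P; rewrite rmorphB ab subrr.
rewrite expnSr !exprM subrXX mulrC; apply: IpowI => //.
rewrite rmorph_sum /=; transitivity (\sum_(i < p) red (a ^+ (p ^ n)) ^+ p.-1).
  apply: eq_bigr => i _; rewrite rmorphM /= !rmorphXn ab -exprD.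
  by congr (_ ^+ _); move: (ltn_ord i); lia.
by rewrite sumr_const card_ord -mulr_natr (pcharf0 k_char) mulr0.
Qed.

Lemma binomial_congr m x y : exists w, (x + y) ^+ p = x ^+ p + y ^+ p + w *+ p /\
  (Ipow m x -> Ipow m y -> Ipow m w).
Proof.
eexists; split; first exact: exprD_prime.
move=> Hx Hy; rewrite big_nat_cond; apply: Ipow_sum => -[//|i] _; apply: IpowMn.
by rewrite exprS mulrCA; apply: IpowMr.
Qed.

(* The derivation [d x = (phi x - x ^ p) / p] maps the (n+1)-st power of the
   kernel to the n-th one; this detects divisibility by [p]. *)
Lemma Ipow_derivation n x z : Ipow n.+1 x -> phi x = x ^+ p + z *+ p -> Ipow n z.
Proof.
have cancelp (a b : O) : a *+ p = b *+ p -> a = b.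
  by move=> ab; apply/eqP; rewrite -subr_eq0; apply/eqP/O_torsion; rewrite mulrnBl ab subrr.
suff main m : forall x, Ipow m x -> forall n z, m = n.+1 -> phi x = x ^+ p + z *+ p -> Ipow n z.
  by move=> Hx; apply: (main n.+1).
move=> y; elim=> {m y} [//|m y1 y2 H1 IH1 H2 IH2|m y1 y2 y0 H2 IH2] n' z' mE zE.
  have [z1 z1E] := phi_frob y1; have [z2 z2E] := phi_frob y2.
  have [w [wE Hw]] := binomial_congr m y1 y2.
  have -> : z' = z1 + z2 - w.
    apply: cancelp; apply: (addrI ((y1 + y2) ^+ p)); rewrite -zE rmorphD z1E z2E wE.
    exact: frobenius_sum_identity.
  apply: IpowB; first by apply: IpowD; [exact: IH1 | exact: IH2].
  by apply: Ipow_leq (Hw H1 H2); rewrite mE.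
have [z1 z1E] := phi_frob y1; have [z2 z2E] := phi_frob y2.
have -> : z' = phi y1 * z2 + z1 * y2 ^+ p.
  apply: cancelp; apply: (addrI ((y1 * y2) ^+ p)); rewrite -zE rmorphM z2E.
  rewrite exprMn z1E; exact: frobenius_prod_identity.
(* In both terms one factor supplies what is missing: [phi y1] again reduces to 0, and [y2 ^+ p]
   lies in the same power of the kernel as [y2]. *)
case: mE => mE; subst n'; apply: IpowD.
  case: m H2 IH2 => [|m] H2 IH2; first exact: Ipow0.
  apply: IpowI; last exact: IH2.
  by rewrite red_phi y0 expr0n; case: p p_prime.
rewrite mulrC; apply: IpowMr; case: p p_prime => // q _.
by rewrite exprS; apply: IpowMr.
Qed.

(** The derivation trades one factor [p] for one power of the kernel and replaces the reduction of
    [y] by its [p]-th power. *)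
Lemma Ipow_torsion s y : Ipow s.+1 (y *+ p ^ s) -> red y = 0.
Proof.
have p0 := prime_gt0 p_prime; have p1 := prime_gt1 p_prime.
elim: s y => [|s IH] y; first by rewrite expn0 => /Ipow1P.
(* [x ^+ p] contains [p] with exponent [s.+1 * p]; setting aside the [s.+1] factors that [phi x]
   shares leaves [j], and [j > 0] makes this term reduce to 0. *)
set x := y *+ p ^ s.+1; pose j := (s.+1 * p - s.+1)%N => Hx.
have j0 : (0 < j)%N by rewrite subn_gt0 -{1}[s.+1]muln1 ltn_mul2l.
have red0 : red ((y ^+ p) *+ p ^ j) = 0.
  by apply: red_pn; rewrite -(prednK j0) expnS dvdn_mulr.
have : Ipow s.+1 ((phi y - y ^+ p *+ p ^ j) *+ p ^ s).
  apply: (Ipow_derivation Hx).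
  have jE : (s.+1 * p = j + s.+1)%N by rewrite subnK // -{1}[s.+1]muln1 leq_mul2l.
  rewrite /x rmorphMn /= exprMn_n -expnM jE expnD -[_ *+ p ^ s *+ p]mulrnA -expnSr.
  by rewrite mulrnBl -mulrnA addrC subrK.
move/IH; rewrite rmorphB red0 subr0 red_phi => /eqP.
by rewrite expf_eq0 => /andP[_ /eqP].
Qed.

(** A nonzero [c] is a power of [p] times a number prime to [p]; lying deep enough, it would force
    the second factor to reduce to 0 in [k]. *)
Lemma Ipow_int_eq0 (c : int) : (forall n, Ipow n (c%:~R)) -> c = 0.
Proof.
move=> Hc; apply/eqP; rewrite -absz_eq0; apply/negPn/negP; rewrite -lt0n => c0.
have [s pN cE] := pfactor_coprime p_prime c0.
have : Ipow (logn p `|c|).+1 ((s%:R : O) *+ p ^ logn p `|c|).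
  rewrite -mulrnA -cE; case: c Hc {c0 cE} => m Hm; first exact: Hm.
  by have := IpowN (Hm (logn p `|Negz m|).+1); rewrite NegzE mulrNz opprK.
move/Ipow_torsion; rewrite rmorph_nat => /eqP.
rewrite -(dvdn_pcharf k_char) => /(elimT idP).
by rewrite (prime_coprime _ p_prime) in pN; rewrite (negbTE pN).
Qed.

Section Rotations.
Variables (X : finType) (P : pred X) (sg : X -> X) (N : nat) (h : X -> O).
Hypotheses (sgP : forall x, P x -> P (sg x)) (hsg : forall x, P x -> h (sg x) = h x).
Hypothesis sgN : forall x, P x -> iter (p ^ N) sg x = x.

(* An orbit of size [p ^ j] contributes [p ^ j] times the value of [h]. *)
Lemma Ipow_orbit_sum m :
    (forall x j, P x -> (j <= N)%N -> iter (p ^ j) sg x = x -> Ipow (m - j) (h x)) ->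
  Ipow m (\sum_(x | P x) h x).
Proof.
move=> Hh; pose T := {x : X | P x}.
pose f (x : T) : T := exist _ (sg (val x)) (sgP (valP x)).
have fE n x : val (iter n f x) = iter n sg (val x) by elim: n => //= n ->.
have fN x : iter (p ^ N) f x = x by apply: val_inj; rewrite fE sgN ?(valP x).
have fI : injective f.
  have pN0 : (0 < p ^ N)%N by rewrite expn_gt0 prime_gt0.
  move=> x y fxy; rewrite -[x]fN -[y]fN -(prednK pN0).
  by rewrite !iterSr fxy.
pose s := perm fI; have sE : s =1 f by move=> x; rewrite permE.
have sN : (s ^+ (p ^ N))%g = 1%g.
  by apply/permP => x; rewrite permX (eq_iter sE) fN perm1.
have -> : \sum_(x | P x) h x = \sum_(x : T) h (val x).
  rewrite (reindex_omap (val : T -> X) insub) => [|x Px]; last by rewrite insubT.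
  by apply: eq_bigl => x; rewrite valK (valP x) eqxx.
rewrite (partition_big (porbit s) predT) //=; apply: Ipow_sum => C _.
have [x0 /eqP CE|C0] := pickP (fun x => porbit s x == C); last first.
  by rewrite big_pred0 //; exact: Ipow_zero.
have hC x : porbit s x == C -> h (val x) = h (val x0).
  rewrite -CE eq_porbit_mem => /porbitP[i ->]; rewrite permX (eq_iter sE) fE.
  by elim: i => //= i IH; rewrite hsg // -fE; exact: valP.
rewrite (eq_bigr _ hC) sumr_const.
have -> : #|[pred x | porbit s x == C]| = #|porbit s x0|.
  by apply: eq_card => x; rewrite -CE !inE eq_porbit_mem.
have : (#|porbit s x0| %| p ^ N)%N.
  apply: (@dvdn_trans #[s]%g); last by rewrite order_dvdn sN.
  by rewrite porbit.unlock; exact: (dvdn_orbit 'P%act).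
case/(dvdn_pfactor _ _ p_prime)=> j jN cE; rewrite cE.
have := Hh (val x0) j (valP x0) jN; rewrite -fE -(eq_iter sE) -cE iter_porbit => /(_ erefl) H.
(* For [m < j] the factor [p ^ j] alone already lies in [Ipow m]. *)
rewrite cE; case: (leqP j m) => [jm|mj].
  by have := Ipow_Mpn j H; rewrite subnK.
by apply: Ipow_leq (Ipow_Mpn j (Ipow0 _)); rewrite add0n ltnW.
Qed.

End Rotations.

(** * Traces of matrix powers with exponent a power of p *)

Section PowerTraces.
Let p0 : (0 < p)%N := prime_gt0 p_prime.
Let pN0 N : (0 < p ^ N)%N. Proof. by rewrite expn_gt0 p0. Qed.

Lemma map_mx_exp d (A : 'M[O]_d) n : map_mx red (A ^+ n) = map_mx red A ^+ n.
Proof.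
elim: n => [|n IH]; first by rewrite !expr0 -[1]/(1%:M) map_mx1.
by rewrite !exprS -IH -[_ * _]/(_ *m _) map_mxM.
Qed.

(** The powers themselves need not be congruent, since matrices do not commute. In the expansion
    over elementary matrices, a word of [p ^ N] letters with period [p ^ j] has as coefficient a
    power of exponent [p ^ (N - j)], which is determined to precision [N - j + 1]; the orbit sum
    gains the remaining [j]. *)
Lemma tr_pow_congr N d (A A' : 'M[O]_d) : map_mx red A = map_mx red A' ->
  Ipow N.+1 (\tr (A ^+ (p ^ N)) - \tr (A' ^+ (p ^ N))).
Proof.
move=> AA'; pose T := ('I_d * 'I_d)%type; pose B (t : T) : 'M[O]_d := delta_mx t.1 t.2.
have AE (C : 'M[O]_d) : C = \sum_(t : T) C t.1 t.2 *: B t.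
  by rewrite [LHS]matrix_sum_delta pair_bigA.
rewrite [A]AE [A']AE !tr_expr_sum_words -sumrB.
under eq_bigr do rewrite -mulrBl.
apply: (@Ipow_orbit_sum _ predT (@rotate T _ (pN0 N)) N) => // [w _|w _|w j _ jN wj].
- rewrite tr_rotate; congr ((_ - _) * _).
    exact: (prod_rotate (pN0 N) (fun t : T => A t.1 t.2)).
  exact: (prod_rotate (pN0 N) (fun t : T => A' t.1 t.2)).
- exact: iter_rotate.
have LE : (p ^ N = p ^ j * p ^ (N - j))%N by rewrite -expnD subnKC.
rewrite (prod_periodic (fun t : T => A t.1 t.2) LE wj).
rewrite (prod_periodic (fun t : T => A' t.1 t.2) LE wj) subSn //; apply: IpowMr.
apply: Ipow_congr_exp; rewrite !rmorph_prod; apply: eq_bigr => i _.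
by have /matrixP/(_ (cyclic_ext (pN0 N) w i).1 (cyclic_ext (pN0 N) w i).2) := AA'; rewrite !mxE.
Qed.

Lemma mulmx_pow m n (A : 'M[O]_(m, n)) (B : 'M[O]_(n, m)) l :
  (A *m B : 'M_m) ^+ l *m A = A *m (B *m A : 'M_n) ^+ l.
Proof.
elim: l => [|l IH]; first by rewrite !expr0 mul1mx mulmx1.
rewrite !exprSr -[X in X *m A]/((A *m B : 'M_m) ^+ l *m (A *m B)).
by rewrite -[RHS]/(A *m ((B *m A : 'M_n) ^+ l *m (B *m A))) [RHS]mulmxA -IH !mulmxA.
Qed.

Lemma tr_mulmx_pow m n (A : 'M[O]_(m, n)) (B : 'M[O]_(n, m)) l : (0 < l)%N ->
  \tr ((A *m B : 'M_m) ^+ l) = \tr ((B *m A : 'M_n) ^+ l).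
Proof.
case: l => // l _; rewrite !exprSr -[X in \tr X = _]/((A *m B : 'M_m) ^+ l *m (A *m B)).
rewrite -[X in _ = \tr X]/((B *m A : 'M_n) ^+ l *m (B *m A)) [in LHS]mulmxA mulmx_pow.
by rewrite -mulmxA mxtrace_mulC mulmxA.
Qed.

Lemma tr_pow_block m n (A : 'M[O]_m) (C : 'M[O]_(m, n)) (B : 'M[O]_n) l :
  \tr ((block_mx A C 0 B) ^+ l) = \tr (A ^+ l) + \tr (B ^+ l).
Proof.
suff [D ->] : exists D, block_mx A C 0 B ^+ l = block_mx (A ^+ l) D 0 (B ^+ l).
  by rewrite mxtrace_block.
elim: l => [|l [D IH]]; first by exists 0; rewrite !expr0 -[1]/(1%:M) scalar_mx_block.
exists (A *m D + C *m B ^+ l); rewrite exprS IH -[LHS]/(_ *m _) mulmx_block.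
by rewrite !mulmx0 !mul0mx !addr0 add0r !exprS.
Qed.

Section Lifts.
Variable lift : k -> O.
Hypothesis liftK : cancel lift red.
Let mxlift m n (A : 'M[k]_(m, n)) := map_mx lift A.

Lemma map_mx_liftK m n (A : 'M[k]_(m, n)) : map_mx red (map_mx lift A) = A.
Proof. by apply/matrixP => i j; rewrite !mxE liftK. Qed.

(* Modulo [Ipow N.+1] this depends neither on [lift] nor on the basis. *)
Definition power_trace N d (A : 'M[k]_d) : O := \tr ((map_mx lift A) ^+ (p ^ N)).

Lemma power_traceE N d (A : 'M[k]_d) (B : 'M[O]_d) : map_mx red B = A ->
  Ipow N.+1 (power_trace N A - \tr (B ^+ (p ^ N))).
Proof. by move=> BA; apply: tr_pow_congr; rewrite map_mx_liftK. Qed.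

Lemma power_trace_mulmx N m n (A : 'M[k]_(m, n)) (B : 'M[k]_(n, m)) :
  Ipow N.+1 (power_trace N (A *m B) - power_trace N (B *m A)).
Proof.
have AB : map_mx red (mxlift A *m mxlift B) = A *m B by rewrite map_mxM !map_mx_liftK.
have BA : map_mx red (mxlift B *m mxlift A) = B *m A by rewrite map_mxM !map_mx_liftK.
have := IpowB (power_traceE N AB) (power_traceE N BA).
by rewrite (tr_mulmx_pow _ _ (pN0 N)) opprB addrA subrK.
Qed.

Lemma power_trace_conj N d d' (A : 'M[k]_d) (U : 'M[k]_(d', d)) (U' : 'M[k]_(d, d')) :
  U' *m U = 1%:M -> Ipow N.+1 (power_trace N (U *m A *m U') - power_trace N A).
Proof.
move=> U'U; have := power_trace_mulmx N (U *m A) U'.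
by rewrite mulmxA U'U mul1mx.
Qed.

Lemma power_trace_block N d d' (A : 'M[k]_d) (C : 'M[k]_(d, d')) (B : 'M[k]_d') :
  Ipow N.+1 (power_trace N (block_mx A C 0 B) - (power_trace N A + power_trace N B)).
Proof.
rewrite /(power_trace N A) /(power_trace N B) -(tr_pow_block _ (mxlift C)).
by apply: power_traceE; rewrite map_block_mx !map_mx_liftK map_mx0.
Qed.

(** Exchanging the two factors of a rank factorization of [E] produces the identity matrix of size
    [\rank E]. *)
Lemma power_trace_idem N d (E : 'M[k]_d) : E *m E = E ->
  Ipow N.+1 (power_trace N E - (\rank E)%:R).
Proof.
move=> EE; rewrite -{1}(mulmx_base E).
have VU : row_base E *m col_base E = 1%:M.
  apply: (row_free_inj (row_base_free E)); rewrite /= mul1mx -mulmxA mulmx_base.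
  by apply: (row_full_inj (col_base_full E)); rewrite /= mulmxA mulmx_base EE.
have r1 : map_mx red (1%:M : 'M_(\rank E)) = 1%:M by exact: map_mx1.
have := IpowD (power_trace_mulmx N (col_base E) (row_base E)) (power_traceE N r1).
by rewrite VU addrA subrK expr1n -[1]/(1%:M) mxtrace1.
Qed.

Lemma power_trace_shift N j d (A : 'M[k]_d) : (j <= N)%N ->
  Ipow (N - j).+1 (power_trace N A - power_trace (N - j) (A ^+ (p ^ j))).
Proof.
move=> jN; rewrite -opprB; apply: IpowN.
have -> : power_trace N A = \tr ((mxlift A ^+ (p ^ j)) ^+ (p ^ (N - j))).
  by rewrite -exprM -expnD subnKC.
by apply: power_traceE; rewrite map_mx_exp map_mx_liftK.
Qed.

Section Representation.
Variables (M : finMonoidType) (d : nat) (r : M -> 'M[k]_d).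
Hypotheses (r1 : r 1%g = 1%:M) (rM : forall a b, r (a * b)%g = r a *m r b).

Lemma repr_exp a n : r (a ^+ n)%g = r a ^+ n.
Proof.
by elim: n => [|n IH]; rewrite ?expg0 ?expr0 ?r1 // expgS rM IH exprS.
Qed.

Lemma repr_prod (I : Type) (s : seq I) (f : I -> M) :
  r (\prod_(i <- s) f i)%g = \prod_(i <- s) r (f i).
Proof. by elim: s => [|i s IH]; rewrite ?big_nil ?r1 // !big_cons rM IH. Qed.

Lemma word_sum_power_trace N N1 (c f : M -> O) :
    (forall a b, f (a * b)%g = f (b * a)%g) ->
    (forall b n, (n <= N)%N ->
       Ipow (n.+1 - N1) (f (b ^+ (p ^ n))%g - power_trace n (r b))) ->
  Ipow (N.+1 - N1) (power_trace N (\sum_b red (c b) *: r b) - word_sum (p ^ N) c f).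
Proof.
move=> fC Hf; pose B b := mxlift (r b).
have redB : map_mx red (\sum_b c b *: B b) = \sum_b red (c b) *: r b.
  rewrite raddf_sum; apply: eq_bigr => b _ /=.
  by rewrite map_mxZ map_mx_liftK.
rewrite -(subrK (\tr ((\sum_b c b *: B b) ^+ (p ^ N))) (power_trace N _)) -addrA.
apply: IpowD; first by apply: Ipow_leq (power_traceE N redB); rewrite leq_subr.
rewrite tr_expr_sum_words /word_sum -sumrB; under eq_bigr do rewrite -mulrBr.
apply: (@Ipow_orbit_sum _ predT (@rotate M _ (pN0 N)) N) => // [w _|w _|w j _ jN wj].
- rewrite tr_rotate prod_rotate; congr (_ * (_ - _)).
  by rewrite mprod_rotate (mprod_rotate0 (pN0 N)) fC.
- exact: iter_rotate.
have LE : (p ^ N = p ^ j * p ^ (N - j))%N by rewrite -expnD subnKC.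
rewrite (prod_periodic B LE wj) (mprod_word_periodic LE wj).
set b := (\prod_(_ <= _ < _) _)%g; rewrite subnAC subSn //.
apply: IpowMl; rewrite -opprB; apply: IpowN.
have redb : map_mx red (\prod_(0 <= n < p ^ j) B (cyclic_ext (pN0 N) w n)) = r b.
  rewrite /b repr_prod; elim: (index_iota _ _) => [|i s IH].
    by rewrite !big_nil -[1]/(1%:M) map_mx1.
  by rewrite !big_cons -[_ * _]/(_ *m _) map_mxM IH map_mx_liftK.
rewrite -(subrK (power_trace (N - j) (r b)) (f _)) -addrA; apply: IpowD.
  by apply: Hf; exact: leq_subr.
by apply: Ipow_leq (power_traceE (N - j) redb); rewrite leq_subr.
Qed.

Section ClassFunctions.
Variables (e N N1 : nat).
Hypothesis e_exp : forall b : M, (b ^+ (e + e) = b ^+ e)%g.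
Hypotheses (N1e : (e <= p ^ N1)%N) (N1N : (N1 <= N)%N).
Hypothesis pN_exp : forall b : M, (b ^+ (p ^ (N + N1)) = b ^+ (p ^ N1))%g.

(** [b] and [b ^+ e.+1] have the same power of exponent [p ^ N1], since this exponent is at least
    [e]; shifting by it costs [N1] steps of precision. The conjugacy step is the symmetry of the
    trace. *)
Lemma power_trace_class b b' : connect (class_step e) b b' ->
  Ipow (N.+1 - N1) (power_trace N (r b) - power_trace N (r b')).
Proof.
case/connectP=> s; elim: s b => [b _ ->|a s IH b /= /andP[ba sP] b'E].
  by rewrite subrr; exact: Ipow_zero.
rewrite -(subrK (power_trace N (r a)) (power_trace N (r b))) -addrA.
apply: IpowD; last exact: (IH a sP b'E).
have powE x : Ipow (N.+1 - N1) (power_trace N (r x) - power_trace N (r (x ^+ e.+1)%g)).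
  have -> : power_trace N (r x) - power_trace N (r (x ^+ e.+1)%g) =
      (power_trace N (r x) - power_trace (N - N1) (r x ^+ (p ^ N1))) -
      (power_trace N (r (x ^+ e.+1)%g) - power_trace (N - N1) (r (x ^+ e.+1)%g ^+ (p ^ N1))).
    rewrite -!repr_exp -expgnA mulSn expg_eventually_periodic //.
    by rewrite opprB addrA subrK.
  by rewrite subSn //; apply: IpowB; exact: power_trace_shift.
case/or3P: ba => [/existsP[u /existsP[v /andP[/eqP-> /eqP->]]]|/eqP->|/eqP->].
- by rewrite !rM; apply: Ipow_leq (power_trace_mulmx _ _ _); rewrite leq_subr.
- exact: powE.
- by rewrite -opprB; apply: IpowN.
Qed.

(** Shifting both traces down to [power_trace (n - N1)] leaves the powers of [b] with exponents
    [p ^ (N + N1)] and [p ^ N1], which are equal. For [n < N1] the precision is 0 and nothing is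
    claimed. *)
Lemma power_trace_periodic b n : (n <= N)%N ->
  Ipow (n.+1 - N1) (power_trace N (r (b ^+ (p ^ n))%g) - power_trace n (r b)).
Proof.
move=> nN; have [n_lt|N1n] := ltnP n N1.
  by rewrite (eqP (_ : n.+1 - N1 == 0)%N) ?subn_eq0 //; exact: Ipow0.
have jN : (N - (n - N1) <= N)%N by rewrite leq_subr.
have NE : (N - (N - (n - N1)) = n - N1)%N.
  by rewrite subKn // (leq_trans (leq_subr _ _)).
have := IpowB (power_trace_shift (r (b ^+ (p ^ n))%g) jN) (Ipow_leq _ (power_trace_shift (r b) N1n)).
rewrite NE -!repr_exp -expgnA -expnD.
have -> : (n + (N - (n - N1)) = N + N1)%N.
  by rewrite addnBA ?(leq_trans (leq_subr _ _)) // addnC -addnBA ?leq_subr // subKn.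
rewrite pN_exp opprB addrA subrK subSn // => H; exact: H.
Qed.

(** Power traces are constant on classes only modulo a power of the kernel; evaluating them at a
    chosen representative gives an exact class function, to which linear identities between class
    functions apply. *)
Definition class_repr (b : M) := fingraph.root (class_step e) b.

Lemma class_reprP b : connect (class_step e) b (class_repr b).
Proof. exact: connect_root. Qed.

Lemma class_repr_eq b b' : connect (class_step e) b b' -> class_repr b = class_repr b'.
Proof. by move=> bb'; apply/eqP; rewrite root_connect //; exact/sym_connect_sym/class_step_sym. Qed.

Lemma word_sum_power_trace_class c :
  Ipow (N.+1 - N1) (power_trace N (\sum_b red (c b) *: r b) -
    word_sum (p ^ N) c (fun b => power_trace N (r (class_repr b)))).
Proof.
apply: word_sum_power_trace => [a b|b n nN].
  congr (power_trace N (r _)); apply: class_repr_eq; apply: connect1.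
  by apply/or3P/Or31; apply/existsP; exists a; apply/existsP; exists b; rewrite !eqxx.
rewrite -(subrK (power_trace N (r (b ^+ (p ^ n))%g)) (power_trace N _)) -addrA.
apply: IpowD; last exact: power_trace_periodic.
apply: (@Ipow_leq _ (N.+1 - N1)); first by rewrite leq_sub2r.
rewrite -opprB; apply: IpowN; apply: power_trace_class; exact: class_reprP.
Qed.

End ClassFunctions.
End Representation.

Section Singular.
Variables (M : finMonoidType).

Definition fixcount (a b : M) : nat := #|[set x | a * x * b == x]%g|.

(* The sum runs over pairs of a point [x] and a word [w] with [a x w = x];
   moving the first letter of [w] past [x] permutes them, and no power
   [p ^ j] with [j <= N] of this permutation has a fixed point. *)
Lemma word_sum_singular N l (a : M) (c : M -> O) :
    (forall x b, a * x * b = x -> a ^+ ((p ^ N - 1) * p ^ l) * x = x)%g ->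
    (forall x b, a * x * b = x -> a ^+ (p ^ N - 1) * x <> x)%g ->
  Ipow N.+1 (word_sum (p ^ N) c (fun b => (fixcount a b)%:R)).
Proof.
move=> aper afree; pose X := (M * {ffun 'I_(p ^ N) -> M})%type.
pose P (u : X) := (a * u.1 * (\prod_i u.2 i) == u.1)%g.
pose h (u : X) : O := \prod_i c (u.2 i).
pose sg (u : X) : X := ((a * u.1 * cyclic_ext (pN0 N) u.2 0)%g, rotate (pN0 N) u.2).
have -> : word_sum (p ^ N) c (fun b => (fixcount a b)%:R) = \sum_(u | P u) h u.
  rewrite /word_sum; under eq_bigr do rewrite /fixcount -sum1dep_card natr_sum mulr_sumr.
  rewrite (exchange_big_dep predT) //= pair_big_dep /=.
  by apply: eq_big => [u|u _]; rewrite ?mulr1.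
have sgE j u : iter j sg u =
    ((a ^+ j * u.1 * \prod_(0 <= n < j) cyclic_ext (pN0 N) u.2 n)%g, iter j (rotate (pN0 N)) u.2).
  elim: j => [|j IH]; first by rewrite big_geq //= mul1g mulg1; case: u.
  rewrite iterS IH /sg /= (cyclic_ext_iter (pN0 N) u.2 j 0) add0n big_nat_recr //=.
  by rewrite expgS !mulgA.
(* A full turn of the word multiplies the point by [a ^+ (p ^ N - 1)] only, because one factor [a]
   together with the word is absorbed by the equation [P u]. *)
have sgL u : P u -> iter (p ^ N) sg u = ((a ^+ (p ^ N - 1) * u.1)%g, u.2).
  move=> /eqP Pu; rewrite sgE iter_rotate; congr (_, _).
  rewrite -(mprod_cyclic_ext (pN0 N)) -{1}[X in (a ^+ X)%g](subnK (pN0 N)).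
  by rewrite expgnDr expg1 -!mulgA [X in (_ * X)%g]mulgA Pu.
have sgP u : P u -> P (sg u).
  move=> /eqP Pu; apply/eqP; rewrite /= (mprod_rotate (pN0 N)).
  rewrite -[in RHS]Pu (mprod_rotate0 (pN0 N)) /=.
  by rewrite !mulgA.
have sgiP j u : P u -> P (iter j sg u) by move=> Pu; elim: j => //= j; exact: sgP.
apply: (@Ipow_orbit_sum _ P sg (N + l)) => // [u _|u Pu|u j Pu jNl uj].
- exact: prod_rotate.
- have E q : iter (p ^ N * q) sg u = ((a ^+ ((p ^ N - 1) * q) * u.1)%g, u.2).
    elim: q => [|q IH]; first by rewrite !muln0 expg0 mul1g; case: u {Pu}.
    rewrite mulnS iterD sgL ?sgiP // IH /= mulnS expgnDr mulgA //.
  by rewrite expnD E (aper _ _ (eqP Pu)); case: u {Pu E}.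
have [jN|Nj] := leqP j N; last by rewrite (eqP (_ : N.+1 - j == 0)%N) ?subn_eq0 //; exact: Ipow0.
have : iter (p ^ N) sg u = u.
  rewrite -(subnK jN) expnD; elim: (p ^ (N - j))%N => // q IH.
  by rewrite mulSn iterD IH.
by rewrite sgL // => /(congr1 fst) /= /(afree _ _ (eqP Pu)).
Qed.

End Singular.
End Lifts.
End PowerTraces.
End FrobeniusLift.

(* The polynomial ring over the integers with one variable for each element of
   [k]; the Frobenius lift raises every variable to the power [p]. *)
Section FreeCommutativeRing.
Import finmap monalg.
Variables (k : fieldType) (p : nat).
Hypotheses (p_prime : prime p) (k_char : p \in [pchar k]).
Local Notation O := {malg int[{cmonom k}]}.

Definition monom_eval (m : {cmonom k}) : k := \prod_(x <- finsupp m) x ^+ m x.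

Lemma monom_evalEw (m : {cmonom k}) (d : {fset k}) : (finsupp m `<=` d)%fset ->
  monom_eval m = \prod_(x <- d) x ^+ m x.
Proof.
move=> md; apply: big_fset_incl => // x xd.
by rewrite -cmE_eq0 => /eqP->; rewrite expr0.
Qed.

Lemma monom_eval_morph : mmorphism monom_eval.
Proof.
split=> [m1 m2|]; last by rewrite /monom_eval mdom1 big_nil.
pose d := (finsupp m1 `|` finsupp m2)%fset.
rewrite !(@monom_evalEw _ d) ?fsubsetUl ?fsubsetUr ?mdomD //.
by rewrite -big_split; apply: eq_bigr => x _; rewrite /= cmM exprD.
Qed.

HB.instance Definition _ := isMultiplicative.Build _ _ monom_eval monom_eval_morph.

Definition frob_monom (m : {cmonom k}) : O := << m >> ^+ p.

Lemma frob_monom_morph : mmorphism frob_monom.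
Proof.
split=> [m1 m2|]; last by rewrite /frob_monom -[<< _ >>]/(1 : O) expr1n.
have E : << mmul m1 m2 >> = << m1 >> * << m2 >> :> O.
  by rewrite malgM_def fgmulUU mulr1.
by rewrite /frob_monom E; exact: exprMn.
Qed.

HB.instance Definition _ := isMultiplicative.Build _ _ frob_monom frob_monom_morph.

Definition free_red : {rmorphism O -> k} := mmap intr monom_eval.
Definition free_phi : {rmorphism O -> O} := mmap intr frob_monom.

Lemma free_redU m : free_red << m >> = monom_eval m.
Proof. by rewrite [LHS]mmapU; exact: mul1r. Qed.

Lemma free_phiU m : free_phi << m >> = << m >> ^+ p.
Proof. by rewrite [LHS]mmapU; exact: mul1r. Qed.

Lemma free_ind (P : O -> Prop) : P 0 -> (forall m, P << m >>) ->
  (forall x, P x -> P (- x)) -> (forall x y, P x -> P y -> P (x + y)) ->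
  forall x, P x.
Proof.
move=> P0 PU PN PD x; rewrite (monalgE x); apply: (big_ind P) => // m _.
have Pn n : P (<< m >> *+ n) by elim: n => [|n IH]; rewrite ?mulr0n ?mulrS //; apply: PD.
have -> : << x@_m *g m >> = << m >> *~ x@_m :> O.
  by rewrite -[in LHS](intz x@_m) -(raddfMz (mkmalgU m)).
by case: (x@_m) => n; [exact: Pn | rewrite NegzE mulrNz; apply: PN; exact: Pn].
Qed.

Lemma free_torsion (x : O) : x *+ p = 0 -> x = 0.
Proof.
move=> xp; apply/malgP => m; have /malgP/(_ m) := xp; rewrite mcoeffMn mcoeff0.
by move/eqP; rewrite Num.Theory.mulrn_eq0 -leqn0 leqNgt prime_gt0 //= => /eqP.
Qed.

(** Additive generators suffice, and on monomials the congruence is an equality. *)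
Lemma free_phi_frob (x : O) : exists y, free_phi x = x ^+ p + y *+ p.
Proof.
have p0 := prime_gt0 p_prime.
elim/free_ind: x => [|m|x [y xy]|x1 x2 [y1 xy1] [y2 xy2]].
- by exists 0; rewrite rmorph0 expr0n mul0rn addr0 gtn_eqF.
- by exists 0; rewrite free_phiU mul0rn addr0.
- rewrite rmorphN xy exprNn; have [p2|p_odd] := even_prime p_prime.
    (* For [p = 2] the square loses the sign, and [- x ^+ 2] is recovered as [x ^+ 2] minus twice
       itself. *)
    exists (- x ^+ p - y); rewrite p2 sqrrN expr1n mul1r; move: (x ^+ 2) => a.
    by rewrite mulrnBl mulNrn [a *+ 2]mulr2n !opprD -!addrA [RHS]addrA subrr add0r.
  by exists (- y); rewrite -signr_odd p_odd mulN1r opprD mulNrn.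
- rewrite rmorphD xy1 xy2 (exprD_prime x1 x2 p_prime); eexists.
  exact: frobenius_sum_identity.
Qed.

Lemma free_red_phi (x : O) : free_red (free_phi x) = free_red x ^+ p.
Proof.
have p0 := prime_gt0 p_prime.
elim/free_ind: x => [|m|x IH|x y IHx IHy].
- by rewrite !rmorph0 expr0n gtn_eqF.
- by rewrite free_phiU rmorphXn.
- by rewrite !rmorphN IH; exact/esym/(pFrobenius_autN k_char).
- have redD u v : free_red (u + v) = free_red u + free_red v by exact: raddfD.
  have -> : free_phi (x + y) = free_phi x + free_phi y by exact: raddfD.
  apply: (etrans (redD _ _)); apply: (etrans (congr2 +%R IHx IHy)).
  apply: (etrans (esym (pFrobenius_autD_comm k_char (mulrC _ _)))).
  exact/esym/(congr1 (fun z => z ^+ p))/redD.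
Qed.

Definition free_lift (x : k) : O := << ucm x >>.

Lemma free_liftK : cancel free_lift free_red.
Proof.
by move=> x; rewrite free_redU /monom_eval mdomU big_seq_fset1 cmUU expr1.
Qed.

Lemma frobenius_lift_exists :
  exists (S : comNzRingType) (red : {rmorphism S -> k}) (phi : {rmorphism S -> S}) (lift : k -> S),
  [/\ forall x : S, x *+ p = 0 -> x = 0, forall x, exists y, phi x = x ^+ p + y *+ p,
      forall x, red (phi x) = red x ^+ p & cancel lift red].
Proof.
exists O, free_red, free_phi, free_lift.
split; [exact: free_torsion|exact: free_phi_frob|exact: free_red_phi|exact: free_liftK].
Qed.

End FreeCommutativeRing.

(** * The two-sided regular representation and ideals generated by idempotents *)

Section TwoSidedRegular.
Variable M : finMonoidType.

(** The map from [x] to [a * x * b], acting on row vectors. The ring varies because this matrix is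
    needed both over [k] and over its lift. *)
Definition twosided (R : comNzRingType) (a b : M) : 'M[R]_#|M| :=
  \matrix_(i, j) (a * enum_val i * b == enum_val j)%g%:R.

Lemma twosidedM (R : comNzRingType) (a b a' b' : M) :
  twosided R a b *m twosided R a' b' = twosided R (a' * a)%g (b * b')%g.
Proof.
apply/matrixP => i j; rewrite !mxE (bigD1 (enum_rank (a * enum_val i * b)%g)) //= big1.
  by rewrite !mxE enum_rankK eqxx mul1r addr0 !mulgA.
move=> l lN; rewrite !mxE; case: eqP => [lE|_]; last by rewrite mul0r.
by rewrite lE enum_valK eqxx in lN.
Qed.

Lemma tr_twosided (R : comNzRingType) (a b : M) : \tr (twosided R a b) = (fixcount a b)%:R.
Proof.
rewrite /mxtrace; under eq_bigr do rewrite mxE.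
rewrite -natr_sum /fixcount -sum1dep_card [in RHS]big_mkcond /=.
rewrite (reindex (@enum_val M M)) /=; last exact/onW_bij/enum_val_bij.
by congr (_%:R); apply: eq_bigr => i _; case: eqP.
Qed.

Lemma map_twosided (R S : comNzRingType) (f : {rmorphism R -> S}) a b :
  map_mx f (twosided R a b) = twosided S a b.
Proof. by apply/matrixP => i j; rewrite !mxE rmorph_nat. Qed.

Lemma prod_twosided (R : comNzRingType) (a : M) (I : Type) (s : seq I) (w : I -> M) :
  \prod_(i <- s) twosided R a (w i) = twosided R (a ^+ size s)%g (\prod_(i <- s) w i)%g.
Proof.
elim: s => [|i s IH] /=; last by rewrite !big_cons IH -[LHS]/(_ *m _) twosidedM -expgSr.
rewrite !big_nil expg0; apply/matrixP => i j; rewrite !mxE mul1g mulg1.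
by rewrite (inj_eq enum_val_inj).
Qed.

Lemma tr_exp_twosided (R : comNzRingType) L (c : M -> R) (a : M) :
  \tr ((\sum_b c b *: twosided R a b) ^+ L) =
    word_sum L c (fun b => (fixcount (a ^+ L)%g b)%:R).
Proof.
rewrite tr_expr_sum_words; apply: eq_bigr => w _.
have sz : size (index_enum 'I_L) = L by rewrite [index_enum _]unlock -enumT size_enum_ord.
by rewrite prod_twosided tr_twosided sz.
Qed.

End TwoSidedRegular.

Lemma trmx_exp (R : comNzRingType) d (A : 'M[R]_d) n : (A^T) ^+ n = (A ^+ n)^T.
Proof.
elim: n => [|n IH]; first by rewrite !expr0 -[1]/(1%:M) trmx1.
by rewrite exprS IH -[LHS]/(_ *m _) -trmx_mul -[_ *m _]/(_ * _) -exprSr.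
Qed.

Section Dirac.
Variables (k : fieldType) (M : finMonoidType).
Local Notation kM := (monoid_algebra k M).

(* The coefficient as an element of [k] rather than of the regular module [k^o]. *)
Definition coeff (f : kM) (m : M) : k := f m.

Definition dirac (a : M) : kM := [ffun m : M => (m == a)%:R].

Lemma diracM a b : dirac (a * b)%g = dirac a * dirac b.
Proof.
apply/ffunP => m; rewrite [RHS]malg_mulE ffunE (bigD1 a) //= [X in _ + X]big1 => [|x /negbTE xa].
  rewrite addr0 (bigD1 b) //= big1 => [|y /negbTE yb]; last by rewrite !ffunE yb mulr0 mul0r.
  by rewrite !ffunE !eqxx !mul1r addr0 eq_sym.
by rewrite big1 // => y _; rewrite !ffunE xa !mul0r.
Qed.

Lemma dirac1 : dirac 1%g = 1. Proof. by []. Qed.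

Lemma dirac_sum (f : kM) : f = \sum_b coeff f b *: dirac b.
Proof.
apply/ffunP => m; rewrite sum_ffunE (bigD1 m) //= big1 ?addr0 => [|b bm].
  by rewrite !ffunE eqxx -[RHS]/(_ * _) mulr1.
by rewrite !ffunE eq_sym (negbTE bm) -[LHS]/(_ * _) mulr0.
Qed.

Lemma sum_one (V : lmodType k) (g : M -> V) : \sum_b coeff (1 : kM) b *: g b = g 1%g.
Proof.
rewrite (bigD1 (1%g : M)) //= big1 ?addr0 => [|b /negbTE b1]; first by rewrite /coeff ffunE eqxx scale1r.
by rewrite /coeff ffunE b1 scale0r.
Qed.

Definition malg_row (f : kM) : 'rV[k]_#|M| := \row_i f (enum_val i).
Definition row_malg (x : 'rV[k]_#|M|) : kM := [ffun m => x 0 (enum_rank m)].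

Lemma malg_rowK : cancel malg_row row_malg.
Proof. by move=> f; apply/ffunP => m; rewrite ffunE mxE enum_rankK. Qed.

Lemma row_malgK : cancel row_malg malg_row.
Proof. by move=> x; apply/rowP => i; rewrite mxE ffunE enum_valK. Qed.

Lemma malg_row_mul (f e : kM) a :
  malg_row (dirac a * f * e) = malg_row f *m \sum_b coeff e b *: twosided k a b.
Proof.
rewrite mulmx_sumr; apply/rowP => j; rewrite summxE.
transitivity (\sum_b (dirac a * f * (coeff e b *: dirac b)) (enum_val j)).
  by rewrite {1}(dirac_sum e) mulr_sumr mxE sum_ffunE.
apply: eq_bigr => b _; rewrite -scalemxAr -scalerAr ffunE [RHS]mxE; congr (_ * _).
rewrite {1}(dirac_sum f) mulr_sumr mulr_suml sum_ffunE mxE.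
rewrite (reindex (@enum_val M M)) /=; last exact/onW_bij/enum_val_bij.
apply: eq_bigr => i _; rewrite !mxE -scalerAr -scalerAl -!diracM !ffunE; congr (_ * _).
by rewrite eq_sym.
Qed.

End Dirac.

Section PrincipalMatrices.
Variables (k : fieldType) (M : finMonoidType).
Local Notation kM := (monoid_algebra k M).
Variables (e : kM) (ee : e * e = e) (d : nat) (r : kM -> 'M[k]_d).
Hypothesis er : affords (principal e) r.

(** [U] is the inclusion of [(kM) e] into [kM], and [V] is the projection of [kM] onto it by right
    multiplication with [e]. *)
Lemma principal_matrices : exists (U : 'M[k]_(d, #|M|)) (V : 'M[k]_(#|M|, d)),
  V *m U = \sum_b coeff e b *: twosided k 1%g b /\
  forall a, (r (dirac k a))^T = U *m twosided k a 1%g *m V.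
Proof.
have [t [[tL tI tS] tr]] := er.
have yee y : row_malg y * e * e = row_malg y * e by rewrite -mulrA ee.
pose s y := principal_elt (yee y).
have sL : F_linear s.
  move=> c x y; apply: val_inj; rewrite submod_val_lin.
  rewrite -[RHS]/(c%:A * (row_malg x * e) + row_malg y * e) mulr_algl scalerAl -mulrDl.
  by congr (_ * _); apply/ffunP => m; rewrite !ffunE !mxE.
have [|V VE] := F_linear_factor sL tL; first by move=> y; apply/tS.
pose U := \matrix_i malg_row (val (t (delta_mx 0 i))).
have UE x : x *m U = malg_row (val (t x)).
  rewrite mulmx_sum_row [in RHS](row_sum_delta x) (F_linear_sum tL).
  apply/rowP => j; rewrite mxE summxE.
  have valsum (I : Type) (q : seq I) (F : I -> principal e) :
      (val (\sum_(i <- q) F i) : kM) = \sum_(i <- q) (val (F i) : kM).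
    by have [g gE] := submod_inj (left_ideal e); rewrite -gE linear_sum; apply: eq_bigr => i _; rewrite gE.
  rewrite valsum sum_ffunE; apply: eq_bigr => i _.
  rewrite rowK [LHS]mxE (F_linearZ tL).
  have -> : (val ((x 0 i)%:A *: t (delta_mx 0 i)) : kM) = x 0 i *: (val (t (delta_mx 0 i)) : kM).
    by rewrite principal_valZ mulr_algl.
  by rewrite ffunE mxE.
have rowdirac y a : row_malg (malg_row y *m twosided k a 1%g) = dirac k a * y.
  have := malg_row_mul y 1 a; rewrite mulr1 => yE; rewrite -[RHS]malg_rowK yE.
  by congr (row_malg (_ *m _)); apply/esym/sum_one.
exists U, V; split.
  apply/row_matrixP => i; rewrite !rowE mulmxA UE -VE.
  have := malg_row_mul (row_malg (delta_mx 0 i)) e 1%g.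
  by rewrite dirac1 mul1r row_malgK.
move=> a; apply/row_matrixP => i; rewrite !rowE; apply: tI.
rewrite tr !mulmxA -VE UE; apply: val_inj.
by rewrite principal_valZ /= rowdirac -mulrA (principal_val (t _)).
Qed.

(** The trace of [a] on [(kM) e] equals that of the map from [x] to [a x e] on all of [kM]. *)
Lemma tr_principal a : \tr (r (dirac k a)) = \sum_b coeff e b * (fixcount a b)%:R.
Proof.
have [U [V [VU rE]]] := principal_matrices.
rewrite -mxtrace_tr rE mxtrace_mulC mulmxA VU mulmx_suml raddf_sum /=.
by apply: eq_bigr => b _; rewrite -scalemxAl mxtraceZ twosidedM mulg1 mulg1 tr_twosided.
Qed.

End PrincipalMatrices.

Section PrincipalPowerTrace.
Variables (O : comNzRingType) (k : fieldType) (p : nat).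
Variables (red : {rmorphism O -> k}).
Hypotheses (p_prime : prime p) (k_char : p \in [pchar k]).
Variables (lift : k -> O) (liftK : cancel lift red) (M : finMonoidType).
Local Notation kM := (monoid_algebra k M).

(** The matrix factors are exchanged over [k], and only the resulting map on all of [kM] is lifted;
    so any lift [c] of the coefficients of [e] will do, without lifting [e] to an idempotent. *)
Lemma power_trace_principal (e : kM) (ee : e * e = e) d (r : kM -> 'M[k]_d) N a (c : M -> O) :
    affords (principal e) r -> (forall b, red (c b) = coeff e b) ->
  Ipow red N.+1 (power_trace p lift N (r (dirac k a)) -
    word_sum (p ^ N) c (fun b => (fixcount (a ^+ (p ^ N))%g b)%:R)).
Proof.
move=> er ce; have [U [V [VU rE]]] := principal_matrices ee er.
have -> : r (dirac k a) = V^T *m ((twosided k a 1%g)^T *m U^T).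
  by rewrite -[LHS]trmxK rE !trmx_mul mulmxA -mulmxA.
apply: Ipow_trans (power_trace_mulmx p_prime k_char liftK _ _ _) _.
rewrite -(tr_exp_twosided (p ^ N) c a) -mxtrace_tr -trmx_exp.
apply: power_traceE => //.
rewrite -mulmxA -trmx_mul VU -trmx_mul -map_trmx; congr (_^T).
rewrite raddf_sum mulmx_suml; apply: eq_bigr => b _ /=.
by rewrite map_mxZ map_twosided -scalemxAl twosidedM mulg1 mulg1 ce.
Qed.

End PrincipalPowerTrace.

(** * Class functions in characteristic zero *)

Section CommutingTraces.
Variables (K : closedFieldType) (M : finMonoidType).

Definition monoid_repr d (r : M -> 'M[K]_d) :=
  r 1%g = 1%:M /\ forall a b, r (a * b)%g = r a *m r b.

Variable S : (M -> K) -> Prop.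
Hypotheses (S0 : S (fun=> 0)) (SD : forall f g, S f -> S g -> S (fun b => f b + g b))
  (SZ : forall c f, S f -> S (fun b => c * f b))
  (Schar : forall d (r : M -> 'M[K]_d), monoid_repr r -> S (fun b => \tr (r b))).

(* An eigenspace of [H] is a subrepresentation, on which [H] is a scalar. *)
Lemma commuting_trace_span d (r : M -> 'M[K]_d) (H : 'M[K]_d) : monoid_repr r ->
  (forall b, H *m r b = r b *m H) -> S (fun b => \tr (r b *m H)).
Proof.
have [m] := ubnP d; elim: m d r H => // m IH d r H; rewrite ltnS => dm [r1 rM] rH.
have [d0|d0] := posnP d.
  subst d; rewrite (_ : (fun _ => _) = fun=> 0) //.
  by apply/funext => b; rewrite [_ *m _]flatmx0 mxtrace0.
have /closed_rootP[l] : size (char_poly H) != 1%N.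
  by rewrite size_char_poly eqSS -lt0n.
rewrite -eigenvalue_root_char; set E := eigenspace H l => E0.
have Epos : (0 < \rank E)%N by rewrite lt0n mxrank_eq0.
pose U := row_base E; pose W := row_base E^C%MS; pose B := col_mx U W.
have rankB : \rank B = d.
  rewrite -addsmxE (adds_eqmx (eq_row_base E) (eq_row_base _)).
  by apply/eqP; exact: addsmx_compl_full.
have cE : (\rank E + \rank E^C = d)%N by rewrite mxrank_compl subnKC // rank_leq_row.
have /row_freeP[B' BB'] : row_free B by rewrite /row_free rankB cE.
have B'B : B' *m B = 1%:M.
  have /row_fullP[B0 B0B] : row_full B by rewrite /row_full rankB.
  by rewrite -{1}[B']mul1mx -B0B -(mulmxA B0) BB' mulmx1.
have UB' : U *m B' = row_mx 1%:M 0.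
  have := BB'; rewrite mul_col_mx scalar_mx_block => /eq_col_mx[-> _].
  by [].
have UH : U *m H = l *: U by apply/eigenspaceP; rewrite eq_row_base.
pose r' b := B *m r b *m B'; pose H' := B *m H *m B'.
have r'E b : r' b = block_mx (ulsubmx (r' b)) 0 (dlsubmx (r' b)) (drsubmx (r' b)).
  have /submxP[Z ZE] : (U *m r b <= U)%MS.
    rewrite eq_row_base; apply/eigenspaceP.
    by rewrite -mulmxA -rH mulmxA UH -scalemxAl.
  have ur0 : ursubmx (r' b) = 0.
    rewrite /ursubmx /r' /B !mul_col_mx col_mxKu ZE -mulmxA UB' mul_mx_row mulmx0.
    by rewrite row_mxKr.
  by rewrite -[LHS]submxK ur0.
have H'E : H' = block_mx (l%:M) 0 (dlsubmx H') (drsubmx H').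
  rewrite -[LHS]submxK /ulsubmx /ursubmx {1 2}/H' /B !mul_col_mx col_mxKu UH.
  by rewrite -scalemxAl UB' scale_row_mx scaler0 row_mxKl row_mxKr scalemx1.
have r'1 : r' 1%g = 1%:M by rewrite /r' r1 mulmx1.
have r'M a b : r' (a * b)%g = r' a *m r' b.
  by rewrite /r' rM !mulmxA -(mulmxA (B *m r a) B' B) B'B mulmx1.
have r'H b : H' *m r' b = r' b *m H'.
  rewrite /r' /H' !mulmxA -(mulmxA (B *m H) B' B) -(mulmxA (B *m r b) B' B) B'B !mulmx1.
  by rewrite -!(mulmxA B) rH.
have rep1 : monoid_repr (fun b => ulsubmx (r' b)).
  split=> [|a b]; first by rewrite r'1 scalar_mx_block block_mxKul.
  by rewrite r'M {1}(r'E a) {1}(r'E b) mulmx_block block_mxKul mul0mx addr0.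
have rep2 : monoid_repr (fun b => drsubmx (r' b)).
  split=> [|a b]; first by rewrite r'1 scalar_mx_block block_mxKdr.
  by rewrite r'M {1}(r'E a) {1}(r'E b) mulmx_block block_mxKdr mulmx0 add0r.
have comm2 b : drsubmx H' *m drsubmx (r' b) = drsubmx (r' b) *m drsubmx H'.
  have := r'H b; rewrite {1 2}H'E {1}(r'E b) [in RHS](r'E b) !mulmx_block.
  by case/eq_block_mx=> _ _ _; rewrite !mulmx0 !add0r.
have lt_m : (\rank E^C < m)%N.
  by apply: leq_trans dm; rewrite -[X in (_ < X)%N]cE -[X in (X < _)%N]add0n ltn_add2r.
have -> : (fun b => \tr (r b *m H)) =
    (fun b => l * \tr (ulsubmx (r' b)) + \tr (drsubmx (r' b) *m drsubmx H')).
  apply/funext => b; transitivity (\tr (r' b *m H')).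
    rewrite /r' /H' !mulmxA -(mulmxA (B *m r b) B' B) B'B mulmx1 [RHS]mxtrace_mulC.
    by rewrite !mulmxA B'B mul1mx.
  rewrite {1}(r'E b) {1}H'E mulmx_block mxtrace_block mul0mx mulmx0 addr0 add0r.
  by rewrite mul_mx_scalar mxtraceZ.
apply: SD; first exact/SZ/Schar.
exact: IH.
Qed.

End CommutingTraces.

(* An alias of ['rV[K]_d], so that the action of the monoid algebra does not
   clash with scaling by [K]. *)
Definition repr_space (K : fieldType) (d : nat) : Type := 'rV[K]_d.
HB.instance Definition _ K d := GRing.Zmodule.on (repr_space K d).

Section RepresentationModule.
Variables (K : fieldType) (M : finMonoidType) (d : nat) (r : M -> 'M[K]_d).
Hypotheses (r1 : r 1%g = 1%:M) (rM : forall a b, r (a * b)%g = r a *m r b).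
Local Notation KM := (monoid_algebra K M).

Definition linear_extension (a : KM) : 'M[K]_d := \sum_m coeff a m *: r m.

Lemma linear_extension_dirac m : linear_extension (dirac K m) = r m.
Proof.
rewrite /linear_extension (bigD1 m) //= big1 ?addr0 => [|b /negbTE bm].
  by rewrite /coeff ffunE eqxx scale1r.
by rewrite /coeff ffunE bm scale0r.
Qed.

Lemma linear_extension_lin : linear linear_extension.
Proof.
move=> c x y; rewrite scaler_sumr -big_split; apply: eq_bigr => m _ /=.
by rewrite /coeff !ffunE scalerDl scalerA.
Qed.

Lemma linear_extensionM x y : linear_extension (x * y) = linear_extension x *m linear_extension y.
Proof.
have [f fE] := linear_fun linear_extension_lin.
have addE (I : Type) (s : seq I) (F : I -> KM) :
    linear_extension (\sum_(i <- s) F i) = \sum_(i <- s) linear_extension (F i).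
  by rewrite -fE linear_sum; apply: eq_bigr => i _; rewrite fE.
have scE c z : linear_extension (c *: z) = c *: linear_extension z.
  by rewrite -fE linearZ /= fE.
rewrite {1}(dirac_sum x) {1}(dirac_sum y) mulr_suml addE {2}/linear_extension mulmx_suml.
apply: eq_bigr => a _; rewrite mulr_sumr addE {2}/linear_extension mulmx_sumr.
apply: eq_bigr => b _; rewrite -scalerAl -scalerAr !scE -diracM linear_extension_dirac rM.
by rewrite -scalemxAl -scalemxAr.
Qed.

Lemma repr_module : exists V : lmodType KM, affords V linear_extension.
Proof.
pose sc (a : KM) (x : repr_space K d) : repr_space K d := (x : 'rV[K]_d) *m (linear_extension a)^T.
have [f fE] := linear_fun linear_extension_lin.
have scA a b x : sc a (sc b x) = sc (a * b) x.
  by rewrite /sc -mulmxA -trmx_mul -linear_extensionM.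
have sc1 : left_id 1 sc.
  by move=> x; rewrite /sc -(dirac1 K M) linear_extension_dirac r1 trmx1 mulmx1.
have scDr : right_distributive sc +%R by move=> a x y; rewrite /sc mulmxDl.
have scDl x : {morph sc^~ x : a b / a + b}.
  by move=> a b; rewrite /sc -!fE linearD /= linearD mulmxDr.
pose m := GRing.Zmodule_isLmodule.Build KM (repr_space K d) scA sc1 scDr scDl.
pose V : lmodType KM := HB.pack (repr_space K d) m.
exists V, (fun x : 'rV[K]_d => x : V); split=> //; split=> //.
  move=> c x y; congr (_ + _); rewrite -[RHS]/(x *m (linear_extension (c%:A))^T).
  by rewrite -fE linearZ /= fE -(dirac1 K M) linear_extension_dirac r1 linearZ /= trmx1 -scalemxAr mulmx1.
by move=> v; split=> // _; exists v.
Qed.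

End RepresentationModule.

(** * Characters as combinations of fixed-point counts *)

Section FixSpan.
Variables (K : fieldType) (M : finMonoidType).

(** The variable sits in the first argument of [fixcount], as in the characters of left modules;
    [opp_fixcount] exchanges the arguments. *)
Definition fix_span (f : M -> K) :=
  exists u : M -> K, forall b, f b = \sum_y u y * (fixcount b y)%:R.

Lemma fix_span_zero : fix_span (fun=> 0).
Proof. by exists (fun=> 0) => b; rewrite big1 // => y _; rewrite mul0r. Qed.

Lemma fix_spanD f g : fix_span f -> fix_span g -> fix_span (fun b => f b + g b).
Proof.
move=> [u uE] [v vE]; exists (fun y => u y + v y) => b.
by rewrite uE vE -big_split; apply: eq_bigr => y _; rewrite mulrDl.
Qed.

Lemma fix_spanZ c f : fix_span f -> fix_span (fun b => c * f b).
Proof.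
move=> [u uE]; exists (fun y => c * u y) => b.
by rewrite uE mulr_sumr; apply: eq_bigr => y _; rewrite mulrA.
Qed.

Lemma fix_span_ext f g : f =1 g -> fix_span f -> fix_span g.
Proof. by move=> fg [u uE]; exists u => b; rewrite -fg. Qed.

Lemma fix_span_sum (I : Type) (s : seq I) (P : pred I) (F : I -> M -> K) :
  (forall i, P i -> fix_span (F i)) -> fix_span (fun b => \sum_(i <- s | P i) F i b).
Proof.
move=> HF; elim: s => [|i s IH].
  by apply: fix_span_ext fix_span_zero => b; rewrite big_nil.
case Pi: (P i); last by apply: fix_span_ext IH => b; rewrite big_cons Pi.
by apply: fix_span_ext (fix_spanD (HF i Pi) IH) => b; rewrite big_cons Pi.
Qed.

End FixSpan.

Section CharactersInSpan.
Variables (K : numClosedFieldType) (M : finMonoidType) (n : nat).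
Local Notation KM := (monoid_algebra K M).
Variables (P : 'I_n -> lmodType KM).
Hypotheses (Preps : represents_pims P) (Cdet : \det (cartan_matrix P) != 0).

Definition dirac_trace d (r : KM -> 'M[K]_d) : {ffun M -> K} := [ffun b => \tr (r (dirac K b))].

Definition mod_char (V : lmodType KM) : {ffun M -> K} := invariant_of dirac_trace V.

Let isz (x : {ffun M -> K}) := x = 0.
Let isz0 : isz 0. Proof. by []. Qed.
Let iszD x y : isz x -> isz y -> isz (x + y). Proof. by move=> -> ->; rewrite /isz addr0. Qed.
Let iszN x : isz x -> isz (- x). Proof. by move=> ->; rewrite /isz oppr0. Qed.

Lemma dirac_trace_conj d d' (r : KM -> 'M[K]_d) (U : 'M_(d', d)) (U' : 'M_(d, d')) :
  U *m U' = 1%:M -> U' *m U = 1%:M -> isz (dirac_trace (fun a => U *m r a *m U') - dirac_trace r).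
Proof.
move=> _ U'U; apply/ffunP => b; rewrite !ffunE mxtrace_mulC mulmxA U'U mul1mx.
exact: subrr.
Qed.

Lemma dirac_trace_block d d' (r : KM -> 'M[K]_d) (r' : KM -> 'M[K]_d') (C : KM -> 'M[K]_(d, d')) :
  isz (dirac_trace (fun a => block_mx (r a) (C a) 0 (r' a)) - (dirac_trace r + dirac_trace r')).
Proof. by apply/ffunP => b; rewrite !ffunE mxtrace_block; exact: subrr. Qed.

Lemma mod_charE V d (r : KM -> 'M[K]_d) : affords V r -> mod_char V = dirac_trace r.
Proof.
move=> Vr; apply/eqP; rewrite -subr_eq0; apply/eqP.
exact: (invariant_ofE (J := isz) dirac_trace_conj Vr).
Qed.

Lemma mod_char_additive : additive_invariant isz mod_char.
Proof. exact: (invariant_of_additive iszD iszN dirac_trace_conj dirac_trace_block). Qed.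

Lemma mod_char_pim_span j : fix_span (mod_char (P j)).
Proof.
have [e [eprim eiso]] := pim_idempotents Preps; have [ee _ _] := eprim j.
have fd := principal_fin_dim ee.
have -> : mod_char (P j) = mod_char (principal (e j)).
  apply/eqP; rewrite -subr_eq0; apply/eqP.
  exact: (invariant_iso iszD iszN mod_char_additive fd (eiso j)).
have [d [r er]] := fin_dim_affords fd; rewrite (mod_charE er).
exists (coeff (e j)) => b.
by rewrite ffunE (tr_principal ee er).
Qed.

(** Nonsingularity enters here: the adjugate expresses the characters of the simple tops through
    those of the projectives up to the factor [\det C], which is invertible in characteristic 0. *)
Lemma mod_char_top_span i : fix_span (mod_char (mod_top (P i))).
Proof.
have [e [eprim eiso]] := pim_idempotents Preps.
pose C := cartan_matrix P; pose chi l := mod_char (mod_top (P l)).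
have CE j : mod_char (P j) = \sum_l chi l *~ C l j.
  apply/eqP; rewrite -subr_eq0; apply/eqP.
  exact: (invariant_cartan Preps eprim eiso isz0 iszD iszN mod_char_additive).
have mulE (f : {ffun M -> K}) (c : int) b : (f *~ c) b = c%:~R * f b.
  have nE m : (f *+ m) b = m%:R * f b by rewrite ffunMnE mulr_natl.
  case: c => m; first exact: nE.
  by rewrite NegzE !mulrNz ffunE mulNr; congr (- _); exact: nE.
have CbE j b : mod_char (P j) b = \sum_l (C l j)%:~R * chi l b.
  by rewrite CE sum_ffunE; apply: eq_bigr => l _; rewrite mulE.
have CadjE l : \sum_j (C l j)%:~R * (\adj C j i)%:~R = ((\det C)%:~R *+ (l == i) : K).
  have /matrixP/(_ l i) := mul_mx_adj C; rewrite !mxE => /(congr1 (intmul (1 : K))).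
  rewrite rmorph_sum /= rmorphMn /= => <-; apply: eq_bigr => j _.
  by rewrite rmorphM.
have dN : ((\det C)%:~R : K) != 0 by rewrite intr_eq0.
apply: (@fix_span_ext _ _ (fun b => ((\det C)%:~R)^-1 *
    \sum_j ((\adj C) j i)%:~R * mod_char (P j) b)).
  move=> b; under eq_bigr => j _.
    rewrite CbE mulr_sumr; under eq_bigr do rewrite mulrCA mulrA.
    over.
  rewrite exchange_big /=; under eq_bigr => l _.
    rewrite -mulr_suml CadjE; over.
  rewrite (bigD1 i) //= big1 ?addr0 => [|l /negbTE li]; last by rewrite li mulr0n mul0r.
  by rewrite eqxx mulr1n mulrA mulVf // mul1r.
apply/fix_spanZ/fix_span_sum => j _; exact/fix_spanZ/mod_char_pim_span.
Qed.

Lemma character_span d (r : M -> 'M[K]_d) : monoid_repr r -> fix_span (fun b => \tr (r b)).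
Proof.
move=> [r1 rM]; have [V Vr] := repr_module r1 rM.
have Vfd : fin_dim V by case: Vr => t [[tL _ tS] _]; exists d, t; split=> // v; apply/tS.
have [e [eprim eiso]] := pim_idempotents Preps.
have H := invariant_multiplicities Preps eprim eiso isz0 iszD iszN mod_char_additive Vfd.
apply: (@fix_span_ext _ _ (fun b => \sum_i (composition_multiplicity V (mod_top (P i)))%:R *
  mod_char (mod_top (P i)) b)).
  move=> b; have /ffunP/(_ b) : mod_char V = \sum_i mod_char (mod_top (P i)) *+
      composition_multiplicity V (mod_top (P i)).
    by apply/eqP; rewrite -subr_eq0; apply/eqP; exact: H.
  rewrite (mod_charE Vr) ffunE linear_extension_dirac // => ->.
  by rewrite sum_ffunE; apply: eq_bigr => i _; rewrite ffunMnE mulr_natl.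
by apply: fix_span_sum => i _; apply/fix_spanZ/mod_char_top_span.
Qed.

Lemma commuting_character_span d (r : M -> 'M[K]_d) (H : 'M[K]_d) : monoid_repr r ->
  (forall b, H *m r b = r b *m H) -> fix_span (fun b => \tr (r b *m H)).
Proof.
apply: commuting_trace_span; [exact: fix_span_zero|move=> f g; exact: fix_spanD
  |move=> c f; exact: fix_spanZ|exact: character_span].
Qed.

End CharactersInSpan.

(** * Green's relations and units at idempotents *)

Section GreenRelations.
Variables (M : finMonoidType) (e0 : nat).
Hypotheses (e0_gt0 : (0 < e0)%N) (e0_exp : forall b : M, (b ^+ (e0 + e0) = b ^+ e0)%g).
Local Open Scope group_scope.

(* Green's L-class of an idempotent [e], and the group of units of [e M e] with
   its inverse. *)
Definition Lclass (e : M) : pred M := fun x => (x * e == x) && [exists y : M, y * x == e].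

Definition unit_at (e : M) : pred M := fun g =>
  [&& e * g == g, g * e == g &
      [exists h : M, [&& e * h == h, h * e == h, g * h == e & h * g == e]]].

(** The default [g] is not reached when [g] is a unit at [e]. *)
Definition inv_at (e g : M) : M :=
  odflt g [pick h : M | [&& e * h == h, h * e == h, g * h == e & h * g == e]].

Definition principal_ideal (e : M) : {set M} :=
  [set z | [exists x : M, [exists y : M, z == x * e * y]]].

(** For a unit [g] at [e] this is the trace of left multiplication by [b] composed with right
    multiplication by [g] on the span of the L-class, where products leaving the class count as
    0. *)
Definition tau (e g b : M) : nat := #|[set x | Lclass e x & b * x * g == x]|.

Lemma LclassP e x : reflect (x * e = x /\ exists y, y * x = e) (Lclass e x).
Proof.
apply: (iffP andP) => [[/eqP xe /existsP[y /eqP yx]]|[xe [y yx]]].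
  by split=> //; exists y.
by split; [apply/eqP | apply/existsP; exists y; apply/eqP].
Qed.

Lemma principal_idealP e z : reflect (exists x y, z = x * e * y) (z \in principal_ideal e).
Proof.
rewrite inE; apply: (iffP existsP) => [[x /existsP[y /eqP zE]]|[x [y zE]]].
  by exists x, y.
by exists x; apply/existsP; exists y; apply/eqP.
Qed.

Lemma inv_atP e g : unit_at e g ->
  [/\ e * inv_at e g = inv_at e g, inv_at e g * e = inv_at e g,
      g * inv_at e g = e & inv_at e g * g = e].
Proof.
case/and3P=> _ _ /existsP[h hP]; rewrite /inv_at; case: pickP => [h' /and4P[]|/(_ h)].
  by do 4!move=> /eqP ?; split.
by rewrite hP.
Qed.

Lemma unit_atE e g : unit_at e g -> e * g = g /\ g * e = g.
Proof. by case/and3P=> /eqP-> /eqP->. Qed.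

Lemma unit_at_intro e g h : e * g = g -> g * e = g -> e * h = h -> h * e = h ->
  g * h = e -> h * g = e -> unit_at e g.
Proof.
move=> eg ge eh he gh hg; apply/and3P; split; try exact/eqP.
by apply/existsP; exists h; apply/and4P; split; apply/eqP.
Qed.

Lemma unit_at_inv e g : unit_at e g -> unit_at e (inv_at e g).
Proof.
move=> ug; have [eg ge] := unit_atE ug; have [ei ie gi ig] := inv_atP ug.
exact: (@unit_at_intro e _ g).
Qed.

Lemma inv_at_uniquel e g h : unit_at e g -> h * e = h -> h * g = e -> inv_at e g = h.
Proof.
move=> ug he hg; have [ei ie gi ig] := inv_atP ug.
by rewrite -[RHS]he -[X in _ = _ * X]gi mulgA hg ei.
Qed.

Lemma inv_at_uniquer e g h : unit_at e g -> e * h = h -> g * h = e -> inv_at e g = h.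
Proof.
move=> ug eh gh; have [ei ie gi ig] := inv_atP ug.
by rewrite -[RHS]eh -[X in _ = X * _]ig -mulgA gh ie.
Qed.

Lemma principal_ideal_refl e : e \in principal_ideal e.
Proof. by apply/principal_idealP; exists 1, 1; rewrite mul1g mulg1. Qed.

Lemma principal_ideal_sub e e' : e \in principal_ideal e' -> principal_ideal e \subset principal_ideal e'.
Proof.
case/principal_idealP=> x [y ->]; apply/fintype.subsetP => _ /principal_idealP[x' [y' ->]].
by apply/principal_idealP; exists (x' * x), (y * y'); rewrite !mulgA.
Qed.

(** Stability of finite monoids: [x] lies in [e' M] and generates the same two-sided ideal as [e'],
    so it already generates the right ideal [e' M]. *)
Lemma Lclass_target e e' x : e * e = e -> e' * e' = e' -> Lclass e x -> e' * x = x ->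
    e' \in principal_ideal e ->
  exists y, [/\ y * x = e, x * y = e', e * y = y & y * e' = y].
Proof.
move=> ee ee' /LclassP[xe [y0 y0x]] e'x /principal_idealP[P0 [q e'E]].
pose P := P0 * y0; pose z := x * q.
have Pz : P * z = e' by rewrite /P /z e'E -y0x !mulgA.
have e'z : e' * z = z by rewrite /z mulgA e'x.
have Pzn n : P ^+ n.+1 * z ^+ n.+1 = e'.
  elim: n => [|n IH]; first by rewrite !expg1.
  by rewrite expgS [z ^+ n.+2]expgSr mulgA -(mulgA P) IH -mulgA e'z.
have e'zn n : e' * z ^+ n.+1 = z ^+ n.+1 by rewrite expgS mulgA e'z.
(* [z ^+ e0] is an idempotent that [e'] fixes from the left and that has a left inverse relative to
   [e']; such an idempotent is [e']. *)
have zn : z ^+ e0 = e'.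
  rewrite -(prednK e0_gt0) -e'zn -{1}(Pzn e0.-1) -mulgA.
  by rewrite (prednK e0_gt0) -expgnDr e0_exp -(prednK e0_gt0) Pzn.
pose q' := q * z ^+ e0.-1.
have xq' : x * q' = e' by rewrite /q' mulgA -expgS (prednK e0_gt0) zn.
pose y := e * q' * e'.
have xy : x * y = e' by rewrite /y mulgA (mulgA x) xe xq' ee'.
have ey : e * y = y by rewrite /y mulgA (mulgA e) ee.
have ye' : y * e' = y by rewrite /y -mulgA ee'.
exists y; split=> //.
by rewrite -ey -{1}y0x -(mulgA y0) xy -mulgA e'x y0x.
Qed.

Section ClassFunction.
Variables (R : comNzRingType) (f : M -> R).
Hypothesis fC : forall a b, f (a * b) = f (b * a).

(* If [x] is in the L-class of [e] and fixed by [e'], then [b x = x h] for a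
   unique unit [h] at [e], conjugate to [b]; only [g = h^-1] contributes. *)
Lemma tau_sum e e' b : e * e = e -> e' * e' = e' -> unit_at e' b -> e' \in principal_ideal e ->
  (\sum_(g | unit_at e g) f (inv_at e g) * (tau e g b)%:R =
    f b *+ #|[set x | Lclass e x & (e' * x == x)%g]|)%R.
Proof.
move=> ee ee' ub e'e; have [e'b be'] := unit_atE ub.
under eq_bigr => g _ do rewrite /tau -sum1dep_card natr_sum mulr_sumr.
rewrite (exchange_big_dep (Lclass e)) /=; last by move=> g x _ /andP[].
rewrite -[RHS]mulr_natr -sum1dep_card natr_sum mulr_sumr.
rewrite [RHS]big_mkcondr; apply: eq_bigr => x Lx; rewrite Lx /=.
case: eqP => [e'x|e'x]; last first.
  rewrite big_pred0 // => g; apply/negbTE; rewrite negb_and orbC; apply/orP; left.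
  by apply/eqP => bxg; case: e'x; rewrite -bxg !mulgA e'b.
have [y [yx xy ey ye']] := Lclass_target ee ee' Lx e'x e'e.
have [xe _] := LclassP _ _ Lx.
have [ei ie bi ib] := inv_atP ub.
pose h := y * b * x; have uh : unit_at e h.
  apply: (@unit_at_intro e h (y * inv_at e' b * x)); rewrite /h.
  - by rewrite !mulgA ey.
  - by rewrite -!mulgA xe.
  - by rewrite !mulgA ey.
  - by rewrite -!mulgA xe.
  - by rewrite -!mulgA (mulgA x y) xy (mulgA e') ei (mulgA b) bi e'x yx.
  - by rewrite -!mulgA (mulgA x y) xy (mulgA e') e'b (mulgA (inv_at _ _)) ib e'x yx.
have bxE : b * x = x * h by rewrite /h !mulgA xy e'b.
have [eh he] := unit_atE uh; have uih := unit_at_inv uh; have [ei' ie' hi ih] := inv_atP uh.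
rewrite (big_pred1 (inv_at e h)).
  by rewrite !mulr1 (inv_at_uniquel uih he hi) /h -mulgA fC -mulgA xy be'.
move=> g /=; apply/andP/eqP => [[ug /eqP bxg]|->].
  have [eg ge] := unit_atE ug.
  rewrite -(inv_at_uniquer uh eg) //.
  by rewrite -yx -{1}bxg /h !mulgA.
by split=> //; rewrite bxE -mulgA hi xe.
Qed.

(** A point [x] counted by [tau] satisfies [e' * x = x], and [e] is a left multiple of [x]. *)
Lemma tau_eq0 e e' g b : e' * e' = e' -> unit_at e' b -> e \notin principal_ideal e' -> tau e g b = 0%N.
Proof.
move=> ee' ub; apply: contraNeq; rewrite -lt0n card_gt0 => /set0Pn[x].
rewrite inE => /andP[/LclassP[xe [y yx]] /eqP bxg]; have [e'b _] := unit_atE ub.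
apply/principal_idealP; exists y, x; rewrite -mulgA.
by rewrite -{1}bxg !mulgA -[y * e' * b]mulgA e'b -!mulgA [b * _]mulgA bxg yx.
Qed.

End ClassFunction.

(** A point counted for [b] or for [b ^+ e0.+1] is fixed from the left by the idempotent [b ^+ e0],
    so both elements act on it alike. *)
Lemma tau_comm_power e g b : tau e g (b ^+ e0.+1) = tau e g b.
Proof.
apply: eq_card => x; rewrite !inE; case: (Lclass e x) => //=.
have iter_fix c : c * x * g = x -> forall n, c ^+ n * x * g ^+ n = x.
  move=> cx; elim=> [|n IH]; first by rewrite !expg0 mul1g mulg1.
  rewrite expgSr [g ^+ n.+1]expgS -!mulgA [x * (g * _)]mulgA [c * (_ * _)]mulgA.
  by rewrite [c * (x * g)]mulgA cx mulgA IH.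
have b_fix c : c ^+ e0 * x * g ^+ e0 = x -> c ^+ e0 * x = x.
  by move=> cx; rewrite -{1}cx !mulgA -expgnDr e0_exp cx.
apply/eqP/eqP => [bx|bx].
  have bb : (b ^+ e0.+1) ^+ e0 = b ^+ e0.
    rewrite -expgnA mulSn expg_eventually_periodic //.
  have := iter_fix _ bx e0; rewrite bb => /b_fix bx'.
  by rewrite -{2}bx expgS -[b * _ * x]mulgA bx'.
have bx' := b_fix _ (iter_fix _ bx e0).
by rewrite expgS -[b * _ * x]mulgA bx'.
Qed.

End GreenRelations.

(** * Representations on L-classes *)

Section TauRepresentation.
Variables (K : closedFieldType) (M : finMonoidType) (e g : M).
Hypotheses (ee : (e * e = e)%g) (ug : unit_at e g).
Local Notation T := {x : M | Lclass e x}.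
Local Notation n := #|{: T}|.
Let elt (i : 'I_n) : M := val (enum_val i).

(** The left Schuetzenberger representation: a product that leaves the L-class becomes 0. *)
Definition Lclass_repr (b : M) : 'M[K]_n := \matrix_(i, j) (b * elt j == elt i)%g%:R.
Definition Lclass_right : 'M[K]_n := \matrix_(i, j) (elt j * g == elt i)%g%:R.

Lemma Lclass_index x : Lclass e x -> {i : 'I_n | elt i = x /\ forall j, (x == elt j) = (j == i)}.
Proof.
move=> Lx; exists (enum_rank (Sub x Lx : T)); rewrite /elt enum_rankK; split=> // j.
apply/eqP/eqP => [xE|->]; last by rewrite enum_rankK.
by apply: enum_val_inj; rewrite enum_rankK; apply: val_inj.
Qed.

Lemma elt_Lclass i : Lclass e (elt i). Proof. exact: valP. Qed.

Lemma Lclass_mulr x : Lclass e x -> Lclass e (x * g)%g.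
Proof.
case/LclassP=> xe [y yx]; have [ei ie gi ig] := inv_atP ug; have [eg ge] := unit_atE ug.
apply/LclassP; split; first by rewrite -mulgA ge.
by exists (inv_at e g * y)%g; rewrite -mulgA (mulgA y) yx eg ig.
Qed.

Lemma Lclass_cancel a x : Lclass e x -> Lclass e (a * x * g)%g -> Lclass e (a * x)%g.
Proof.
case/LclassP=> xe _ /LclassP[_ [y yx]].
have [ei ie gi ig] := inv_atP ug; have [eg ge] := unit_atE ug.
apply/LclassP; split; first by rewrite -mulgA xe.
have E : (y * (a * x) = inv_at e g)%g.
  transitivity (y * (a * x * g) * inv_at e g)%g; last by rewrite yx ei.
  by rewrite -!mulgA gi xe.
by exists (g * y)%g; rewrite -mulgA E gi.
Qed.

Lemma sum_Lclass (F : 'I_n -> K) x : Lclass e x ->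
  exists2 i, elt i = x & \sum_l F l * (x == elt l)%:R = F i.
Proof.
move=> /Lclass_index[i [iE eqE]]; exists i => //.
rewrite (bigD1 i) //= eqE eqxx mulr1 big1 ?addr0 // => l /negbTE li.
by rewrite eqE li mulr0.
Qed.

Lemma sum_notLclass (F : 'I_n -> K) x : ~~ Lclass e x -> \sum_l F l * (x == elt l)%:R = 0.
Proof.
move=> xN; rewrite big1 // => l _; case: eqP => [xE|_]; last by rewrite mulr0.
by rewrite xE elt_Lclass in xN.
Qed.

(** A product that has left the L-class does not return under further left multiplication, so
    replacing it by 0 is compatible with products. *)
Lemma Lclass_repr_monoid : monoid_repr Lclass_repr.
Proof.
split=> [|a b]; apply/matrixP => i j; rewrite !mxE.
  rewrite mul1g; congr (_%:R); congr nat_of_bool; rewrite eq_sym.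
  by apply/eqP/eqP => [/val_inj/enum_val_inj|->].
under eq_bigr do rewrite !mxE.
have [Lb|Lb] := boolP (Lclass e (b * elt j)%g).
  have [l lE ->] := sum_Lclass (fun l => (a * elt l == elt i)%g%:R) Lb.
  by rewrite lE mulgA.
rewrite (sum_notLclass (fun l => (a * elt l == elt i)%g%:R)) //; case: eqP => // abj.
case/negP: Lb; have [_ [y yi]] := LclassP _ _ (elt_Lclass i).
have [je _] := LclassP _ _ (elt_Lclass j).
apply/LclassP; split; first by rewrite -mulgA je.
by exists (y * a)%g; rewrite -yi -abj !mulgA.
Qed.

Lemma Lclass_repr_comm b : Lclass_right *m Lclass_repr b = Lclass_repr b *m Lclass_right.
Proof.
apply/matrixP => i j; rewrite !mxE.
under eq_bigr do rewrite !mxE; under [RHS]eq_bigr do rewrite !mxE.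
have [m mE ->] := sum_Lclass (fun l => (b * elt l == elt i)%g%:R) (Lclass_mulr (elt_Lclass j)).
rewrite mE mulgA; have [Lb|Lb] := boolP (Lclass e (b * elt j)%g).
  by have [l lE ->] := sum_Lclass (fun l => (elt l * g == elt i)%g%:R) Lb; rewrite lE.
rewrite (sum_notLclass (fun l => (elt l * g == elt i)%g%:R)) //; case: eqP => // bjg.
by case/negP: Lb; apply: Lclass_cancel (elt_Lclass j) _; rewrite bjg elt_Lclass.
Qed.

Lemma tr_Lclass b : \tr (Lclass_repr b *m Lclass_right) = (tau e g b)%:R.
Proof.
rewrite /mxtrace /tau -sum1dep_card natr_sum.
transitivity (\sum_(i < n) (b * elt i * g == elt i)%g%:R : K).
  apply: eq_bigr => i _; rewrite mxE; under eq_bigr do rewrite !mxE.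
  have [m mE ->] := sum_Lclass (fun l => (b * elt l == elt i)%g%:R) (Lclass_mulr (elt_Lclass i)).
  by rewrite mE mulgA.
rewrite (reindex_omap (fun i : 'I_n => elt i) (fun x => omap enum_rank (insub x : option T))) /=; last first.
  by move=> x /andP[Lx _]; rewrite insubT /= /elt enum_rankK.
rewrite [RHS]big_mkcond [LHS]big_mkcond; apply: eq_bigr => i _.
by rewrite valK /= enum_valK eqxx andbT (elt_Lclass i) /=; case: eqP.
Qed.

End TauRepresentation.

(** * All class functions as combinations of fixed-point counts *)

Section ClassFunctionSpan.
Variables (K : numClosedFieldType) (M : finMonoidType) (e0 : nat).
Hypotheses (e0_gt0 : (0 < e0)%N) (e0_exp : forall b : M, (b ^+ (e0 + e0) = b ^+ e0)%g).
Hypothesis Hspan : forall d (r : M -> 'M[K]_d) (H : 'M[K]_d), monoid_repr r ->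
  (forall b, H *m r b = r b *m H) -> fix_span (fun b => \tr (r b *m H)).

Definition class_function (f : M -> K) :=
  (forall a b, f (a * b)%g = f (b * a)%g) /\ forall b, f (b ^+ e0.+1)%g = f b.

Lemma tau_span (e g : M) : (e * e = e)%g -> unit_at e g -> fix_span (fun b => (tau e g b)%:R : K).
Proof.
move=> ee ug; apply: fix_span_ext (fun b => tr_Lclass K ug b) _.
by apply: Hspan; [exact: Lclass_repr_monoid | exact: Lclass_repr_comm].
Qed.

Lemma tau_class (e g : M) : (e * e = e)%g -> unit_at e g -> class_function (fun b => (tau e g b)%:R).
Proof.
move=> ee ug; split=> [a b|b]; last by rewrite (tau_comm_power e0_exp).
have [_ rM] := @Lclass_repr_monoid K M e.
have comm := Lclass_repr_comm K ug; rewrite -!(tr_Lclass K ug) !rM.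
move: (Lclass_repr _ _ a) (comm a) (Lclass_repr _ _ b) => ra commA rb.
transitivity (\tr (rb *m Lclass_right K e g *m ra)).
  by rewrite [RHS]mxtrace_mulC mulmxA.
by rewrite -mulmxA commA mulmxA.
Qed.

(* Idempotents are removed from [S] one at a time, smallest principal ideal
   first: subtracting a combination of the functions [tau e g] makes [f] vanish
   on the units at idempotents generating the same ideal as [e]. *)
Lemma class_function_span f : class_function f -> fix_span f.
Proof.
pose D := [set e : M | (e * e == e)%g].
suff main m (S : {set M}) : #|S| = m -> S \subset D ->
    (forall e e', e \in S -> e' \in D -> e' \notin S ->
      (#|principal_ideal e'| <= #|principal_ideal e|)%N) ->
    forall f, class_function f ->
      (forall e' b, e' \in D -> e' \notin S -> unit_at e' b -> f b = 0) -> fix_span f.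
  move=> Hf; apply: (main _ D erefl) => // [e e' _ eD|e' b eD]; by rewrite eD.
elim: m S => [|m IH] S cS SD Smin {}f [fC fP] fS.
  have S0 : S = finset.set0 by apply/eqP; rewrite -cards_eq0 cS.
  (* No idempotent is left, and [b ^+ e0.+1], where [f] takes the same value as at [b], is a unit at
     the idempotent [b ^+ e0]. *)
  apply: fix_span_ext (@fix_span_zero K M) => b; rewrite -fP; apply/esym.
  have ee : (b ^+ e0 * b ^+ e0 = b ^+ e0)%g by rewrite -expgnDr.
  have expE m : (e0 <= m)%N -> (b ^+ e0 * b ^+ m = b ^+ m)%g.
    by move=> em; rewrite -expgnDr addnC -{1}[e0]muln1 expg_eventually_periodic.
  have expE' m : (e0 <= m)%N -> (b ^+ m * b ^+ e0 = b ^+ m)%g.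
    by move=> em; rewrite -expgnDr -{1}[e0]muln1 expg_eventually_periodic.
  (* The inverse of [b ^+ e0.+1] is sought among the powers of [b]: the two exponents must add up to
     a multiple of [e0], and each has to be at least [e0]. *)
  have inv1 : (e0.+1 + (e0 * e0 + e0.-1) = e0 + e0 * e0.+1)%N by nia.
  apply: (fS (b ^+ e0)%g); rewrite ?inE ?ee ?S0 ?inE //.
  have ge : (e0 <= e0 * e0 + e0.-1)%N by nia.
  apply: (@unit_at_intro _ _ _ (b ^+ (e0 * e0 + e0.-1))%g); rewrite ?expE ?expE' //.
    by rewrite -expgnDr inv1 expg_eventually_periodic.
  by rewrite -expgnDr addnC inv1 expg_eventually_periodic.
have [x0 x0S] : exists x0, x0 \in S by apply/finset.set0Pn; rewrite -cards_eq0 cS.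
have [e eS0 emin] := arg_minnP (fun e => #|principal_ideal e|) x0S.
have eS : e \in S := eS0.
have ee : (e * e = e)%g by have := fintype.subsetP SD e eS; rewrite inE => /eqP.
(* On the units at [e] the combination [F] below is [c] times [f]; [c] is nonzero because [e] itself
   is counted. *)
pose c : K := #|[set x | Lclass e x & (e * x == x)%g]|%:R.
have c0 : c != 0.
  rewrite Num.Theory.pnatr_eq0 -lt0n card_gt0; apply/finset.set0Pn; exists e.
  rewrite inE ee eqxx andbT; apply/LclassP; split=> //; exists 1%g; exact: mul1g.
pose F b : K := \sum_(g | unit_at e g) f (inv_at e g) * (tau e g b)%:R.
have Fspan : fix_span F.
  by apply: fix_span_sum => g ug; apply/fix_spanZ/tau_span.
have Fclass : class_function F.
  split=> [a b|b]; apply: eq_bigr => g ug; congr (_ * _); have [tC tP] := tau_class ee ug.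
    exact: tC.
  exact: tP.
have F0 e' b : (e' * e' = e')%g -> unit_at e' b -> e \notin principal_ideal e' -> F b = 0.
  move=> ee' ub eN; rewrite /F big1 // => g _.
  by rewrite (tau_eq0 g ee' ub eN) mulr0.
pose f1 b := f b + (- c^-1) * F b.
have f1class : class_function f1.
  have [FC FP] := Fclass; split=> [a b|b]; first by rewrite /f1 fC FC.
  by rewrite /f1 fP FP.
suff f1span : fix_span f1.
  have := fix_spanD f1span (fix_spanZ (c^-1) Fspan).
  by apply: fix_span_ext => b; rewrite /f1 mulNr subrK.
have cS' : #|S :\ e| = m by move: cS; rewrite (cardsD1 e) eS add1n => -[].
apply: (IH (S :\ e) cS') => //.
- exact: fintype.subset_trans (finset.subD1set S e) SD.
- move=> e1 e'; rewrite !inE negb_and negbK => /andP[e1e e1S] e'D /orP[/eqP->|e'S].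
    exact: emin.
  by apply: Smin => //; rewrite inE.
move=> e' b; rewrite inE => /eqP ee'; rewrite !inE negb_and negbK => e'S ub.
have le_ee' : (#|principal_ideal e'| <= #|principal_ideal e|)%N.
  case/orP: e'S => [/eqP->//|e'S]; apply: Smin => //.
  by rewrite inE ee'.
have [ein|eN] := boolP (e \in principal_ideal e'); last first.
  rewrite /f1 (F0 e') // mulr0 addr0; apply: (fS e') => //; first by rewrite inE ee'.
  case/orP: e'S => [/eqP e'e|//]; case/negP: eN; rewrite e'e; exact: principal_ideal_refl.
have /eqP idE : principal_ideal e == principal_ideal e'.
  by rewrite eqEcard principal_ideal_sub.
have FE : F b = f b *+ #|[set x | Lclass e x & (e' * x == x)%g]|.
  apply: (tau_sum e0_gt0 e0_exp fC) => //; rewrite idE; exact: principal_ideal_refl.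
rewrite /f1 FE; case/orP: e'S => [/eqP e'e|e'S].
  by rewrite e'e -mulr_natr -/c mulNr mulrCA mulVf // mulr1 subrr.
by rewrite (fS e') ?inE ?ee' // mul0rn mulr0 addr0.
Qed.

End ClassFunctionSpan.

(** Solvability of a linear system with integer coefficients descends from [K] to the rationals,
    where [D] clears all denominators of a solution. *)
Lemma integer_combination (K : Num.NumField.type) q m n (A : 'M[int]_(m, n)) (V : 'M[int]_(q, n)) :
    (map_mx intr V <= (map_mx intr A : 'M[K]_(m, n)))%MS ->
  exists (D : int) (W : 'M[int]_(q, m)), D != 0 /\ D *: V = W *m A.
Proof.
have ratE a b (B : 'M[int]_(a, b)) : map_mx intr B = map_mx (ratr : rat -> K) (map_mx intr B).
  by apply/matrixP => i j; rewrite !mxE ratr_int.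
rewrite (ratE _ _ V) (ratE _ _ A) map_submx => /submxP[U UE].
pose D : int := \prod_(u : 'I_q * 'I_m) denq (U u.1 u.2).
pose W : 'M[int]_(q, m) :=
  \matrix_(i, j) (numq (U i j) * \prod_(u | u != (i, j)) denq (U u.1 u.2)).
have WE : map_mx intr W = (D%:~R : rat) *: U.
  apply/matrixP => i j; rewrite /W !mxE /D [in RHS](bigD1 (i, j)) //= !intrM numqE.
  by move: (\prod_(_ <- _ | _) _)%:~R => x; rewrite mulrAC mulrC [X in _ * X]mulrC mulrA.
exists D, W; split; first by apply/prodf_neq0 => u _; exact: denq_neq0.
apply/matrixP => i j; apply: (@intr_inj rat).
have /matrixP/(_ i j) : map_mx (intr : int -> rat) (D *: V) = map_mx intr (W *m A).
  by rewrite map_mxM map_mxZ /= WE -scalemxAl -UE.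
by rewrite !mxE.
Qed.

Section IntegralClassFunctions.
Variables (K : numClosedFieldType) (M : finMonoidType) (n : nat).
Variables (P : 'I_n -> lmodType (monoid_algebra K M)).
Hypotheses (Preps : represents_pims P) (Cdet : \det (cartan_matrix P) != 0).
Variable e0 : nat.
Hypotheses (e0_gt0 : (0 < e0)%N) (e0_exp : forall b : M, (b ^+ (e0 + e0) = b ^+ e0)%g).

(** The functions form a family indexed by [c] so that one denominator [D] serves all of them. *)
Lemma integral_class_function_span (f : M -> M -> int) :
    (forall c a b, f c (a * b)%g = f c (b * a)%g) -> (forall c b, f c (b ^+ e0.+1)%g = f c b) ->
  exists (D : int) (w : M -> M -> int), D != 0 /\
    forall c b, D * f c b = \sum_y w c y * (fixcount b y)%:R.
Proof.
move=> fC fP; have Hspan := commuting_character_span Preps Cdet.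
have /choice[u uE] c : fix_span (fun b => (f c b)%:~R : K).
  apply: (class_function_span e0_gt0 e0_exp Hspan); split=> [a b|b].
    exact: (congr1 (intmul 1) (fC c a b)).
  exact: (congr1 (intmul 1) (fP c b)).
pose A : 'M[int]_#|M| := \matrix_(i, j) (fixcount (enum_val j) (enum_val i) : int).
pose V : 'M[int]_#|M| := \matrix_(i, j) f (enum_val i) (enum_val j).
have [|D [W [D0 DE]]] := @integer_combination K _ _ _ A V.
  apply/submxP; exists (\matrix_(i, j) u (enum_val i) (enum_val j)).
  apply/matrixP => i j; rewrite !mxE uE (reindex (@enum_val M M)) /=; last exact/onW_bij/enum_val_bij.
  by apply: eq_bigr => l _; rewrite !mxE.
exists D, (fun c y => W (enum_rank c) (enum_rank y)); split=> // c b.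
have /matrixP/(_ (enum_rank c) (enum_rank b)) := DE.
rewrite !mxE !enum_rankK => ->.
rewrite [RHS](reindex (@enum_val M M)) /=; last exact/onW_bij/enum_val_bij.
by apply: eq_bigr => l _; rewrite !mxE !enum_rankK enum_valK natz.
Qed.

End IntegralClassFunctions.

(** * The opposite monoid and the exchange of left and right *)

Definition opposite_monoid (M : Type) : Type := M.

Section OppositeMonoid.
Variable M : finMonoidType.
Local Notation M' := (opposite_monoid M).

HB.instance Definition _ := Finite.on M'.

Definition opp_mul (x y : M') : M' := ((y : M) * (x : M))%g.

Lemma opp_mulA : associative opp_mul. Proof. by move=> x y z; rewrite /opp_mul mulgA. Qed.
Lemma opp_mul1 : left_id (1%g : M) opp_mul. Proof. by move=> x; rewrite /opp_mul mulg1. Qed.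
Lemma opp_mulr1 : right_id (1%g : M) opp_mul. Proof. by move=> x; rewrite /opp_mul mul1g. Qed.

HB.instance Definition _ := isMonoid.Build M' opp_mulA opp_mul1 opp_mulr1.

Lemma opp_expg (x : M) n : ((x : M') ^+ n)%g = (x ^+ n)%g.
Proof.
elim: n => [|n IH]; first by [].
by rewrite expgS expgSr IH.
Qed.

Lemma opp_fixcount (a b : M) : fixcount (a : M') (b : M') = fixcount b a.
Proof. by apply: eq_card => x; rewrite !inE; congr (_ == x); exact: (mulgA b x a). Qed.

Lemma opp_lstab p (a : M) : p'_monoid p (rstab a) -> p'_monoid p (lstab (a : M')).
Proof.
move=> Ha m; rewrite inE => /eqP ma i j [j0 mij ijmin].
apply: (Ha (m : M)) (i) _ _; first by rewrite inE; apply/eqP.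
split=> //; first by rewrite -!opp_expg.
by move=> i' j' j'0 E; apply: ijmin => //; rewrite !opp_expg.
Qed.

Section OppositeAlgebra.
Variable k : fieldType.

Definition opp_malg (f : monoid_algebra k M) : monoid_algebra k M' := [ffun m : M' => f m].
Definition opp_malg' (f : monoid_algebra k M') : monoid_algebra k M := [ffun m : M => f m].

Lemma opp_malg_lin : linear opp_malg.
Proof. by move=> c f g; apply/ffunP => m; rewrite !ffunE. Qed.

Lemma opp_malgM f g : opp_malg (f * g) = opp_malg g * opp_malg f.
Proof.
apply/ffunP => m; rewrite ffunE !malg_mulE exchange_big; apply: eq_bigr => y _.
by apply: eq_bigr => x _; rewrite !ffunE [f x * g y]mulrC.
Qed.

Lemma opp_malgK : cancel opp_malg opp_malg'.
Proof. by move=> f; apply/ffunP => m; rewrite !ffunE. Qed.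

Lemma opp_malgK' : cancel opp_malg' opp_malg.
Proof. by move=> f; apply/ffunP => m; rewrite !ffunE. Qed.

Lemma opposite_pims n (P : 'I_n -> lmodType (monoid_algebra k M)) : represents_pims P ->
  exists2 P' : 'I_n -> lmodType (monoid_algebra k M'), represents_pims P' &
    (\det (cartan_matrix P') == 0) = (\det (cartan_matrix P) == 0).
Proof.
move=> Preps.
have H := @opposite_representatives k (monoid_algebra k M) (monoid_algebra k M') opp_malg opp_malg'.
by apply: (H opp_malg_lin opp_malgM opp_malgK opp_malgK').
Qed.

End OppositeAlgebra.
End OppositeMonoid.

(** * Stabilizers and the Cartan matrix in positive characteristic *)

Section Stabilizers.
Variable M : finMonoidType.
Local Open Scope group_scope.
Implicit Types a b x m : M.

(** The definition wants one pair minimal in both entries, while minima are found separately. The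
    minimal period [k] holds from some exponent [j] on; a period [l] at the minimal index [i] moves
    [i] beyond [j] and back, so [k] is a period at [i] as well. *)
Lemma index_period_exists m e : (0 < e)%N -> m ^+ (e + e) = m ^+ e ->
  exists i k, index_period m i k.
Proof.
move=> e_gt0 me.
pose Pk k := `[< (0 < k)%N /\ exists i, m ^+ i = m ^+ (i + k) >].
pose Pi i := `[< exists k, (0 < k)%N /\ m ^+ i = m ^+ (i + k) >].
have exk : exists k, Pk k by exists e; apply/asboolP; split=> //; exists e.
have exi : exists i, Pi i by exists e; apply/asboolP; exists e.
case: (ex_minnP exk) => k /asboolP[k0 [j mj]] kmin.
case: (ex_minnP exi) => i /asboolP[l [l0 mi]] imin.
exists i, k; split=> // [|i' k' k'0 mi'].
  have ij : (j <= i + l * j)%N by rewrite (leq_trans _ (leq_addl _ _)) // leq_pmull.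
  have := expg_period 1 mj ij; rewrite muln1 addnAC.
  by rewrite (expg_period j mi (leqnn i)) (expg_period j mi (leq_addr k i)).
split; first by apply: imin; apply/asboolP; exists k'.
by apply: kmin; apply/asboolP; split=> //; exists i'.
Qed.

Lemma fix_power a x b n : a * x * b = x -> a ^+ n * x * b ^+ n = x.
Proof.
move=> axb; elim: n => [|n IH]; first by rewrite mul1g mulg1.
by rewrite expgSr [b ^+ n.+1]expgS !mulgA -(mulgA _ a x) -(mulgA _ (a * x) b) axb.
Qed.

Lemma fix_power_idem e a x b : a ^+ (e + e) = a ^+ e -> a * x * b = x -> a ^+ e * x = x.
Proof. by move=> ae /(fix_power e) axb; rewrite -{1}axb !mulgA -expgnDr ae. Qed.

Lemma fix_expM a x n q : a ^+ n * x = x -> a ^+ (n * q) * x = x.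
Proof.
move=> ax; elim: q => [|q IH]; first by rewrite muln0 mul1g.
by rewrite mulnS expgnDr -mulgA IH.
Qed.

(** As [a] need not be invertible, the Bezout relation is used in the form
    [u * n = v * n' + gcdn n n'], without subtraction. *)
Lemma fix_gcdn a x n n' : a ^+ n * x = x -> a ^+ n' * x = x -> a ^+ gcdn n n' * x = x.
Proof.
move=> an an'; have [->|n_gt0] := posnP n; first by rewrite gcd0n.
have [u v E _] := egcdnP n' n_gt0.
have := fix_expM u an; rewrite mulnC E expgnDr => H.
have := fix_expM v an'; rewrite mulnC => H'.
have : a ^+ gcdn n n' * (a ^+ (v * n') * x) = x.
  by rewrite mulgA -expgnDr addnC expgnDr.
by rewrite H'.
Qed.

Section PowerOfPrime.
Variables (p e N : nat).
Hypotheses (p_prime : prime p) (e_gt0 : (0 < e)%N) (N_gt0 : (0 < N)%N).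
Hypothesis e_exp : forall b : M, b ^+ (e + e) = b ^+ e.
Hypothesis pN1 : (e`_p^' %| p ^ N - 1)%N.

Lemma exponent_dvdn : (e %| (p ^ N - 1) * p ^ logn p e)%N.
Proof. by rewrite -{1}(partnC p e_gt0) mulnC p_part; apply: dvdn_mul. Qed.

Lemma expg_pN b : b ^+ (p ^ (N + e)) = b ^+ (p ^ e).
Proof.
have e_le : (e <= p ^ e)%N by rewrite ltnW // ltn_expl // prime_gt1.
have /dvdnP[q qE] : (e %| p ^ e * (p ^ N - 1))%N.
  apply: dvdn_trans exponent_dvdn _; rewrite mulnC dvdn_mul // dvdn_exp2l //.
  by rewrite ltnW // (leq_trans (ltn_logl _ e_gt0)).
have -> : (p ^ (N + e) = p ^ e + e * q)%N.
  rewrite mulnC -qE expnD mulnBr muln1 mulnC subnKC // leq_pmulr // expn_gt0 prime_gt0 //.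
exact: expg_eventually_periodic.
Qed.

(* A period of [a] prime to [p] is, up to its factors outside the exponent
   [e], a divisor of the [p']-part of [e], hence of [p ^ N - 1]. *)
Lemma regular_fix a i k x : ~~ (p %| k)%N -> a ^+ i = a ^+ (i + k) -> a ^+ e * x = x ->
  a ^+ (p ^ N - 1) * x = x.
Proof.
move=> pk aik ax.
have akx : a ^+ k * x = x.
  have ie : (i <= e * i)%N by rewrite leq_pmull.
  have := expg_period 1 aik ie; rewrite muln1 addnC => akE.
  by rewrite -{1}(fix_expM i ax) mulgA -expgnDr akE; exact: fix_expM.
have gP : (gcdn e k %| p ^ N - 1)%N.
  apply: dvdn_trans pN1; rewrite -(@Gauss_dvdr _ (e`_p)).
    by rewrite partnC // dvdn_gcdl.
  rewrite p_part coprimeXr // coprime_sym prime_coprime //.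
  by apply: contra pk => /dvdn_trans; apply; exact: dvdn_gcdr.
by case/dvdnP: gP => q ->; rewrite mulnC; apply/fix_expM/fix_gcdn.
Qed.

(** Either fixed-point equation forces [a ^+ e * x = x], and on such [x] the elements [a] and
    [a ^+ (p ^ N)] act alike. *)
Lemma regular_fixcount a i k b : ~~ (p %| k)%N -> a ^+ i = a ^+ (i + k) ->
  fixcount (a ^+ (p ^ N)) b = fixcount a b.
Proof.
move=> pk aik; have pN0 : (0 < p ^ N)%N by rewrite expn_gt0 prime_gt0.
apply: eq_card => x; rewrite !inE.
have pNE : (p ^ N = 1 + (p ^ N - 1))%N by rewrite subnKC.
have key : a ^+ e * x = x -> a ^+ (p ^ N) * x = a * x.
  by move=> /(regular_fix pk aik); rewrite {2}pNE expgnDr expg1 -mulgA => ->.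
apply/eqP/eqP => [axb|axb].
  rewrite -key //; have := fix_power_idem (e_exp _) axb.
  rewrite -expgnA mulnC -(prednK pN0) mulnS.
  by rewrite expg_eventually_periodic.
by rewrite key //; exact: fix_power_idem axb.
Qed.

(** If [x] were fixed, the power [m] of [a] would lie in the stabilizer of [x] and have a period [k]
    prime to [p]; then [(p ^ N - 1) * k] would be a period of [a] prime to [p]. *)
Lemma singular_fix a : (forall x, p'_monoid p (lstab x)) ->
    (forall i k, (0 < k)%N -> a ^+ i = a ^+ (i + k) -> p %| k)%N ->
  forall x, a ^+ (p ^ N - 1) * x <> x.
Proof.
move=> stab sing x ax; pose m := a ^+ (p ^ N - 1).
have pN_gt1 : (1 < p ^ N)%N by rewrite -{1}(expn0 p) ltn_exp2l // prime_gt1.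
have [i [k mik]] := index_period_exists e_gt0 (e_exp m).
have mS : m \in lstab x by rewrite inE; apply/eqP.
have /negP := stab x m mS i k mik; apply; have [k0 mE _] := mik.
have : (p %| (p ^ N - 1) * k)%N.
  apply: (sing ((p ^ N - 1) * i)%N); first by rewrite muln_gt0 subn_gt0 pN_gt1.
  by rewrite -mulnDr !expgnA.
rewrite Euclid_dvdM // => /orP[|//].
have ppN : (p %| p ^ N)%N by rewrite dvdn_exp.
move=> /(dvdn_sub ppN); rewrite subKn ?(ltnW pN_gt1) // dvdn1 => /eqP p1.
by move: p_prime; rewrite p1.
Qed.

End PowerOfPrime.
End Stabilizers.

(** * Congruences from a null vector of the Cartan matrix *)

Section PimRelations.
Variables (p : nat) (k : fieldType) (O : comNzRingType).
Variables (red : {rmorphism O -> k}) (lift : k -> O).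
Hypotheses (p_prime : prime p) (k_char : p \in [pchar k]) (liftK : cancel lift red).
Variables (M : finMonoidType) (n : nat).
Local Notation kM := (monoid_algebra k M).
Variables (Q : 'I_n -> lmodType kM) (Qreps : represents_pims Q).
Variables (e : 'I_n -> kM) (eprim : forall i, primitive_idem (e i)).
Hypothesis eiso : forall i, isomorphic_mod (principal (e i)) (Q i).
Variable N : nat.

Let c j (b : M) : O := lift (coeff (e j) b).
Let J : O -> Prop := Ipow red N.+1.

Let J0 : J 0. Proof. exact: Ipow_zero. Qed.
Let JD x y : J x -> J y -> J (x + y). Proof. exact: IpowD. Qed.
Let JN x : J x -> J (- x). Proof. exact: IpowN. Qed.

Definition element_trace (a : M) d (r : kM -> 'M[k]_d) : O := power_trace p lift N (r (dirac k a)).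

Lemma element_trace_conj a d d' (r : kM -> 'M[k]_d) (U : 'M_(d', d)) (U' : 'M_(d, d')) :
  U *m U' = 1%:M -> U' *m U = 1%:M ->
  J (element_trace a (fun x => U *m r x *m U') - element_trace a r).
Proof. by move=> _ U'U; exact: power_trace_conj. Qed.

Lemma element_trace_block a d d' (r : kM -> 'M[k]_d) (r' : kM -> 'M[k]_d') (C : kM -> 'M[k]_(d, d')) :
  J (element_trace a (fun x => block_mx (r x) (C x) 0 (r' x)) - (element_trace a r + element_trace a r')).
Proof. exact: power_trace_block. Qed.

Let phi a := invariant_of (element_trace a).

Lemma pim_word_sum a j :
  J (phi a (Q j) - word_sum (p ^ N) (c j) (fun b => (fixcount (a ^+ (p ^ N))%g b)%:R)).
Proof.
have [ee _ _] := eprim j; have fd := principal_fin_dim ee.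
have phi_add := invariant_of_additive JD JN (element_trace_conj a) (element_trace_block a).
apply: (J_trans JD) (invariant_iso JD JN phi_add fd (eiso j)) _.
have [d [r er]] := fin_dim_affords fd.
apply: (J_trans JD) (invariant_ofE (element_trace_conj a) er) _.
by apply: (power_trace_principal p_prime k_char liftK ee) => // b; exact: liftK.
Qed.

Variable v : 'I_n -> int.
Hypothesis Cv : forall i, \sum_j cartan_matrix Q i j * v j = 0.

Lemma pim_relation a :
  J (\sum_j word_sum (p ^ N) (c j) (fun b => (fixcount (a ^+ (p ^ N))%g b)%:R) *~ v j).
Proof.
have phi_add := invariant_of_additive JD JN (element_trace_conj a) (element_trace_block a).
rewrite -[X in J X]opprK; apply: JN; rewrite -[X in J X]add0r.
apply: (J_trans JD (y := \sum_j phi a (Q j) *~ v j)); last first.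
  rewrite -sumrB; apply: (J_sum J0 JD) => j _; rewrite -mulrzBl.
  exact/(J_mulrz J0 JD JN)/pim_word_sum.
apply: (J_sym JN).
have S0 : \sum_j (\sum_i phi a (mod_top (Q i)) *~ cartan_matrix Q i j) *~ v j = 0 :> O.
  under eq_bigr => j _ do rewrite mulrz_suml.
  rewrite exchange_big big1 // => i _.
  under eq_bigr => j _ do rewrite -mulrzA.
  by rewrite -mulrz_sumr Cv.
rewrite -[X in J (_ - X)]S0 -sumrB; apply: (J_sum J0 JD) => j _; rewrite -mulrzBl.
apply/(J_mulrz J0 JD JN).
exact: (invariant_cartan Qreps eprim eiso J0 JD JN phi_add).
Qed.

End PimRelations.

(** * Primitive idempotents acting on simple tops *)

Section TopRepresentation.
Variables (F : fieldType) (A : falgType F) (n : nat) (P : 'I_n -> lmodType A).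
Hypothesis Preps : represents_pims P.
Variable e : 'I_n -> A.
Hypotheses (e_prim : forall i, primitive_idem (e i))
  (e_iso : forall i, isomorphic_mod (principal (e i)) (P i)).
Variables (i : 'I_n) (d : nat) (r : A -> 'M[F]_d).
Hypothesis ir : affords (mod_top (P i)) r.

Lemma top_repr_idem_neq j : j != i -> r (e j) = 0.
Proof.
move=> ji; have [t [[tL tI _] tr]] := ir; have [ee _ _] := e_prim j.
apply: trmx_inj; apply/row_matrixP => l; rewrite trmx0 row0 rowE; apply: tI.
rewrite tr (F_linear0 tL); apply/eqP; apply: contraTT ji => sN; rewrite negbK.
have es : e j *: (e j *: t (delta_mx 0 l)) = e j *: t (delta_mx 0 l) by rewrite scalerA ee.
have Ppim : pim (P i) by case: Preps.
have := idem_simple_top Preps (e_prim j) (e_iso j) (pim_top_simple Ppim) es sN.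
by move/(top_inj Preps)/eqP.
Qed.

Lemma top_repr_idem_eq : (\rank (r (e i)))%:Z != 0.
Proof.
have [t [[tL tI tS] tr]] := ir.
have [s [es sN]] := idem_acts_on_top Preps (e_prim i) (e_iso i).
have [x sE] := (tS s).1 I.
rewrite eqz_nat mxrank_eq0; apply: contraNneq sN => r0.
by rewrite -es sE -tr r0 trmx0 mulmx0 (F_linear0 tL).
Qed.

End TopRepresentation.

(** * Vanishing of integral null vectors *)

Section Main.
Variables (p : nat) (p_prime : prime p) (M : finMonoidType).
Hypothesis stab : forall a : M, p'_monoid p (lstab a).
Variable e0 : nat.
Hypotheses (e0_gt0 : (0 < e0)%N) (e0_exp : forall b : M, (b ^+ (e0 + e0) = b ^+ e0)%g).
(** The whole contribution of characteristic zero, detached from complex modules because it will be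
    supplied by the opposite monoid. *)
Hypothesis class_span : forall f : M -> M -> int,
  (forall c a b, f c (a * b)%g = f c (b * a)%g) -> (forall c b, f c (b ^+ e0.+1)%g = f c b) ->
  exists (D : int) (w : M -> M -> int), D != 0 /\
    forall c b, D * f c b = \sum_y w c y * (fixcount y b)%:R.
Variables (k : fieldType) (k_char : p \in [pchar k]) (n : nat).
Variables (Q : 'I_n -> lmodType (monoid_algebra k M)) (Qreps : represents_pims Q).

Lemma word_sum_fixcount_regular_or_singular (O : comNzRingType) (red : {rmorphism O -> k}) N
    (a : M) : (0 < N)%N -> (e0`_p^' %| p ^ N - 1)%N ->
  (forall c, Ipow red N.+1 (word_sum (p ^ N) c (fun b => (fixcount a b)%:R))) \/
  forall b, fixcount (a ^+ (p ^ N))%g b = fixcount a b.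
Proof.
move=> N_gt0 pN1.
case: (pselect (exists i k', ~~ (p %| k')%N /\ (a ^+ i = a ^+ (i + k'))%g)).
  move=> [i [k' [pk' aik]]]; right=> b.
  exact: (regular_fixcount p_prime e0_gt0 e0_exp pN1 _ pk' aik).
move=> sing; left=> c.
apply: (@word_sum_singular _ _ _ red p_prime k_char _ N (logn p e0)) => x b axb; last first.
  apply: (singular_fix p_prime e0_gt0 N_gt0 e0_exp stab) => i k' _ aik.
  by apply: contrapT => /negP pk'; apply: sing; exists i, k'.
(* [a ^+ e0] fixes [x], and [e0] divides [(p ^ N - 1) * p ^ logn p e0]; hence the choice of
   [logn p e0] for the extra exponent in the order of the permutation of words. *)
have /dvdnP[q ->] := exponent_dvdn e0_gt0 pN1.
by rewrite mulnC; apply/fix_expM/(fix_power_idem (e0_exp a) axb).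
Qed.

Lemma left_stabilizer_nonsingular : \det (cartan_matrix Q) != 0.
Proof.
rewrite -det_tr; apply/negP => /det0P[v0 v0N v0C].
pose v j : int := v0 0 j.
have Cv i : \sum_j cartan_matrix Q i j * v j = 0.
  have /rowP/(_ i) := v0C; rewrite !mxE => v0i; apply: etrans v0i; apply: eq_bigr => j _.
  by rewrite !mxE mulrC.
have [e [eprim eiso]] := pim_idempotents Qreps.
have [O [red [phi [lift [O_torsion phi_frob red_phi liftK]]]]] := frobenius_lift_exists p_prime k_char.
(* The indicators of the classes, indexed by representatives; the function is 0 when [c] is not a
   chosen representative. *)
pose delta (c b : M) : int := (class_repr e0 b == c)%:R.
have [||D [w [D0 DE]]] := @class_span delta.
- move=> c a b; congr ((_ == c)%:R); apply: class_repr_eq; apply: connect1.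
  by apply/or3P/Or31; apply/existsP; exists a; apply/existsP; exists b; rewrite !eqxx.
- move=> c b; congr ((_ == c)%:R); apply/esym/class_repr_eq; apply: connect1.
  by apply/or3P/Or32.
case/eqP: v0N; apply/rowP => i; rewrite mxE -/(v i).
have Ppim : pim (Q i) by case: Qreps.
have fdtop : fin_dim (mod_top (Q i)).
  have [q qE] := quotmod_piS (mod_rad (V := Q i)).
  apply: (fin_dim_quot (g := q)) (pim_fin_dim Ppim) => x.
  by have [y yx] := quotmod_surj x; exists y; rewrite qE.
have [d [r ir]] := fin_dim_affords fdtop.
have ri0 := top_repr_idem_eq Qreps eprim eiso ir.
suff : D * v i * (\rank (r (e i)))%:Z = 0.
  by move=> /eqP; rewrite !mulf_eq0 (negbTE D0) (negbTE ri0) orbF => /eqP.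
apply: (Ipow_int_eq0 p_prime k_char O_torsion phi_frob red_phi) => m.
(* [N] is a multiple of [totient q], so [p ^ N] is 1 modulo [q] by Euler's theorem; the second
   factor makes [N] large enough to leave precision [m] after a loss of [e0]. *)
pose q := (e0`_p^')%N; pose N := (totient q * (m + e0).+1)%N.
have tot_gt0 : (0 < totient q)%N by rewrite totient_gt0 part_gt0.
have leN : (m + e0 < N)%N by rewrite leq_pmull.
have N_gt0 : (0 < N)%N by exact: leq_trans leN.
have e0N : (e0 <= N)%N by rewrite (leq_trans (leq_addl m e0)) // ltnW.
have pN1 : (q %| p ^ N - 1)%N.
  rewrite -eqn_mod_dvd ?expn_gt0 ?prime_gt0 // /N expnM -modnXm.
  rewrite (Euler_exp_totient (_ : coprime p q)) ?modnXm ?exp1n //.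
  by rewrite prime_coprime // -p'natE ?part_pnat ?part_gt0.
apply: (@Ipow_leq _ _ red m (N.+1 - e0)); first by lia.
set J := Ipow red _.
have J0 : J 0 by exact: Ipow_zero.
have JD x y : J x -> J y -> J (x + y) by exact: IpowD.
have JN x : J x -> J (- x) by exact: IpowN.
have JL x : Ipow red N.+1 x -> J x by apply: Ipow_leq; rewrite leq_subr.
pose c j (b : M) : O := lift (coeff (e j) b).
pose F b := power_trace p lift N (r (dirac k b)).
pose f b := F (class_repr e0 b).
pose ws j := word_sum (p ^ N) (c j).
have relX y : J (\sum_j ws j (fun b => (fixcount y b)%:R) *~ v j).
  have rel := pim_relation p_prime k_char liftK Qreps eprim eiso N Cv y.
  apply: JL; have [sing|reg] := word_sum_fixcount_regular_or_singular red y N_gt0 pN1.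
    by apply: Ipow_sum => j _; apply/IpowMz/sing.
  have regj j : ws j (fun b => (fixcount y b)%:R) = ws j (fun b => (fixcount (y ^+ (p ^ N))%g b)%:R).
    by congr (word_sum _ _ _); apply/funext => b; rewrite reg.
  by under eq_bigr => j _ do rewrite regj.
have rE j : r (e j) = \sum_b red (c j b) *: r (dirac k b).
  have [g gE] := linear_fun (affords_lin ir).
  rewrite {1}(dirac_sum (e j)) -gE linear_sum; apply: eq_bigr => b _.
  by rewrite linearZ /= gE /c liftK.
have ws_f j : J (ws j f - (\rank (r (e j)))%:R).
  have r1 : r (dirac k (1%g : M)) = 1%:M by rewrite dirac1 (affords1 ir).
  have rM a b : r (dirac k (a * b)%g) = r (dirac k a) *m r (dirac k b).
    by rewrite diracM (affordsM _ _ ir).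
  (* [e0] itself serves as the shift [N1] of the class-function congruences. *)
  have e0_le : (e0 <= p ^ e0)%N by rewrite ltnW // ltn_expl // prime_gt1.
  apply: (J_trans JD (y := power_trace p lift N (r (e j)))).
    rewrite rE; apply: (J_sym JN).
    exact: (word_sum_power_trace_class p_prime k_char liftK r1 rM e0_exp e0_le e0N
      (expg_pN p_prime e0_gt0 e0_exp pN1) (c j)).
  apply/JL/(power_trace_idem p_prime k_char liftK).
  by rewrite -(affordsM _ _ ir); have [-> _ _] := eprim j.
have fE b : D%:~R * f b = \sum_z F z * (\sum_y w z y * (fixcount y b)%:R)%:~R.
  under eq_bigr => z _ do rewrite -DE.
  rewrite (bigD1 (class_repr e0 b)) //= big1 ?addr0 => [|z /negbTE zb]; rewrite /delta.
    by rewrite eqxx mulr1 mulrC.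
  by rewrite eq_sym zb mulr0 mulr0z mulr0.
have D_ws j : D%:~R * ws j f =
    \sum_y (\sum_b F b * (w b y)%:~R) * ws j (fun b => (fixcount y b)%:R).
  rewrite /ws -word_sum_lin mulr_sumr; apply: eq_bigr => x _; rewrite mulrCA; congr (_ * _).
  rewrite fE; under [RHS]eq_bigr => y _ do rewrite mulr_suml.
  rewrite exchange_big; apply: eq_bigr => z _ /=; rewrite rmorph_sum mulr_sumr.
  by apply: eq_bigr => y _; rewrite rmorphM /= rmorph_nat mulrA.
have -> : (D * v i * (\rank (r (e i)))%:Z)%:~R = D%:~R * \sum_j (\rank (r (e j)))%:R *~ v j :> O.
  rewrite (bigD1 i) //= big1 ?addr0 => [|j ji].
    by rewrite !intrM -mulrA -(mulrzr (\rank (r (e i)))%:R (v i)); congr (_ * _); exact: mulrC.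
  by rewrite (top_repr_idem_neq Qreps eprim eiso ir ji) mxrank0 mul0rz.
have wsJ : J (D%:~R * \sum_j ws j f *~ v j).
  have -> : D%:~R * \sum_j ws j f *~ v j = \sum_y (\sum_b F b * (w b y)%:~R) *
      \sum_j ws j (fun b => (fixcount y b)%:R) *~ v j.
    under [RHS]eq_bigr => y _ do rewrite mulr_sumr.
    rewrite mulr_sumr exchange_big; apply: eq_bigr => j _ /=.
    rewrite mulrzAr D_ws mulrz_suml; apply: eq_bigr => y _.
    by rewrite mulrzAr.
  by apply: Ipow_sum => y _; apply/IpowMl/relX.
(* The ranks may be replaced by the word sums [ws j f], from which they differ by elements of
   [J]. *)
rewrite -[X in J X](subrK (D%:~R * \sum_j ws j f *~ v j)); apply: JD => //.
rewrite -mulrBr -sumrB; apply/IpowMl/Ipow_sum => j _; rewrite -mulrzBl.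
by apply: IpowMz; apply: (J_sym JN).
Qed.

End Main.

Theorem corollary6p5 (p : nat) (p_prime : prime p) (M : finMonoidType)
    (stab_p' : (forall a : M, p'_monoid p (lstab a)) \/
               (forall a : M, p'_monoid p (rstab a)))
    (R : realType) (n : nat)
    (P : 'I_n -> lmodType (monoid_algebra R[i] M)) (P_reps : represents_pims P)
    (CM_nonsing : \det (cartan_matrix P) != 0)
    (k : fieldType) (k_char : p \in [pchar k]) (m : nat)
    (Q : 'I_m -> lmodType (monoid_algebra k M)) (Q_reps : represents_pims Q) :
  \det (cartan_matrix Q) != 0.
Proof.
have [e0 e0_gt0 e0_exp] := idempotent_exponent M.
have e0_exp' (b : opposite_monoid M) : (b ^+ (e0 + e0) = b ^+ e0)%g.
  by rewrite !opp_expg.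
(* Characteristic zero yields functions in the first argument of [fixcount], while characteristic
   [p] consumes them in the second. For left stabilizers the complex side passes to the opposite
   monoid, for right stabilizers the side over [k]. *)
case: stab_p' => stab.
  have [P' P'_reps P'_det] := opposite_pims P_reps.
  apply: (left_stabilizer_nonsingular p_prime stab e0_gt0 e0_exp _ k_char Q_reps) => f fC fP.
  have [|c a b|c b|D [w [D0 DE]]] :=
      integral_class_function_span P'_reps _ e0_gt0 e0_exp' (f := f).
  - by rewrite P'_det.
  - exact: fC.
  - by rewrite opp_expg.
  exists D, w; split=> // c b; rewrite DE; apply: eq_bigr => y _.
  by rewrite opp_fixcount.
have [Q' Q'_reps <-] := opposite_pims Q_reps.
have stab' (a : opposite_monoid M) : p'_monoid p (lstab a) by exact/opp_lstab/stab.
apply: (left_stabilizer_nonsingular p_prime stab' e0_gt0 e0_exp' _ k_char Q'_reps) => f fC fP.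
have [c a b|c b|D [w [D0 DE]]] :=
    integral_class_function_span P_reps CM_nonsing e0_gt0 e0_exp (f := f).
- exact: fC b a.
- by rewrite -opp_expg.
exists D, w; split=> // c b; rewrite DE; apply: eq_bigr => y _.
by rewrite opp_fixcount.
Qed.
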